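(* Let $\Omega\subset\mathbb C$ be a set and let $C>0$, $\alpha\in(0,1)$ be constants such that for every integer $k\ge0$ $$\inf_{\deg(p)\le k}\ \sup_{z\in\Omega}|1-zp(z)|\le C\alpha^k,$$ where $p$ ranges over complex polynomials. Let $\varepsilon,\delta\in(0,1)$, let $M\in\mathbb C^{n\times n}$ be a matrix such that $\|M\|\le\mathrm{poly}(n)$ and $\Lambda_\delta(M)\subset\Omega$, and let $b\in\mathbb C^n$. Then, with high probability, the algorithm shatteredGMRES on input $(M,b)$, in $$k=O\left(\frac{\log(n/\delta)\log(n)+\log(1/\varepsilon)}{\log(1/\alpha)}\right)$$ iterations, outputs a vector $x$ such that, for some $\Delta_M\in\mathbb C^{n\times n}$ and $\delta_b\in\mathbb C^n$, $$(M+\Delta_M)x=b+\delta_b,\qquad \|\Delta_M\|\le\delta,\qquad \|\delta_b\|\le\varepsilon\|b\|,$$ and it uses $O\left(k\,\mathrm{nnz}(M)+kn\log^6(n)+k^2n\right)$ arithmetic operations.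
   Context: $\|\cdot\|$ denotes the Euclidean norm of vectors and the $\ell_2$ operator norm of matrices; $\mathrm{nnz}(M)$ is the number of nonzero entries of $M$; $\log$ is the natural logarithm. The $\delta$-pseudospectrum is $\Lambda_\delta(M)=\{z\in\mathbb C:\sigma_n(zI-M)\le\delta\}$, with $\sigma_n$ the smallest singular value. GMRES applied to a matrix $A$ and vector $b$ for $k$ iterations outputs $x_k=p_k(A)b$, where $p_k=\arg\min_{\deg(p)\le k}\|b-Ap(A)b\|$, the minimum being over complex polynomials $p$ of degree at most $k$. The amortized cost per iteration is $O(\mathrm{nnz}(A)+kn)$ arithmetic operations. The algorithm shatteredGMRES, on input $(M,b)$ with parameter $\delta$: sample the random matrix $N_g\in\mathbb C^{n\times n}$ whose entries are i.i.d. copies of $\beta\cdot g$, where $\beta\sim\mathrm{Bernoulli}(\rho)$ with $\rho=\log(n)^6/n$ and $g$ is an independent standard complex Gaussian (density $\pi^{-1}e^{-|z|^2}$ on $\mathbb C$); set $A=M+\frac{0.1\,\delta}{\sqrt n}N_g$; run GMRES on $A$ and $b$ for $k$ iterations and output the result. ''With high probability'' is over the draw of $N_g$ and means with probability tending to $1$ as $n\to\infty$. The condition $\|M\|\le\mathrm{poly}(n)$ means $\|M\|\le n^{c}$ for a fixed constant $c$; implied constants in $O(\cdot)$ may depend on $c$ and $C$. *)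

(* Defs.v *)
From HB Require Import structures.
From mathcomp Require Import all_boot all_order all_algebra.
From mathcomp Require Import all_classical all_reals all_analysis.
From mathcomp Require Export complex.
Set Implicit Arguments.
Unset Strict Implicit.
Unset Printing Implicit Defensive.
Import Order.TTheory GRing.Theory Num.Theory.
Import numFieldNormedType.Exports.
Local Open Scope classical_set_scope.
Local Open Scope ring_scope.
Local Open Scope complex_scope.
Local Open Scope sesquilinear_scope.

Definition cabs (R : realType) (z : R[i]) : R := ComplexField.Normc.normc z.

Definition vnorm (R : realType) n (v : 'cV[R[i]]_n) : R :=
  Num.sqrt (\sum_(i < n) cabs (v i 0) ^+ 2).

(* The `|_| notation of MathComp-Analysis on matrices is the max norm. *)
Definition opnorm (R : realType) n (M : 'M[R[i]]_n) : R :=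
  sup [set vnorm (M *m v) | v in [set v : 'cV[R[i]]_n | vnorm v <= 1]].

Definition nnz (R : realType) n (M : 'M[R[i]]_n) : nat :=
  #|[set ij : 'I_n * 'I_n | M ij.1 ij.2 != 0]|.

Definition singular_value (R : realType) n (M : 'M[R[i]]_n) (s : R) : Prop :=
  0 <= s /\ eigenvalue (M ^t* *m M) (s ^+ 2)%:C.

(* For n > 0 the set is finite and nonempty, so the infimum is a minimum. *)
Definition sigma_min (R : realType) n (M : 'M[R[i]]_n) : R :=
  inf [set s | singular_value M s].

Definition pseudospectrum (R : realType) n (delta : R) (M : 'M[R[i]]_n) :
  set R[i] := [set z | sigma_min (z%:M - M) <= delta].

(* mathcomp's horner_mx is only available for matrices of size n.+1;
   [size p <= k.+1] says that p has degree at most k. *)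
Definition mxpoly_eval (R : realType) n (p : {poly R[i]}) (A : 'M[R[i]]_n) :
  'M[R[i]]_n := \sum_(i < size p) p`_i *: A ^+ i.

Definition gmres_residual (R : realType) n (A : 'M[R[i]]_n) (b : 'cV[R[i]]_n)
    (p : {poly R[i]}) : R :=
  vnorm (b - A *m (mxpoly_eval p A *m b)).

(* A relation, because the minimizer need not be unique when A is singular. *)
Definition gmres_output (R : realType) n (A : 'M[R[i]]_n) (b : 'cV[R[i]]_n)
    (k : nat) (x : 'cV[R[i]]_n) : Prop :=
  exists p : {poly R[i]},
    [/\ (size p <= k.+1)%N,
        forall q : {poly R[i]}, (size q <= k.+1)%N ->
          gmres_residual A b p <= gmres_residual A b q
      & x = mxpoly_eval p A *m b].

(* inf over deg p <= k of sup over z in Omega of |1 - z p(z)| *)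
Definition approx_error (R : realType) (Omega : set R[i]) (k : nat) : \bar R :=
  ereal_inf [set ereal_sup [set (cabs (1 - z * p.[z]))%:E | z in Omega]
            | p in [set p : {poly R[i]} | (size p <= k.+1)%N]].

(* Algebraic computation trees: the algorithm is a finite tree whose nodes
   perform an arithmetic operation on earlier values or branch on whether a
   value is zero, and whose leaves list the coordinates of the output.
   The constants in a tree are fixed before the input is known. *)
Inductive operand (I F : Type) : Type :=
  | Input of I
  | Const of F
  | Temp of nat.  (* the result of the j-th operation, counted from 0 *)

Inductive arith_op (I F : Type) : Type :=
  | Add of operand I F & operand I F
  | Sub of operand I F & operand I F
  | Mul of operand I F & operand I F
  | Div of operand I F & operand I F
  | Conj of operand I F
  | Sqrt of operand I F.

Inductive ctree (I F : Type) (n : nat) : Type :=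
  | Return of ('I_n -> operand I F)
  | Compute of arith_op I F & ctree I F n
  | IfZero of operand I F & ctree I F n & ctree I F n.

Section Execution.
Context {I : Type} {F : numClosedFieldType} {n : nat} (input : I -> F).

Definition operand_val (tmp : seq F) (o : operand I F) : F :=
  match o with
  | Input i => input i
  | Const a => a
  | Temp j => nth 0 tmp j
  end.

Definition arith_op_val (tmp : seq F) (o : arith_op I F) : F :=
  match o with
  | Add x y => operand_val tmp x + operand_val tmp y
  | Sub x y => operand_val tmp x - operand_val tmp y
  | Mul x y => operand_val tmp x * operand_val tmp y
  | Div x y => operand_val tmp x / operand_val tmp y
  | Conj x => Num.conj (operand_val tmp x)
  | Sqrt x => sqrtC (operand_val tmp x)
  end.

(* The output together with the number of arithmetic operations performed;
   as the matrices are sparse, finding the zero entries is not counted. *)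
Fixpoint exec (t : ctree I F n) (tmp : seq F) : 'cV[F]_n * nat :=
  match t with
  | Return out => (\col_i operand_val tmp (out i), 0%N)
  | Compute o t' =>
      let r := exec t' (rcons tmp (arith_op_val tmp o)) in (r.1, r.2.+1)
  | IfZero o t1 t2 =>
      if operand_val tmp o == 0 then exec t1 tmp else exec t2 tmp
  end.

Definition ctree_output (t : ctree I F n) : 'cV[F]_n := (exec t [::]).1.
Definition ctree_ops (t : ctree I F n) : nat := (exec t [::]).2.

End Execution.

(* shatteredGMRES reads M, b, delta and the sampled noise matrix N. *)
Inductive sg_slot (n : nat) : Type :=
  | slot_M of 'I_n & 'I_n
  | slot_N of 'I_n & 'I_n
  | slot_b of 'I_n
  | slot_delta.
Arguments slot_delta {n}.

Definition sg_input (R : realType) n (delta : R) (M N : 'M[R[i]]_n)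
    (b : 'cV[R[i]]_n) (s : sg_slot n) : R[i] :=
  match s with
  | slot_M i j => M i j
  | slot_N i j => N i j
  | slot_b i => b i 0
  | slot_delta => delta%:C
  end.

Definition shattered (R : realType) n (delta : R) (M N : 'M[R[i]]_n) :
  'M[R[i]]_n := M + (10^-1 * delta / Num.sqrt n%:R)%:C *: N.

Definition implements_shatteredGMRES (R : realType) n (k : nat)
    (t : ctree (sg_slot n) R[i] n) : Prop :=
  forall (delta : R) (M N : 'M[R[i]]_n) (b : 'cV[R[i]]_n),
    gmres_output (shattered delta M N) b k
      (ctree_output (sg_input delta M N b) t).

Definition mutually_independent d (T : measurableType d) (R : realType)
    (P : probability T R) (I : finType) (S : I -> set (set T)) : Prop :=
  forall (J : {set I}) (E : I -> set T), (forall i, i \in J -> S i (E i)) ->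
    P (\bigcap_(i in [set` J]) E i) = (\prod_(i in J) P (E i))%E.

(* The events determined by X. *)
Definition events_of d (T : measurableType d) d' (U : measurableType d')
    (X : T -> U) : set (set T) :=
  [set X @^-1` B | B in measurable].

Definition reim (R : realType) (z : R[i]) : R * R := (complex.Re z, complex.Im z).

Definition std_complex_gaussian d (T : measurableType d) (R : realType)
    (P : probability T R) (g : T -> R[i]) : Prop :=
  measurable_fun setT (fun w => reim (g w)) /\
  forall B : set (R * R), measurable B ->
    P ((fun w => reim (g w)) @^-1` B) =
    (\int[(@lebesgue_measure R \x @lebesgue_measure R)%E]_(z in B)
       (pi^-1 * expR (- (z.1 ^+ 2 + z.2 ^+ 2)))%:E)%E.

Definition bernoulli_rv d (T : measurableType d) (R : realType)
    (P : probability T R) (p : R) (X : T -> bool) : Prop :=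
  measurable_fun setT X /\
  forall B : set bool, P (X @^-1` B) = bernoulli_prob p B.

Definition noise_matrix d (T : measurableType d) (R : realType) n
    (beta : 'I_n -> 'I_n -> T -> bool) (g : 'I_n -> 'I_n -> T -> R[i]) (w : T) :
  'M[R[i]]_n := \matrix_(i, j) ((beta i j w)%:R * g i j w).

(* [inl] indexes the Bernoulli variables and [inr] the Gaussian ones. *)
Definition sparse_gaussian d (T : measurableType d) (R : realType)
    (P : probability T R) n (rho : R)
    (beta : 'I_n -> 'I_n -> T -> bool) (g : 'I_n -> 'I_n -> T -> R[i]) : Prop :=
  [/\ forall i j, bernoulli_rv P rho (beta i j),
      forall i j, std_complex_gaussian P (g i j)
    & mutually_independent P
        (fun s : ('I_n * 'I_n) + ('I_n * 'I_n) =>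
           match s with
           | inl ij => events_of (beta ij.1 ij.2)
           | inr ij => events_of (fun w => reim (g ij.1 ij.2 w))
           end)].

Definition sg_rho (R : realType) (n : nat) : R := ln n%:R ^+ 6 / n%:R.

(* G may fail to be measurable. *)
Definition prob_at_least d (T : measurableType d) (R : realType)
    (P : probability T R) (G : set T) (q : R) : Prop :=
  exists E : set T, [/\ measurable E, E `<=` G & (q%:E <= P E)%E].

Definition approx_solution (R : realType) n (eps delta : R) (M : 'M[R[i]]_n)
    (b x : 'cV[R[i]]_n) : Prop :=
  exists (DeltaM : 'M[R[i]]_n) (deltab : 'cV[R[i]]_n),
    [/\ (M + DeltaM) *m x = b + deltab,
        opnorm DeltaM <= delta
      & vnorm deltab <= eps * vnorm b].

Definition iteration_bound (R : realType) (n : nat) (alpha eps delta : R) : R :=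
  (ln (n%:R / delta) * ln n%:R + ln eps^-1) / ln alpha^-1.

Definition ops_bound (R : realType) n (k : nat) (M : 'M[R[i]]_n) : R :=
  (k * nnz M)%:R + (k * n)%:R * ln n%:R ^+ 6 + (k ^ 2 * n)%:R.

(* Main.v *)
(** Randomness is needed only to control the noise: with high probability every row
    and column of N_g has O(log^6 n) nonzero entries, each of size at most log n, so
    that ||A - M|| <= delta/2 and nnz(N_g) = O(n log^6 n).  Everything else is
    deterministic.

    Convergence.  The sublevel set of sigma_n(z - A) at level delta/2 lies in Omega.
    Cutting off q(z) (z - A)^-1 with a Lipschitz function of sigma_n(z - A), the
    Cauchy-Pompeiu formula bounds ||q(A)|| by O((||A|| / delta)^2) times the supremum
    of |q| over Omega; no eigenvector condition number enters.  The formula is proved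
    with Riemann sums over a square lattice whose mesh tends to 0, summation by parts
    replacing integration, and comparison with a second, radial cutoff replacing the
    winding number.  GMRES with k steps then has relative residual at most
    (n / delta)^O(1) alpha^k.

    Rounding k down is harmless: by quadratic interpolation around an eigenvalue of M
    the hypothesis for k = 1 already forces 1/alpha <= (n / delta)^O(1).

    Cost.  The iterate is computed by orthogonalising the vectors A y against each
    other while updating the y simultaneously, in O(nnz(A) + k n) operations per step. *)

Require Import Defs.
From HB Require Import structures.
From mathcomp Require Import all_boot all_order all_algebra.
From mathcomp Require Import all_classical all_reals all_analysis.
From mathcomp Require Import complex.
From mathcomp Require Import measurable_realfun zify ring lra.
Import Order.TTheory GRing.Theory Num.Theory.
Import numFieldNormedType.Exports.
Local Open Scope classical_set_scope.
Local Open Scope ring_scope.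
Local Open Scope complex_scope.
Local Open Scope sesquilinear_scope.

(** * Norms and singular values *)

(** A contour integral of [q(z) (z - A)^-1] would need a curve of controlled length inside the
    pseudospectrum, and the boundary of a sublevel set of sigma_n offers none a priori. A cutoff
    trades length for area. With [a] a bound on [A] and [d] the level, sigma_n(z - A) is 1-Lipschitz
    in [z], so its cutoff has gradient O(1/d); where this gradient lives the resolvent is O(1/d) and
    [|q|] is at most its supremum; the area involved is O(a^2). The product is the factor
    [(a / d)^2]. The cutoff is only Lipschitz, so symmetric differences replace derivatives and
    summation by parts moves them onto the holomorphic factor. There the error is O(h^3) at each of
    O(h^-2) lattice points, O(h) in total. The radial cutoff varies only far from the spectrum,
    where [(z - A)^-1 = z^-1 (1 + A (z - A)^-1)] and [A (z - A)^-1] has norm at most 1/L. The first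
    term yields [q(A) b] times the winding sum, of which a crude lower bound is enough: a large
    constant [L] makes the second term absorbable. *)

Section Cabs.
Context {R : realType}.
Implicit Types (z w : R[i]).

Lemma normCE z : `|z| = (cabs z)%:C.
Proof. by case: z. Qed.

Lemma cabs_ge0 z : 0 <= cabs z.
Proof. by case: z => a b; exact: sqrtr_ge0. Qed.

Lemma cabsM z w : cabs (z * w) = cabs z * cabs w.
Proof. exact: ComplexField.Normc.normcM. Qed.

Lemma cabsV z : cabs z^-1 = (cabs z)^-1.
Proof. exact: ComplexField.Normc.normcV. Qed.

Lemma cabs0 : cabs (0 : R[i]) = 0.
Proof. exact: ComplexField.Normc.normc0. Qed.

Lemma cabs1 : cabs (1 : R[i]) = 1.
Proof. exact: ComplexField.Normc.normc1. Qed.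

Lemma cabsN z : cabs (- z) = cabs z.
Proof. by case: z => a b; rewrite /cabs /= !sqrrN. Qed.

Lemma cabsB z w : cabs (z - w) = cabs (w - z).
Proof. by rewrite -cabsN opprB. Qed.

Lemma cabs_eq0 z : (cabs z == 0) = (z == 0).
Proof.
apply/eqP/eqP => [|->]; [exact: ComplexField.Normc.eq0_normc | exact: cabs0].
Qed.

Lemma cabs_gt0 z : (0 < cabs z) = (z != 0).
Proof. by rewrite lt_def cabs_ge0 andbT cabs_eq0. Qed.

Lemma cabsD z w : cabs (z + w) <= cabs z + cabs w.
Proof. by rewrite -lecR raddfD /= -!normCE ler_normD. Qed.

Lemma cabsX z k : cabs (z ^+ k) = cabs z ^+ k.
Proof. by elim: k => [|k IH]; rewrite ?expr0 ?cabs1 // !exprS cabsM IH. Qed.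

Lemma cabs_real (x : R) : cabs x%:C = `|x|.
Proof. by rewrite /cabs /= expr0n /= addr0 sqrtr_sqr. Qed.

Lemma cabs_i : cabs ('i : R[i]) = 1.
Proof. by rewrite /cabs /= expr0n /= add0r expr1n sqrtr1. Qed.

Lemma cabs_sqr z : cabs z ^+ 2 = complex.Re z ^+ 2 + complex.Im z ^+ 2.
Proof. by case: z => a b; rewrite /cabs /= sqr_sqrtr // addr_ge0 // sqr_ge0. Qed.

Lemma cabs_sqrC z : (cabs z ^+ 2)%:C = z^* * z.
Proof. by rewrite mulrC -normCK normCE -rmorphXn. Qed.

Lemma Re_le_cabs z : complex.Re z <= cabs z.
Proof.
apply: le_trans (ler_norm _) _; rewrite -sqrtr_sqr; case: z => a b /=.
by rewrite ler_sqrt ?lerDl ?addr_ge0 ?sqr_ge0.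
Qed.

Lemma Im_le_cabs z : `|complex.Im z| <= cabs z.
Proof.
by rewrite -sqrtr_sqr; case: z => a b /=; rewrite ler_sqrt ?lerDr ?addr_ge0 ?sqr_ge0.
Qed.

Lemma cabs_sum (I : Type) (s : seq I) (P : pred I) (F : I -> R[i]) :
  cabs (\sum_(i <- s | P i) F i) <= \sum_(i <- s | P i) cabs (F i).
Proof.
elim/big_rec2: _ => [|i x y _ H]; first by rewrite cabs0.
by apply: le_trans (cabsD _ _) _; rewrite lerD2l.
Qed.

Lemma cabs_triangle z w : cabs z - cabs w <= cabs (z - w).
Proof. by rewrite lerBlDr; have := cabsD (z - w) w; rewrite subrK. Qed.

End Cabs.

(** * Euclidean norm, operator bounds and a Schur test *)

Section Vnorm.
Context {R : realType} {n : nat}.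
Implicit Types (u v : 'cV[R[i]]_n) (A B : 'M[R[i]]_n).

Definition dot u v : R[i] := (u ^t* *m v) 0 0.

Lemma dotE u v : dot u v = \sum_i (u i 0)^* * v i 0.
Proof. by rewrite /dot mxE; apply: eq_bigr => i _; rewrite !mxE. Qed.

Lemma vnorm_ge0 v : 0 <= vnorm v.
Proof. exact: sqrtr_ge0. Qed.

Lemma vnorm_sqr v : vnorm v ^+ 2 = \sum_i cabs (v i 0) ^+ 2.
Proof. by rewrite /vnorm sqr_sqrtr // sumr_ge0 // => i _; rewrite sqr_ge0. Qed.

Lemma dot_vv v : dot v v = (vnorm v ^+ 2)%:C.
Proof.
by rewrite dotE vnorm_sqr rmorph_sum /=; apply: eq_bigr => i _; rewrite cabs_sqrC.
Qed.

Lemma vnorm0 : vnorm (0 : 'cV[R[i]]_n) = 0.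
Proof.
by apply/eqP; rewrite -sqrf_eq0 vnorm_sqr big1 // => i _; rewrite mxE cabs0 expr0n.
Qed.

Lemma vnorm_eq0 v : (vnorm v == 0) = (v == 0).
Proof.
apply/eqP/eqP => [v0|->]; last exact: vnorm0.
apply/matrixP => i j; rewrite ord1 mxE; apply/eqP; rewrite -cabs_eq0 -sqrf_eq0.
have /eqP := vnorm_sqr v; rewrite v0 expr0n /= eq_sym psumr_eq0 => [/allP H|k _].
  exact: (implyP (H i (mem_index_enum i))).
exact: sqr_ge0.
Qed.

Lemma vnorm_gt0 v : (0 < vnorm v) = (v != 0).
Proof. by rewrite lt_def vnorm_ge0 andbT vnorm_eq0. Qed.

Lemma vnormZ (a : R[i]) v : vnorm (a *: v) = cabs a * vnorm v.
Proof.
apply/eqP; rewrite -(@eqrXn2 _ 2) ?mulr_ge0 ?cabs_ge0 ?vnorm_ge0 //; apply/eqP.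
rewrite exprMn !vnorm_sqr mulr_sumr; apply: eq_bigr => i _.
by rewrite mxE cabsM exprMn.
Qed.

Lemma vnormN v : vnorm (- v) = vnorm v.
Proof. by rewrite -scaleN1r vnormZ cabsN cabs1 mul1r. Qed.

Lemma cauchy_schwarz (I : finType) (P : pred I) (x y : I -> R) :
  (\sum_(i | P i) x i * y i) ^+ 2 <=
  (\sum_(i | P i) x i ^+ 2) * (\sum_(i | P i) y i ^+ 2).
Proof.
set a := \sum_(i | P i) x i ^+ 2; set b := \sum_(i | P i) y i ^+ 2.
set d := \sum_(i | P i) x i * y i.
have a0 : 0 <= a by apply: sumr_ge0 => i _; exact: sqr_ge0.
have H (t : R) : 0 <= a * t ^+ 2 + (- 2 * d) * t + b.
  have -> : a * t ^+ 2 + (- 2 * d) * t + b = \sum_(i | P i) (x i * t - y i) ^+ 2.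
    rewrite /a /b /d mulr_suml mulr_sumr mulr_suml -!big_split /=.
    by apply: eq_bigr => i _; ring.
  by apply: sumr_ge0 => i _; exact: sqr_ge0.
move: a0; rewrite le_eqVlt => /orP[/eqP a0|a0]; last first.
  have := H (d / a).
  have -> : a * (d / a) ^+ 2 + - 2 * d * (d / a) + b = (a * b - d ^+ 2) / a.
    by field; rewrite gt_eqF.
  by rewrite pmulr_lge0 ?invr_gt0 // subr_ge0.
have x0 i : P i -> x i = 0.
  move=> Pi; apply/eqP; rewrite -sqrf_eq0.
  move/esym/eqP: a0; rewrite psumr_eq0 => [/allP H0|j _]; last exact: sqr_ge0.
  by have := H0 i (mem_index_enum i); rewrite Pi.
by rewrite -a0 mul0r /d big1 ?expr0n // => i Pi; rewrite x0 // mul0r.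
Qed.

Lemma vnormD u v : vnorm (u + v) <= vnorm u + vnorm v.
Proof.
rewrite -(@ler_pXn2r _ 2) ?nnegrE ?addr_ge0 ?vnorm_ge0 //.
rewrite vnorm_sqr sqrrD !vnorm_sqr.
have CS : \sum_i cabs (u i 0) * cabs (v i 0) <= vnorm u * vnorm v.
  rewrite -(@ler_pXn2r _ 2) ?nnegrE ?mulr_ge0 ?vnorm_ge0 //; last first.
    by apply: sumr_ge0 => i _; rewrite mulr_ge0 ?cabs_ge0.
  by rewrite exprMn !vnorm_sqr; exact: cauchy_schwarz.
apply: (@le_trans _ _ (\sum_i (cabs (u i 0) + cabs (v i 0)) ^+ 2)).
  apply: ler_sum => i _; rewrite mxE ler_pXn2r ?nnegrE ?addr_ge0 ?cabs_ge0 //.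
  exact: cabsD.
have -> : \sum_i (cabs (u i 0) + cabs (v i 0)) ^+ 2 = \sum_i cabs (u i 0) ^+ 2 +
    (\sum_i cabs (u i 0) * cabs (v i 0)) *+ 2 + \sum_i cabs (v i 0) ^+ 2.
  by rewrite -sumrMnl -!big_split /=; apply: eq_bigr => i _; rewrite sqrrD.
by rewrite lerD2r lerD2l ler_pMn2r.
Qed.

Lemma vnormB u v : vnorm (u - v) <= vnorm u + vnorm v.
Proof. by rewrite -[vnorm v]vnormN vnormD. Qed.

Lemma vnorm_triangle u v : vnorm u - vnorm v <= vnorm (u - v).
Proof. by rewrite lerBlDr; have := vnormD (u - v) v; rewrite subrK. Qed.

Lemma vnorm_sum (I : Type) (s : seq I) (P : pred I) (F : I -> 'cV[R[i]]_n) :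
  vnorm (\sum_(i <- s | P i) F i) <= \sum_(i <- s | P i) vnorm (F i).
Proof.
elim/big_rec2: _ => [|i x y _ H]; first by rewrite vnorm0.
by apply: le_trans (vnormD _ _) _; rewrite lerD2l.
Qed.

(** A one-sided substitute for the operator norm: such bounds add and compose without handling a
    supremum. *)
Definition mxbound (a : R) A := forall v, vnorm (A *m v) <= a * vnorm v.

(** Only finiteness matters: it bounds the set whose supremum is [opnorm]. *)
Lemma frobenius_bound A : exists2 a, 0 <= a & mxbound a A.
Proof.
pose a2 := \sum_i \sum_j cabs (A i j) ^+ 2.
have a0 : 0 <= a2 by do 2 (apply: sumr_ge0 => ? _); exact: sqr_ge0.
exists (Num.sqrt a2); first exact: sqrtr_ge0.
move=> v; rewrite -(@ler_pXn2r _ 2) ?nnegrE ?mulr_ge0 ?sqrtr_ge0 ?vnorm_ge0 //.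
rewrite exprMn (sqr_sqrtr a0) vnorm_sqr /a2 mulr_suml; apply: ler_sum => i _.
rewrite vnorm_sqr; apply: le_trans (cauchy_schwarz _ _ _ _).
rewrite ler_pXn2r ?nnegrE ?cabs_ge0 ?sumr_ge0 // => [|j _].
  rewrite mxE; apply: le_trans (cabs_sum _ _ _ _) _.
  by apply: ler_sum => j _; rewrite cabsM.
by rewrite mulr_ge0 ?cabs_ge0.
Qed.

Lemma opnorm_mxbound A : mxbound (opnorm A) A.
Proof.
have [a a0 aA] := frobenius_bound A.
set S := [set vnorm (A *m v) | v in [set v : 'cV[R[i]]_n | vnorm v <= 1]].
have supS : has_sup S.
  split; first by exists (vnorm (A *m 0)), 0 => //=; rewrite vnorm0 ler01.
  exists a => _ [v /= v1 <-]; apply: le_trans (aA v) _.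
  by rewrite -[leRHS]mulr1 ler_wpM2l.
move=> v; have [->|v0] := eqVneq v 0; first by rewrite mulmx0 vnorm0 mulr0.
have nv : 0 < vnorm v by rewrite vnorm_gt0.
have : vnorm (A *m ((vnorm v)^-1%:C *: v)) <= opnorm A.
  apply: sup_upper_bound => //; exists ((vnorm v)^-1%:C *: v) => //=.
  by rewrite vnormZ cabs_real ger0_norm ?invr_ge0 ?vnorm_ge0 // mulVf // gt_eqF.
rewrite -scalemxAr vnormZ cabs_real ger0_norm ?invr_ge0 ?vnorm_ge0 //.
by rewrite ler_pdivrMl // mulrC.
Qed.

Lemma mxbound_opnorm a A : 0 <= a -> mxbound a A -> opnorm A <= a.
Proof.
move=> a0 aA; apply: ge_sup; first by exists (vnorm (A *m 0)), 0 => //=; rewrite vnorm0 ler01.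
by move=> _ [v /= v1 <-]; apply: le_trans (aA v) _; rewrite -[leRHS]mulr1 ler_wpM2l.
Qed.

(** Cauchy-Schwarz in each row against the 0-1 pattern of [A] costs the row count; exchanging the
    sums costs the column count. The Frobenius norm would only give [sqrt (n m) t], too large for
    noise scaled by [1 / sqrt n]. *)
Lemma mxbound_schur A (m t : R) : 0 <= m -> 0 <= t ->
  (forall i j, cabs (A i j) <= t) ->
  (forall i, #|[pred j | A i j != 0]|%:R <= m) ->
  (forall j, #|[pred i | A i j != 0]|%:R <= m) -> mxbound (m * t) A.
Proof.
move=> m0 t0 At Ar Ac v.
rewrite -(@ler_pXn2r _ 2) ?nnegrE ?mulr_ge0 ?vnorm_ge0 //.
pose I i j : R := (A i j != 0)%:R.
have row i : cabs ((A *m v) i 0) ^+ 2 <= m * t ^+ 2 * \sum_j I i j * cabs (v j 0) ^+ 2.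
  have -> : m * t ^+ 2 * \sum_j I i j * cabs (v j 0) ^+ 2 =
      m * \sum_j (t * (I i j * cabs (v j 0))) ^+ 2.
    rewrite -mulrA; congr (_ * _); rewrite mulr_sumr; apply: eq_bigr => j _.
    by rewrite !exprMn /I; case: (A i j != 0); rewrite ?expr1n // expr0n.
  apply: (@le_trans _ _ ((\sum_j I i j * (t * (I i j * cabs (v j 0)))) ^+ 2)).
    rewrite ler_pXn2r ?nnegrE ?cabs_ge0 ?sumr_ge0 // => [|j _]; last first.
      by rewrite /I !mulr_ge0 ?ler0n ?cabs_ge0.
    rewrite mxE; apply: le_trans (cabs_sum _ _ _ _) _; apply: ler_sum => j _.
    rewrite cabsM /I; have [->|_] := eqVneq (A i j) 0; first by rewrite cabs0 !mul0r.
    by rewrite !mul1r ler_wpM2r ?cabs_ge0.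
  apply: le_trans (cauchy_schwarz _ _ _ _) _; apply: ler_wpM2r.
    by apply: sumr_ge0 => j _; exact: sqr_ge0.
  apply: le_trans (Ar i); rewrite -sum1_card natr_sum [leRHS]big_mkcond /=.
  apply: ler_sum => j _; rewrite inE /I; case: (A i j != 0); rewrite ?expr1n //.
  by rewrite expr0n.
rewrite vnorm_sqr; apply: le_trans (ler_sum _ (fun i _ => row i)) _.
rewrite -mulr_sumr exchange_big /= !exprMn.
have -> : m ^+ 2 * t ^+ 2 * vnorm v ^+ 2 = m * t ^+ 2 * (m * vnorm v ^+ 2) by ring.
apply: ler_wpM2l; first by rewrite mulr_ge0 ?sqr_ge0.
rewrite vnorm_sqr mulr_sumr; apply: ler_sum => j _; rewrite -mulr_suml.
apply: ler_wpM2r; first exact: sqr_ge0.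
apply: le_trans (Ac j); rewrite -sum1_card natr_sum [leRHS]big_mkcond /=.
by apply: ler_sum => i _; rewrite inE /I; case: (A i j != 0).
Qed.

End Vnorm.

Lemma nnzE {R : realType} n (M : 'M[R[i]]_n) :
  nnz M = (\sum_i \sum_j (M i j != 0%R))%N.
Proof.
rewrite /nnz -sum1_card pair_big /= big_mkcond /=; apply: eq_bigr => ij _.
case: ifPn => [/set_mem /= -> //|/negP H].
by case: (boolP (M _ _ != 0)) => // ne; case: H; apply/mem_set.
Qed.

(** * The smallest singular value through the spectral theorem *)

Section SigmaMin.
Context {R : realType} {n : nat}.
Implicit Types (B : 'M[R[i]]_n) (v : 'cV[R[i]]_n).

(** Singular values are defined through eigenvalues, so [B^t* *m B] is diagonalised unitarily:
    [vnorm (B *m v) ^+ 2] becomes a sum of the [cabs ((U *m v) i 0) ^+ 2] weighted by squared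
    singular values. *)
Lemma sigma_min_le B v : sigma_min B * vnorm v <= vnorm (B *m v).
Proof.
case: n B v => [|m] B v.
  by rewrite (_ : v = 0) ?mulmx0 ?vnorm0 ?mulr0 //; apply/matrixP => -[].
have herm : B^t* *m B \is hermsymmx.
  apply/is_hermitianmxP; rewrite expr0 scale1r trmx_mul map_mxM /=.
  by rewrite trmxCK.
have := hermitian_normalmx herm => /orthomx_spectralP.
set U := spectralmx _; set d := spectral_diag _ => BE.
have Uu : U \is unitarymx by exact: spectral_unitarymx.
have Uinv : U \in unitmx by exact: unitarymx_unit.
have dR i : d 0 i = (complex.Re (d 0 i))%:C.
  by have /mxOverP /(_ 0 i) /RRe_real -> := hermitian_spectral_diag_real herm.
have Un w : vnorm (U *m w) = vnorm w.
  apply/eqP; rewrite -(@eqrXn2 _ 2) ?vnorm_ge0 //; apply/eqP.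
  suff /(congr1 (@complex.Re R)) : (vnorm (U *m w) ^+ 2)%:C = (vnorm w ^+ 2)%:C by [].
  rewrite -!dot_vv /dot trmx_mul map_mxM /= mulmxA -(mulmxA (w^t*)).
  by rewrite -(invmx_unitary Uu) mulVmx ?mulmx1.
have Bn w : vnorm (B *m w) ^+ 2 =
    \sum_i complex.Re (d 0 i) * cabs ((U *m w) i 0) ^+ 2.
  suff /(congr1 (@complex.Re R)) /= -> : (vnorm (B *m w) ^+ 2)%:C =
      \sum_i d 0 i * (cabs ((U *m w) i 0) ^+ 2)%:C.
    by rewrite raddf_sum /=; apply: eq_bigr => i _; rewrite dR /= mul0r subr0.
  rewrite -dot_vv /dot trmx_mul map_mxM /= mulmxA -(mulmxA (w^t*)) BE.
  rewrite invmx_unitary // -!mulmxA mulmxA.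
  have -> : w^t* *m U^t* = (U *m w)^t* by rewrite trmx_mul map_mxM.
  rewrite mxE; apply: eq_bigr => i _.
  by rewrite mul_diag_mx !mxE cabs_sqrC mulrCA.
have d0 i : 0 <= complex.Re (d 0 i).
  have := Bn (invmx U *m delta_mx i 0); rewrite mulKVmx // (bigD1 i) //= big1.
    by rewrite !mxE !eqxx cabs1 expr1n mulr1 addr0 => <-; exact: sqr_ge0.
  by move=> j ji; rewrite mxE (negbTE ji) cabs0 expr0n mulr0.
have sv i : singular_value B (Num.sqrt (complex.Re (d 0 i))).
  split; first exact: sqrtr_ge0.
  (* [eigenvalue] speaks of row vectors, so the rows of [U] are the eigenvectors. *)
  rewrite sqr_sqrtr // -dR; apply/eigenvalueP; exists (row i U).
    rewrite -row_mul BE !mulmxA mulmxV // mul1mx.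
    by apply/rowP => j; rewrite mul_diag_mx !mxE.
  apply/negP => /eqP r0.
  have : row i U *m invmx U = 0 by rewrite r0 mul0mx.
  rewrite -row_mul mulmxV // => /rowP /(_ i) /eqP; rewrite !mxE eqxx.
  by rewrite oner_eq0.
have sle i : sigma_min B <= Num.sqrt (complex.Re (d 0 i)).
  apply: ge_inf; last exact: sv.
  by exists 0 => s [].
have s0 : 0 <= sigma_min B.
  by apply: lb_le_inf => [|s []//]; exists (Num.sqrt (complex.Re (d 0 0))); exact: sv.
rewrite -(@ler_pXn2r _ 2) ?nnegrE ?mulr_ge0 ?vnorm_ge0 //.
rewrite exprMn Bn -(Un v) vnorm_sqr mulr_sumr; apply: ler_sum => i _.
apply: ler_wpM2r; first exact: sqr_ge0.
by rewrite -[leRHS]sqr_sqrtr // ler_pXn2r ?nnegrE ?sqrtr_ge0.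
Qed.

End SigmaMin.

(** * Resolvents, lattice sums and Taylor expansion *)

Lemma unitmx_inj (F : fieldType) n (B : 'M[F]_n) :
  (forall v : 'cV_n, B *m v = 0 -> v = 0) -> B \in unitmx.
Proof.
move=> H; rewrite -unitmx_tr -row_free_unit -kermx_eq0; apply/rowV0P => v.
move/sub_kermxP => vB; apply: trmx_inj; rewrite trmx0; apply: H.
by apply: trmx_inj; rewrite trmx_mul trmxK vB trmx0.
Qed.

Section Smin.
Context {R : realType} {n : nat}.
Implicit Types (A : 'M[R[i]]_n) (v : 'cV[R[i]]_n) (z w : R[i]).

(** The variational form of the smallest singular value of [z - A], for which Lipschitz and
    perturbation bounds are immediate; [sigma_min_le] links it to the pseudospectrum. For [n = 0] it
    is the infimum of an empty set, whence the hypotheses [0 < n] below. *)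
Definition smin A z : R :=
  inf [set vnorm ((z%:M - A) *m v) | v in [set v : 'cV[R[i]]_n | vnorm v = 1]].

Lemma smin_le A z v : smin A z * vnorm v <= vnorm ((z%:M - A) *m v).
Proof.
have [->|v0] := eqVneq v 0; first by rewrite mulmx0 vnorm0 mulr0.
have nv : 0 < vnorm v by rewrite vnorm_gt0.
have ni : cabs (vnorm v)^-1%:C = (vnorm v)^-1.
  by rewrite cabs_real ger0_norm // invr_ge0 vnorm_ge0.
have : smin A z <= vnorm ((z%:M - A) *m ((vnorm v)^-1%:C *: v)).
  apply: ge_inf; first by exists 0 => _ [u _ <-]; exact: vnorm_ge0.
  by exists ((vnorm v)^-1%:C *: v) => //=; rewrite vnormZ ni mulVf // gt_eqF.
by rewrite -scalemxAr vnormZ ni ler_pdivlMl // mulrC.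
Qed.

Lemma smin_ge A z t : (0 < n)%N ->
  (forall v, vnorm v = 1 -> t <= vnorm ((z%:M - A) *m v)) -> t <= smin A z.
Proof.
move=> n0 H; apply: lb_le_inf => [|_ [v /= v1 <-]]; last exact: H.
pose u : 'cV[R[i]]_n := delta_mx (Ordinal n0) 0.
exists (vnorm ((z%:M - A) *m u)), u => //=.
apply/eqP; rewrite -(@eqrXn2 _ 2) ?vnorm_ge0 // expr1n vnorm_sqr.
rewrite (bigD1 (Ordinal n0)) //= big1 ?addr0; first by rewrite mxE !eqxx cabs1 expr1n.
by move=> i /negbTE i0; rewrite mxE i0 cabs0 expr0n.
Qed.

Lemma smin_lip A z w : (0 < n)%N -> smin A z <= smin A w + cabs (z - w).
Proof.
move=> n0; rewrite -lerBlDr; apply: smin_ge => // v v1.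
rewrite lerBlDr; have := smin_le A z v; rewrite v1 mulr1 => /le_trans; apply.
have -> : z%:M - A = (w%:M - A) + (z - w)%:M.
  by rewrite [RHS]addrC raddfB /= addrA subrK.
rewrite mulmxDl mul_scalar_mx; apply: le_trans (vnormD _ _) _.
by rewrite vnormZ v1 mulr1.
Qed.

Lemma smin_large A a z : (0 < n)%N -> mxbound a A -> cabs z - a <= smin A z.
Proof.
move=> n0 aA; apply: smin_ge => // v v1.
rewrite mulmxBl mul_scalar_mx; apply: le_trans (vnorm_triangle _ _).
by rewrite vnormZ v1 mulr1 lerD2l lerN2; have := aA v; rewrite v1 mulr1.
Qed.

Definition resolvent A z : 'M[R[i]]_n := invmx (z%:M - A).

Lemma smin_unit A z : 0 < smin A z -> z%:M - A \in unitmx.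
Proof.
move=> s0; apply: unitmx_inj => v v0; apply/eqP; rewrite -vnorm_eq0.
have := smin_le A z v; rewrite v0 vnorm0 pmulr_rle0 // => H.
by rewrite eq_le H vnorm_ge0.
Qed.

Lemma resolvent_bound A z t v : 0 < t -> t <= smin A z ->
  vnorm (resolvent A z *m v) <= t^-1 * vnorm v.
Proof.
move=> t0 ts; have u := smin_unit _ _ (lt_le_trans t0 ts).
rewrite ler_pdivlMl //; have := smin_le A z (resolvent A z *m v).
rewrite mulmxA /resolvent mulmxV // mul1mx; apply: le_trans.
by apply: ler_wpM2r => //; exact: vnorm_ge0.
Qed.

End Smin.

(** * Square lattices and summation by parts *)

Section Lattice.
Context {R : realType}.
Variables (h : R) (N : nat).

Definition lpt (j k : nat) : R[i] := (h * (j%:R - N%:R)) +i* (h * (k%:R - N%:R)).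

(** The indices run from 1 to [2 * N - 1], so that the four neighbours of each point still have
    indices between 0 and [2 * N]. *)
Definition gsum {V : nmodType} (F : R[i] -> V) : V :=
  \sum_(j < (2 * N).-1) \sum_(k < (2 * N).-1) F (lpt j.+1 k.+1).

(* Discrete versions of the operator d/dx + i d/dy, scaled by [2 * h]: the
   symmetric differences make them O(h^3) on holomorphic functions. *)
Definition db (f : R[i] -> R) (z : R[i]) : R[i] :=
  (f (z + h%:C) - f (z - h%:C)) +i* (f (z + 0 +i* h) - f (z - 0 +i* h)).

Definition Db {V : lmodType R[i]} (f : R[i] -> V) (z : R[i]) : V :=
  (f (z + h%:C) - f (z - h%:C)) + 'i *: (f (z + 0 +i* h) - f (z - 0 +i* h)).

Lemma gsumD {V : nmodType} (F G : R[i] -> V) :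
  gsum (fun z => F z + G z) = gsum F + gsum G.
Proof.
by rewrite /gsum -big_split /=; apply: eq_bigr => j _; rewrite -big_split.
Qed.

Lemma gsum_scale {V : lmodType R[i]} (c : R[i] -> R[i]) (v : V) :
  gsum (fun z => c z *: v) = gsum c *: v.
Proof.
by rewrite /gsum scaler_suml; apply: eq_bigr => j _; rewrite scaler_suml.
Qed.

Lemma eq_gsum {V : nmodType} (F G : R[i] -> V) : F =1 G -> gsum F = gsum G.
Proof. by move=> FG; apply: eq_bigr => j _; apply: eq_bigr => k _. Qed.

Definition inbox (z : R[i]) :=
  `|complex.Re z| <= h * N%:R /\ `|complex.Im z| <= h * N%:R.

Lemma lpt_inbox j k : 0 <= h -> (j <= 2 * N)%N -> (k <= 2 * N)%N -> inbox (lpt j k).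
Proof.
move=> h0 jN kN; have H l : (l <= 2 * N)%N -> `|h * (l%:R - N%:R)| <= h * N%:R.
  move=> lN; rewrite normrM (ger0_norm h0); apply: ler_wpM2l => //.
  have : l%:R <= (2 * N)%:R :> R by rewrite ler_nat.
  rewrite natrM ler_norml => lN'; apply/andP; split; last by lra.
  by have : 0 <= l%:R :> R by []; lra.
by split; exact: H.
Qed.

Lemma gsum_bound {n} (F : R[i] -> 'cV[R[i]]_n) (B : R) : 0 <= h ->
  (forall z, inbox z -> vnorm (F z) <= B) -> 0 <= B ->
  vnorm (gsum F) <= 4 * N%:R ^+ 2 * B.
Proof.
move=> h0 FB B0; apply: (@le_trans _ _ ((2 * N).-1%:R * ((2 * N).-1%:R * B))).
  have sumB (G : 'I_(2 * N).-1 -> 'cV[R[i]]_n) (D : R) :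
      (forall l, vnorm (G l) <= D) -> vnorm (\sum_l G l) <= (2 * N).-1%:R * D.
    move=> GD; apply: le_trans (vnorm_sum _ _ _ _) _.
    apply: le_trans (ler_sum _ (fun l _ => GD l)) _.
    by rewrite sumr_const card_ord mulr_natl.
  apply: (sumB) => j; apply: (sumB) => k; apply/FB/lpt_inbox => //.
    by apply: leq_trans (ltn_ord j) (leq_pred _).
  by apply: leq_trans (ltn_ord k) (leq_pred _).
have N2 : (2 * N).-1%:R <= 2 * N%:R :> R by rewrite -natrM ler_nat leq_pred.
have N0 : 0 <= (2 * N).-1%:R :> R by [].
have -> : 4 * N%:R ^+ 2 * B = (2 * N%:R) * ((2 * N%:R) * B) by ring.
by apply: ler_pM => //; [exact: mulr_ge0 | exact: ler_wpM2r].
Qed.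

(** The two sums together telescope. Symmetric differences have stride two, so two indices at each
    end contribute boundary terms, and [p] has to vanish at all four. *)
Lemma sbp1 {V : lmodType R[i]} (M : nat) (p : nat -> R) (f : nat -> V) :
  p 0 = 0 -> p 1 = 0 -> p M = 0 -> p M.+1 = 0 ->
  \sum_(j < M) ((p j.+2 - p j)%:C *: f j.+1) =
  - \sum_(j < M) ((p j.+1)%:C *: (f j.+2 - f j)).
Proof.
move=> p0 p1 pM pM1; apply/eqP; rewrite -addr_eq0 -big_split /=; apply/eqP.
pose T j : V := (p j.+1)%:C *: f j + (p j)%:C *: f j.+1.
rewrite (eq_bigr (fun j : 'I_M => T j.+1 - T j)) => [|j _]; last first.
  rewrite /T rmorphB /= scalerBl scalerBr opprD addrACA; congr (_ + _).
  by rewrite addrC.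
rewrite -(big_mkord xpredT (fun j => T j.+1 - T j)) telescope_sumr //.
by rewrite /T p0 p1 pM pM1 !scale0r !addr0 subr0.
Qed.

Lemma sbp {V : lmodType R[i]} (p : R[i] -> R) (f : R[i] -> V) : (1 < N)%N -> 0 <= h ->
  (forall z, h * N%:R - h <= `|complex.Re z| -> p z = 0) ->
  (forall z, h * N%:R - h <= `|complex.Im z| -> p z = 0) ->
  gsum (fun z => db p z *: f z) = - gsum (fun z => (p z)%:C *: Db f z).
Proof.
move=> N1 h0 pR pI.
have lX j k : lpt j.+1 k + h%:C = lpt j.+2 k /\ lpt j.+1 k - h%:C = lpt j k.
  by rewrite /lpt; split; apply/eqP; rewrite eq_complex /=; apply/andP; split;
    apply/eqP; rewrite ?[_.+2%:R]mulrS ?[j.+1%:R]mulrS; ring.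
have lY j k : lpt j k.+1 + 0 +i* h = lpt j k.+2 /\ lpt j k.+1 - 0 +i* h = lpt j k.
  by rewrite /lpt; split; apply/eqP; rewrite eq_complex /=; apply/andP; split;
    apply/eqP; rewrite ?[_.+2%:R]mulrS ?[k.+1%:R]mulrS; ring.
have far l : l \in [:: 0; 1; (2 * N).-1; (2 * N).-1.+1]%N ->
    h * N%:R - h <= `|h * (l%:R - N%:R)|.
  have N1R : 1 <= N%:R :> R by rewrite ler1n ltnW.
  have eN : (2 * N).-1.+1 = (2 * N)%N by rewrite prednK // muln_gt0 /= ltnW.
  have eN' : (2 * N).-1%:R = 2 * N%:R - 1 :> R.
    by apply/eqP; rewrite -subr_eq opprK natr1 eN natrM.
  rewrite !inE normrM (ger0_norm h0) -[X in _ - X]mulr1 -mulrBr => lb.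
  apply: ler_wpM2l => //; rewrite ler_normr; apply/orP.
  by case/or4P: lb => /eqP ->; rewrite ?eN ?eN' ?natrM; [right|right|left|left]; lra.
pose M := (2 * N).-1.
have pX k l : l \in [:: 0; 1; M; M.+1]%N -> p (lpt l k) = 0.
  by move=> /far H; apply: pR.
have pY k l : l \in [:: 0; 1; M; M.+1]%N -> p (lpt k l) = 0.
  by move=> /far H; apply: pI.
have sumX : gsum (fun z => (p (z + h%:C) - p (z - h%:C))%:C *: f z) =
    - gsum (fun z => (p z)%:C *: (f (z + h%:C) - f (z - h%:C))).
  rewrite /gsum exchange_big [in RHS]exchange_big -sumrN /=; apply: eq_bigr => k _.
  have := @sbp1 V M (fun j => p (lpt j k.+1)) (fun j => f (lpt j k.+1)).
  rewrite !pX ?inE ?eqxx ?orbT // => /(_ erefl erefl erefl erefl) E.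
  by under eq_bigr do rewrite (lX _ _).1 (lX _ _).2; rewrite E; congr (- _);
    apply: eq_bigr => j _; rewrite (lX _ _).1 (lX _ _).2.
have sumY : gsum (fun z => (p (z + 0 +i* h) - p (z - 0 +i* h))%:C *: f z) =
    - gsum (fun z => (p z)%:C *: (f (z + 0 +i* h) - f (z - 0 +i* h))).
  rewrite /gsum -sumrN /=; apply: eq_bigr => j _.
  have := @sbp1 V M (fun k => p (lpt j.+1 k)) (fun k => f (lpt j.+1 k)).
  rewrite !pY ?inE ?eqxx ?orbT // => /(_ erefl erefl erefl erefl) E.
  by under eq_bigr do rewrite (lY _ _).1 (lY _ _).2; rewrite E; congr (- _);
    apply: eq_bigr => k _; rewrite (lY _ _).1 (lY _ _).2.
rewrite (eq_gsum _ (fun z => (p (z + h%:C) - p (z - h%:C))%:C *: f z +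
    'i *: ((p (z + 0 +i* h) - p (z - 0 +i* h))%:C *: f z))) => [|z]; last first.
  by rewrite scalerA -scalerDl /db; congr (_ *: _); rewrite [LHS]complexE.
have gi (F : R[i] -> V) : gsum (fun z => 'i *: F z) = 'i *: gsum F.
  by rewrite /gsum scaler_sumr; apply: eq_bigr => j _; rewrite scaler_sumr.
rewrite gsumD sumX gi sumY scalerN -opprD -gi -gsumD; congr (- _).
by apply: eq_gsum => z; rewrite /Db [RHS]scalerDr !scalerA (mulrC 'i).
Qed.

End Lattice.

(** * Functions on which the discrete Cauchy-Riemann operator is cubically small *)

Section Taylor.
Context {R : realType}.

Lemma inbox_cabs (h : R) (N : nat) (z : R[i]) : inbox h N z -> cabs z <= 2 * (h * N%:R).
Proof.
case=> zr zi; rewrite [z]complexE; apply: le_trans (cabsD _ _) _.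
rewrite cabsM complexiE cabs_i mul1r !cabs_real; lra.
Qed.

(* A second order expansion suffices, because the terms of order 1 and 2 cancel in [Db]. *)
Definition taylor3 (p : {poly R[i]}) := forall rho : R, exists2 K : R, 0 <= K &
  exists p1 p2 : R[i] -> R[i], forall z w : R[i], cabs z <= rho -> cabs w <= 1 ->
  cabs (p.[z + w] - p.[z] - w * p1 z - w ^+ 2 * p2 z) <= K * cabs w ^+ 3 /\
  cabs (p1 z) + cabs (p2 z) <= K.

Lemma poly_taylor3 p : taylor3 p.
Proof.
elim/poly_ind: p => [|p c IH] rho.
  exists 0 => //; exists (fun=> 0), (fun=> 0) => z w _ _.
  by rewrite !horner0 !mulr0 !subr0 cabs0 addr0 mul0r.
have [K K0 [p1 [p2 H]]] := IH rho.
have [B B0 HB] : exists2 B : R, 0 <= B & forall z, cabs z <= rho -> cabs p.[z] <= B.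
  exists (\sum_(i < size p) cabs p`_i * `|rho| ^+ i).
    by apply: sumr_ge0 => i _; rewrite mulr_ge0 ?cabs_ge0 ?exprn_ge0.
  move=> z zr; rewrite horner_coef; apply: le_trans (cabs_sum _ _ _ _) _.
  apply: ler_sum => i _; rewrite cabsM cabsX ler_wpM2l ?cabs_ge0 //.
  rewrite lerXn2r ?nnegrE ?cabs_ge0 //.
  by apply: le_trans zr _; exact: ler_norm.
exists (3 * (K * `|rho|) + 3 * K + B); first by rewrite !addr_ge0 ?mulr_ge0.
(* [p1] and [p2] play the roles of [p'] and [p'' / 2]; the new ones follow the product rule for
   multiplication by [z]. *)
exists (fun z => z * p1 z + p.[z]), (fun z => z * p2 z + p1 z) => z w zr w1.
have [Hz Hk] := H z w zr w1.
have zr' : cabs z <= `|rho| by apply: le_trans zr _; exact: ler_norm.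
have k1 : cabs (p1 z) <= K by apply: le_trans Hk; rewrite lerDl cabs_ge0.
have k2 : cabs (p2 z) <= K by apply: le_trans Hk; rewrite lerDr cabs_ge0.
have zK x : cabs x <= K -> cabs (z * x) <= K * `|rho|.
  by move=> xK; rewrite cabsM mulrC; apply: ler_pM; rewrite ?cabs_ge0.
have Kr0 : 0 <= K * `|rho| by rewrite mulr_ge0.
split; last first.
  have := cabsD (z * p1 z) p.[z]; have := cabsD (z * p2 z) (p1 z).
  have := zK _ k1; have := zK _ k2; have := HB _ zr; lra.
set e := (X in cabs X <= _) in Hz.
have hE x : (p * 'X + c%:P).[x] = p.[x] * x + c by rewrite !hornerE.
rewrite !hE {hE}.
have -> : p.[z + w] * (z + w) + c - (p.[z] * z + c) - w * (z * p1 z + p.[z]) -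
    w ^+ 2 * (z * p2 z + p1 z) = w ^+ 3 * p2 z + (z + w) * e by rewrite /e; ring.
have w3 : 0 <= cabs w ^+ 3 by rewrite exprn_ge0 ?cabs_ge0.
apply: le_trans (cabsD _ _) _; rewrite (cabsM (w ^+ 3)) (cabsM (z + w)) cabsX.
apply: (@le_trans _ _ (cabs w ^+ 3 * K + (`|rho| + 1) * (K * cabs w ^+ 3))).
  apply: lerD; first exact: ler_wpM2l.
  apply: ler_pM; rewrite ?cabs_ge0 //.
  by apply: le_trans (cabsD _ _) _; apply: lerD.
have KB : 0 <= (2 * (K * `|rho|) + K + B) * cabs w ^+ 3.
  by rewrite mulr_ge0 ?addr_ge0 // mulr_ge0.
lra.
Qed.

(** The stand-in for holomorphy: a sum of such errors over O(h^-2) lattice points is O(h). *)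
Definition cubic_Db {n} (g : R[i] -> 'cV[R[i]]_n) := forall rho : R,
  exists2 K : R, 0 <= K & forall (z : R[i]) (h : R), cabs z <= rho -> 0 < h <= 1 ->
  vnorm (Db h g z) <= K * h ^+ 3.

Lemma cubic_Db_poly n (p : {poly R[i]}) (v : 'cV[R[i]]_n) :
  cubic_Db (fun z => p.[z] *: v).
Proof.
move=> rho; have [K K0 [p1 [p2 H]]] := poly_taylor3 p rho.
exists (4 * K * vnorm v); first by rewrite !mulr_ge0 ?vnorm_ge0.
move=> z h zr /andP[h0 h1].
pose e w := p.[z + w] - p.[z] - w * p1 z - w ^+ 2 * p2 z.
have He w : cabs w = h -> cabs (e w) <= K * h ^+ 3.
  by move=> wh; have [|] := H z w zr; rewrite wh.
have hh : cabs h%:C = h by rewrite cabs_real gtr0_norm.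
have hi : 0 +i* h = 'i * h%:C :> R[i] by rewrite [LHS]complexE add0r complexiE.
have hih : cabs ('i * h%:C) = h by rewrite cabsM cabs_i mul1r.
have -> : Db h (fun z => p.[z] *: v) z =
    (e h%:C - e (- h%:C) + 'i * (e ('i * h%:C) - e (- ('i * h%:C)))) *: v.
  rewrite /Db -!scalerBl scalerA -scalerDl hi; congr (_ *: _); rewrite /e.
  have i2 : 'i * 'i = -1 :> R[i] by rewrite -expr2 sqrCi.
  by ring: i2.
rewrite vnormZ mulrAC; apply: ler_wpM2r; first exact: vnorm_ge0.
apply: le_trans (cabsD _ _) _; rewrite cabsM cabs_i mul1r.
have := cabsD (e h%:C) (- e (- h%:C)).
have := cabsD (e ('i * h%:C)) (- e (- ('i * h%:C))); rewrite !cabsN.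
have := He _ hh; have := He _ hih.
have := He (- h%:C); have := He (- ('i * h%:C)); rewrite !cabsN.
by move=> /(_ hih) ? /(_ hh) ? ? ? ? ?; lra.
Qed.

Lemma cubic_DbD n (f g : R[i] -> 'cV[R[i]]_n) :
  cubic_Db f -> cubic_Db g -> cubic_Db (fun z => f z + g z).
Proof.
move=> Hf Hg rho; have [K K0 HK] := Hf rho; have [L L0 HL] := Hg rho.
exists (K + L) => [|z h zr h01]; first exact: addr_ge0.
have -> : Db h (fun z => f z + g z) z = Db h f z + Db h g z.
  have e (x1 y1 x2 y2 : 'cV[R[i]]_n) : x1 + y1 - (x2 + y2) = (x1 - x2) + (y1 - y2).
    by rewrite opprD addrACA.
  by rewrite /Db !e scalerDr addrACA.
by rewrite mulrDl; apply: le_trans (vnormD _ _) _; apply: lerD; [exact: HK | exact: HL].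
Qed.

Lemma cubic_Db_mul n (A : 'M[R[i]]_n) (f : R[i] -> 'cV[R[i]]_n) :
  cubic_Db f -> cubic_Db (fun z => A *m f z).
Proof.
move=> Hf rho; have [K K0 HK] := Hf rho; have [a a0 aA] := frobenius_bound A.
exists (a * K) => [|z h zr h01]; first exact: mulr_ge0.
have -> : Db h (fun z => A *m f z) z = A *m Db h f z.
  by rewrite /Db -!mulmxBr scalemxAr -mulmxDr.
by apply: le_trans (aA _) _; rewrite -mulrA; apply: ler_wpM2l => //; exact: HK.
Qed.

End Taylor.

(** * Polynomials of a matrix and the resolvent *)

Section PolyEval.
Context {R : realType} {n : nat}.
Implicit Types (A : 'M[R[i]]_n) (p q : {poly R[i]}).

Lemma mxpoly_eval_wide m p A : (size p <= m)%N ->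
  mxpoly_eval p A = \sum_(i < m) p`_i *: A ^+ i.
Proof.
move=> pm; rewrite /mxpoly_eval (big_ord_widen m (fun i => p`_i *: A ^+ i) pm).
rewrite big_mkcond /=; apply: eq_bigr => i _; case: ltnP => // H.
by rewrite nth_default // scale0r.
Qed.

Lemma mxpoly_evalD p q A :
  mxpoly_eval (p + q) A = mxpoly_eval p A + mxpoly_eval q A.
Proof.
pose m := maxn (size p) (size q).
rewrite !(@mxpoly_eval_wide m) ?leq_maxl ?leq_maxr ?size_polyD //.
by rewrite -big_split /=; apply: eq_bigr => i _; rewrite coefD scalerDl.
Qed.

Lemma mxpoly_evalZ c p A : mxpoly_eval (c *: p) A = c *: mxpoly_eval p A.
Proof.
rewrite (@mxpoly_eval_wide (size p)) ?size_scale_leq // scaler_sumr.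
by apply: eq_bigr => i _; rewrite coefZ scalerA.
Qed.

Lemma mxpoly_evalC c A : mxpoly_eval c%:P A = c%:M.
Proof.
rewrite (@mxpoly_eval_wide 1) ?size_polyC_leq1 // big_ord1 coefC /= expr0.
by rewrite scalemx1.
Qed.

Lemma mxpoly_evalMX p A : mxpoly_eval (p * 'X) A = A *m mxpoly_eval p A.
Proof.
rewrite (@mxpoly_eval_wide (size p).+1) ?(leq_trans (size_polyMleq _ _)) ?size_polyX ?addn2 //.
rewrite big_ord_recl coefMX eqxx scale0r add0r mulmx_sumr.
by apply: eq_bigr => i _; rewrite coefMX /= -scalemxAr exprS.
Qed.

Lemma resolvent_comm A z : z%:M - A \in unitmx ->
  A *m resolvent A z = resolvent A z *m A.
Proof.
move=> u; have B0 : resolvent A z *m (z%:M - A) = (z%:M - A) *m resolvent A z.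
  by rewrite /resolvent mulVmx // mulmxV.
move: B0; rewrite mulmxBr mulmxBl mul_scalar_mx mul_mx_scalar => /eqP.
by rewrite (inj_eq (addrI _)) eqr_opp => /eqP.
Qed.

(** [(q(z) - q(A)) (z - A)^-1] is a polynomial in [z] with matrix coefficients. Hence [g] extends
    over the spectrum, where the cutoff equals 1 and summation by parts still needs it. *)
Lemma resolvent_poly A q (b : 'cV[R[i]]_n) : exists2 g, cubic_Db g &
  forall z, z%:M - A \in unitmx ->
  q.[z] *: (resolvent A z *m b) = resolvent A z *m (mxpoly_eval q A *m b) + g z.
Proof.
elim/poly_ind: q => [|q c [g Hg IH]].
  exists (fun=> 0).
    by move=> rho; exists 0 => // z h _ _; rewrite /Db !subr0 scaler0 addr0 vnorm0 mul0r.
  by move=> z _; rewrite horner0 scale0r /mxpoly_eval size_poly0 big_ord0 mul0mx mulmx0 addr0.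
exists (fun z => q.[z] *: b + A *m g z).
  by apply: cubic_DbD; [exact: cubic_Db_poly | exact: cubic_Db_mul].
move=> z u; rewrite mxpoly_evalD mxpoly_evalMX mxpoly_evalC hornerD hornerMX hornerC scalerDl.
have -> : resolvent A z *m ((A *m mxpoly_eval q A + c%:M) *m b) =
  A *m (resolvent A z *m (mxpoly_eval q A *m b)) + c *: (resolvent A z *m b).
  rewrite mulmxDl mulmxDr mul_scalar_mx -scalemxAr; congr (_ + _).
  by rewrite !mulmxA (resolvent_comm _ _ u).
have -> : A *m (resolvent A z *m (mxpoly_eval q A *m b)) =
    A *m (q.[z] *: (resolvent A z *m b)) - A *m g z.
  by rewrite IH // mulmxDr addrK.
have -> : (q.[z] * z) *: (resolvent A z *m b) =
    A *m (q.[z] *: (resolvent A z *m b)) + q.[z] *: b.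
  rewrite -scalemxAr -scalerDr -scalerA; congr (_ *: _).
  have E : (z%:M - A) *m (resolvent A z *m b) = b.
    by rewrite mulmxA /resolvent mulmxV // mul1mx.
  by rewrite -{3}E mulmxBl mul_scalar_mx addrC subrK.
set X := A *m (_ *: _); set Y := A *m g z; set Z := c *: _; set W := _ *: b.
by rewrite [RHS]addrACA [X - Y + W]addrAC [Z + Y]addrC addrA subrK.
Qed.

End PolyEval.

(** * The discrete Cauchy-Riemann operator on the resolvent *)

Section ResolventDb.
Context {R : realType} {n : nat}.
Implicit Types (A : 'M[R[i]]_n).

(** The first resolvent identity, for matrices that differ by a scalar. *)
Lemma invmx_sub (P Q : 'M[R[i]]_n) (c : R[i]) : P \in unitmx -> Q \in unitmx ->
  Q - P = c%:M -> invmx P - invmx Q = c *: (invmx P *m invmx Q).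
Proof.
move=> uP uQ QP; rewrite -mul_scalar_mx -scalar_mxC -QP.
have -> : invmx P - invmx Q = invmx P *m (Q - P) *m invmx Q.
  by rewrite mulmxBr mulmxBl mulmxK // mulVmx // mul1mx.
by rewrite QP scalar_mxC -mulmxA scalar_mxC.
Qed.

(** [P], [Q], [S], [T] stand for [z - A] at the four neighbours. The resolvent identity turns both
    differences into products with coefficients [- 2 h] and [2 h]; a second use of it on these
    products yields the remaining [h ^+ 2]. The result is exact, so no Taylor remainder of the
    resolvent has to be estimated. *)
Lemma invmx_Db (P Q S T : 'M[R[i]]_n) (h : R[i]) :
  P \in unitmx -> Q \in unitmx -> S \in unitmx -> T \in unitmx ->
  Q - P = (- 2 * h)%:M -> T - S = (- 2 * 'i * h)%:M ->
  Q *m P - T *m S = (- 2 * h ^+ 2)%:M ->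
  (invmx P - invmx Q) + 'i *: (invmx S - invmx T) =
  (- 4 * h ^+ 3) *: (invmx S *m invmx T *m (invmx P *m invmx Q)).
Proof.
move=> uP uQ uS uT QP TS E.
have i2 : 'i * 'i = -1 :> R[i] by rewrite -expr2 sqrCi.
have STPQ : invmx S *m invmx T - invmx P *m invmx Q =
    (- 2 * h ^+ 2) *: (invmx S *m invmx T *m (invmx P *m invmx Q)).
  have -> : invmx S *m invmx T - invmx P *m invmx Q =
    invmx S *m invmx T *m (Q *m P - T *m S) *m (invmx P *m invmx Q).
    rewrite mulmxBr mulmxBl; congr (_ - _).
      by rewrite -!mulmxA (mulKVmx uP) (mulmxV uQ) mulmx1.
    by rewrite -(mulmxA (invmx S)) (mulKmx uT) (mulVmx uS) mul1mx.
  by rewrite E mul_mx_scalar -scalemxAl.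
rewrite (invmx_sub _ _ _ uP uQ QP) (invmx_sub _ _ _ uS uT TS) scalerA.
have -> : 'i * (- 2 * 'i * h) = 2 * h by ring: i2.
move: (invmx P *m invmx Q) (invmx S *m invmx T) STPQ => X Y YX.
have -> : (- 2 * h) *: X + (2 * h) *: Y = (2 * h) *: (Y - X).
  by rewrite scalerBr addrC mulNr scaleNr.
rewrite YX scalerA; congr (_ *: _); ring.
Qed.

Lemma resolvent_Db A (h : R) (z : R[i]) (y : 'cV[R[i]]_n) :
  (z + h%:C)%:M - A \in unitmx -> (z - h%:C)%:M - A \in unitmx ->
  (z + 0 +i* h)%:M - A \in unitmx -> (z - 0 +i* h)%:M - A \in unitmx ->
  Db h (fun w => resolvent A w *m y) z = (- 4 * h%:C ^+ 3) *:
    (resolvent A (z + 0 +i* h) *m (resolvent A (z - 0 +i* h) *m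
    (resolvent A (z + h%:C) *m (resolvent A (z - h%:C) *m y)))).
Proof.
move=> uP uQ uS uT.
have hi : 0 +i* h = 'i * h%:C :> R[i] by rewrite [LHS]complexE add0r complexiE.
have i2 : 'i * 'i = -1 :> R[i] by rewrite -expr2 sqrCi.
have := invmx_Db _ _ _ _ h%:C uP uQ uS uT.
rewrite -!/(resolvent _ _) => H.
rewrite /Db -!mulmxBl scalemxAl -mulmxDl H; first by rewrite -scalemxAl -!mulmxA.
- rewrite opprB addrA subrK -raddfB /=; congr (_%:M); ring.
- rewrite opprB addrA subrK -raddfB /= hi; congr (_%:M); ring.
rewrite !mulmxBl !mulmxBr !mul_scalar_mx !mul_mx_scalar hi.
rewrite !scale_scalar_mx; move: (A *m A) => AA.
have -> : (- 2 * h%:C ^+ 2) = (z - h%:C) * (z + h%:C) - (z - 'i * h%:C) * (z + 'i * h%:C).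
  by ring: i2.
apply/matrixP => j k; rewrite !mxE.
case: (j == k); rewrite ?mulr1n ?mulr0n; ring.
Qed.

(** Since [smin A] is 1-Lipschitz, the margin [h] keeps all four neighbours at level [t] or
    above. *)
Lemma resolvent_Db_bound A (h t : R) (z : R[i]) (y : 'cV[R[i]]_n) : (0 < n)%N ->
  0 < h -> 0 < t -> t + h <= smin A z ->
  vnorm (Db h (fun w => resolvent A w *m y) z) <= 4 * h ^+ 3 * t^-1 ^+ 4 * vnorm y.
Proof.
move=> n0 h0 t0 tz.
have near w : cabs (z - w) <= h -> t <= smin A w.
  move=> zw; rewrite -(lerD2r h); apply: le_trans tz _.
  by apply: le_trans (smin_lip A z w n0) _; rewrite lerD2l.
have hh : cabs h%:C = h by rewrite cabs_real gtr0_norm.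
have hi : cabs (0 +i* h) = h by rewrite /cabs /= expr0n /= add0r sqrtr_sqr gtr0_norm.
have tP : t <= smin A (z + h%:C) by apply: near; rewrite opprD addrA subrr add0r cabsN hh.
have tQ : t <= smin A (z - h%:C) by apply: near; rewrite subKr hh.
have tS : t <= smin A (z + 0 +i* h) by apply: near; rewrite opprD addrA subrr add0r cabsN hi.
have tT : t <= smin A (z - 0 +i* h) by apply: near; rewrite subKr hi.
have un w : t <= smin A w -> w%:M - A \in unitmx.
  by move=> tw; apply: smin_unit; exact: lt_le_trans tw.
rewrite resolvent_Db ?un // vnormZ.
have -> : cabs (- 4 * h%:C ^+ 3) = 4 * h ^+ 3.
  have -> : - 4 * h%:C ^+ 3 = (- 4 * h ^+ 3)%:C by rewrite rmorphM rmorphXn rmorphN rmorph_nat.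
  by rewrite cabs_real mulNr normrN ger0_norm // mulr_ge0 // exprn_ge0 ?ltW.
have -> : 4 * h ^+ 3 * t^-1 ^+ 4 * vnorm y =
    4 * h ^+ 3 * (t^-1 * (t^-1 * (t^-1 * (t^-1 * vnorm y)))) by ring.
apply: ler_wpM2l; first by rewrite mulr_ge0 // exprn_ge0 ?ltW.
have t1 : 0 <= t^-1 by rewrite invr_ge0 ltW.
have step w (v : 'cV_n) (B : R) : t <= smin A w -> vnorm v <= B ->
    vnorm (resolvent A w *m v) <= t^-1 * B.
  by move=> tw vB; apply: le_trans (resolvent_bound _ _ _ v t0 tw) _; exact: ler_wpM2l.
by do 4 (apply: (step) => //).
Qed.

End ResolventDb.

(** * Lipschitz cutoffs *)

Section Cutoff.
Context {R : realType}.

Definition clamp (x : R) : R := Num.min 1 (Num.max 0 x).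

Lemma clamp_spec (x : R) : [\/ x <= 0 /\ clamp x = 0, 0 <= x <= 1 /\ clamp x = x
  | 1 <= x /\ clamp x = 1].
Proof.
rewrite /clamp; have [x0|x0] := leP x 0.
  by apply: Or31; split => //; rewrite min_r // ler01.
have [x1|x1] := leP 1 x; first by apply: Or33.
by apply: Or32; rewrite (ltW x0) (ltW x1).
Qed.

Lemma clamp_lip (x y : R) : `|clamp x - clamp y| <= `|x - y|.
Proof.
wlog xy : x y / x <= y.
  by move=> H; have [/H //|/ltW/H] := leP x y; rewrite distrC (distrC x).
rewrite (distrC x) (distrC (clamp x)) (ger0_norm (_ : 0 <= y - x)) ?subr_ge0 //.
by case: (clamp_spec x) => -[? ->]; case: (clamp_spec y) => -[? ->];
  rewrite ler_norml; apply/andP; split; lra.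
Qed.

Lemma clamp_homo (x y : R) : x <= y -> clamp x <= clamp y.
Proof.
by move=> xy; case: (clamp_spec x) => -[? ->]; case: (clamp_spec y) => -[? ->]; lra.
Qed.

Lemma clamp01 (x : R) : 0 <= clamp x <= 1.
Proof. by case: (clamp_spec x) => -[? ->]; rewrite ?lexx ?ler01. Qed.

Lemma clamp_le0 (x : R) : x <= 0 -> clamp x = 0.
Proof. by move=> x0; case: (clamp_spec x) => -[? ->]; lra. Qed.

Lemma clamp_ge1 (x : R) : 1 <= x -> clamp x = 1.
Proof. by move=> x0; case: (clamp_spec x) => -[? ->]; lra. Qed.

Lemma clamp_id (x : R) : 0 <= x <= 1 -> clamp x = x.
Proof. by move=> x0; case: (clamp_spec x) => -[? ->]; lra. Qed.

Lemma cabs_le (x y : R) : cabs (x +i* y) <= `|x| + `|y|.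
Proof.
have -> : x +i* y = x%:C + 'i * y%:C by rewrite [LHS]complexE complexiE.
by apply: le_trans (cabsD _ _) _; rewrite cabsM cabs_i mul1r !cabs_real.
Qed.

Lemma db_lip (h L : R) (p : R[i] -> R) z : 0 < h ->
  (forall z w, `|p z - p w| <= L * cabs (z - w)) -> cabs (db h p z) <= 4 * L * h.
Proof.
move=> h0 pL; apply: le_trans (cabs_le _ _) _.
have := pL (z + h%:C) (z - h%:C); have := pL (z + 0 +i* h) (z - 0 +i* h).
have -> : z + h%:C - (z - h%:C) = (2 * h)%:C by rewrite rmorphM rmorph_nat; ring.
have -> : z + 0 +i* h - (z - 0 +i* h) = 2 * (0 +i* h) by ring.
rewrite cabsM (_ : cabs 2 = 2); last first.
  by rewrite -(rmorph_nat (real_complex R)) cabs_real ger0_norm.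
have -> : cabs (0 +i* h) = h by rewrite /cabs /= expr0n /= add0r sqrtr_sqr gtr0_norm.
have h2 : 0 <= 2 * h by lra.
rewrite cabs_real (ger0_norm h2); lra.
Qed.

Lemma db_const (h c : R) (p : R[i] -> R) z : 0 <= h ->
  (forall w, cabs (w - z) <= h -> p w = c) -> db h p z = 0.
Proof.
move=> h0 pc; have hh : cabs h%:C = h by rewrite cabs_real ger0_norm.
have hi : cabs (0 +i* h) = h by rewrite /cabs /= expr0n /= add0r sqrtr_sqr ger0_norm.
by rewrite /db !pc ?subrr // addrC addKr ?cabsN ?hh ?hi.
Qed.

Lemma dbB (h : R) (p q : R[i] -> R) z :
  db h (fun w => p w - q w) z = db h p z - db h q z.
Proof. by rewrite /db; apply/eqP; rewrite eq_complex /=; apply/andP; split; apply/eqP; ring. Qed.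

End Cutoff.

(** * The radial cutoff *)

Section Quadratic.
Context {R : realType}.
Variables (r h : R).
Hypotheses (r0 : 0 < r) (h0 : 0 < h) (hr : h <= r / 4).

(* Well inside the annulus [r < |z| < 2 r] this gives [db h qcut z = - 4 h z / (3 r^2)], so the
   sum of [db h qcut z / z], which replaces the winding integral, has no cancellation. *)
Definition qcut (z : R[i]) : R :=
  clamp ((4 * r ^+ 2 - (complex.Re z ^+ 2 + complex.Im z ^+ 2)) / (3 * r ^+ 2)).

Let r2 : 0 < 3 * r ^+ 2.
Proof. by rewrite mulr_gt0 ?exprn_gt0. Qed.

(** In this box each coordinate contributes at most [4 |u| h / (3 r^2) <= 16 h / (3 r)]; 11 rounds
    up twice 16/3. *)
Lemma db_qcut_bound (z : R[i]) : `|complex.Re z| <= 4 * r -> `|complex.Im z| <= 4 * r ->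
  cabs (db h qcut z) <= 11 * h / r.
Proof.
case: z => x y /= xr yr; apply: le_trans (cabs_le _ _) _.
have key (u v : R) : `|u| <= 4 * r ->
    `|(4 * r ^+ 2 - ((u + h) ^+ 2 + v)) / (3 * r ^+ 2) -
      (4 * r ^+ 2 - ((u - h) ^+ 2 + v)) / (3 * r ^+ 2)| <= 16 / 3 * (h / r).
  move=> ur; have -> : (4 * r ^+ 2 - ((u + h) ^+ 2 + v)) / (3 * r ^+ 2) -
      (4 * r ^+ 2 - ((u - h) ^+ 2 + v)) / (3 * r ^+ 2) = - (u * (4 * h) / (3 * r ^+ 2)).
    by field; rewrite gt_eqF.
  rewrite normrN normrM [X in _ * X]ger0_norm ?invr_ge0 ?(ltW r2) //.
  rewrite normrM (ger0_norm (_ : 0 <= 4 * h)) ?mulr_ge0 ?(ltW h0) //.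
  rewrite ler_pdivrMr //.
  have -> : 16 / 3 * (h / r) * (3 * r ^+ 2) = (4 * r) * (4 * h) by field; rewrite gt_eqF.
  by apply: ler_wpM2r => //; move: h0; lra.
have h1 : `|qcut (x +i* y + h%:C) - qcut (x +i* y - h%:C)| <= 16 / 3 * (h / r).
  by apply: le_trans (clamp_lip _ _) _ => /=; rewrite oppr0 !addr0; exact: key.
have h2 : `|qcut (x +i* y + 0 +i* h) - qcut (x +i* y - 0 +i* h)| <= 16 / 3 * (h / r).
  apply: le_trans (clamp_lip _ _) _ => /=; rewrite oppr0 !addr0.
  by rewrite ![x ^+ 2 + _]addrC; exact: key.
have hr0 : 0 < h / r by rewrite divr_gt0.
move: h1 h2; rewrite -mulrA; lra.
Qed.

Lemma qcut_far z : 2 * r <= `|complex.Re z| \/ 2 * r <= `|complex.Im z| -> qcut z = 0.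
Proof.
move=> H; apply: clamp_le0; rewrite pmulr_lle0 ?invr_gt0 // subr_le0.
have -> : 4 * r ^+ 2 = (2 * r) ^+ 2 by ring.
have s (u : R) : 2 * r <= `|u| -> (2 * r) ^+ 2 <= u ^+ 2.
  move=> ur; rewrite -(real_normK (num_real u)) ler_pXn2r ?nnegrE //.
  by rewrite mulr_ge0 ?ltW.
case: H => /s H; apply: le_trans H _; rewrite ?lerDl ?lerDr ?sqr_ge0 //.
Qed.

Lemma qcut_near z : cabs z <= r -> qcut z = 1.
Proof.
move=> zr; apply: clamp_ge1; rewrite -cabs_sqr ler_pdivlMr // mul1r.
have : cabs z ^+ 2 <= r ^+ 2 by rewrite ler_pXn2r ?nnegrE ?cabs_ge0 ?(ltW r0) //.
by move: r0; lra.
Qed.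

Lemma qcut01 z : 0 <= qcut z <= 1. Proof. exact: clamp01. Qed.

Lemma db_qcut_small z : cabs z <= r / 2 -> db h qcut z = 0.
Proof.
move=> zr; apply: (@db_const _ _ 1) => [|w wz]; first exact: ltW.
apply: qcut_near; have := cabs_triangle w z.
move: r0 hr zr wz; lra.
Qed.

Lemma Re_divE (a b x y : R) :
  complex.Re ((a +i* b) / (x +i* y)) = (a * x + b * y) / (x ^+ 2 + y ^+ 2).
Proof. by rewrite /=; ring. Qed.

(** [qcut] decreases as [|Re z|] or [|Im z|] grows, so each difference has the sign opposite to its
    coordinate. With all terms of one sign, any part of the winding sum bounds it from below. *)
Lemma qcut_radial z : 0 <= - complex.Re (db h qcut z / z).
Proof.
case: z => x y; rewrite Re_divE -mulNr; apply: mulr_ge0; last first.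
  by rewrite invr_ge0 addr_ge0 ?sqr_ge0.
rewrite opprD /= /qcut /= oppr0 !addr0.
have mono (u v : R) : 0 <= - ((clamp ((4 * r ^+ 2 - ((u + h) ^+ 2 + v)) / (3 * r ^+ 2)) -
    clamp ((4 * r ^+ 2 - ((u - h) ^+ 2 + v)) / (3 * r ^+ 2))) * u).
  rewrite -mulNr opprB; have [u0|u0] := leP 0 u.
    apply: mulr_ge0 => //; rewrite subr_ge0; apply: clamp_homo.
    apply: ler_wpM2r; first by rewrite invr_ge0 ltW.
    have : 0 <= u * h by rewrite mulr_ge0 // ltW.
    by rewrite !sqrrD sqrrN; lra.
  apply: mulr_le0; last exact: ltW.
  rewrite subr_le0; apply: clamp_homo.
  apply: ler_wpM2r; first by rewrite invr_ge0 ltW.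
  have : u * h <= 0 by rewrite mulr_le0_ge0 // ltW.
  by rewrite !sqrrD sqrrN; lra.
apply: addr_ge0; first exact: mono.
by rewrite ![x ^+ 2 + _]addrC; exact: mono.
Qed.

(** A margin of [r / 4 >= h] around this square still has squared modulus between [r^2] and
    [53 / 16 r^2], so [clamp] acts as the identity at all four neighbours. *)
Lemma qcut_radial_eq z : 5 / 4 * r <= complex.Re z <= 3 / 2 * r ->
  0 <= complex.Im z <= r / 4 ->
  - complex.Re (db h qcut z / z) = 4 * h / (3 * r ^+ 2).
Proof.
case: z => x y xx yy; rewrite Re_divE.
move: xx yy => /= /andP[x1 x2] /andP[y1 y2].
rewrite /= /qcut /= oppr0 !addr0.
have cl (u v : R) : r <= u <= 7 / 4 * r -> - (r / 4) <= v <= r / 2 ->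
    clamp ((4 * r ^+ 2 - (u ^+ 2 + v ^+ 2)) / (3 * r ^+ 2)) =
    (4 * r ^+ 2 - (u ^+ 2 + v ^+ 2)) / (3 * r ^+ 2).
  move=> /andP[u1 u2] /andP[v1 v2]; apply: clamp_id.
  have uu : r * r <= u * u by apply: ler_pM => //; exact: ltW.
  have uu' : u * u <= (7 / 4 * r) * (7 / 4 * r).
    by apply: ler_pM => //; exact: le_trans (ltW r0) u1.
  have vv : 0 <= (r / 2 - v) * (v + r / 2).
    by apply: mulr_ge0; move: r0 v1 v2; lra.
  have rr : 0 < r * r by exact: mulr_gt0.
  have vp := sqr_ge0 v.
  apply/andP; split; last by rewrite ler_pdivrMr //; move: rr uu uu' vv vp; nra.
  apply: divr_ge0; last exact: ltW.
  by move: rr uu uu' vv; nra.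
rewrite !cl; try by (apply/andP; split; move: r0 h0 hr x1 x2 y1 y2; lra).
field; rewrite gt_eqF //=; apply/eqP; move: r0 h0; nra.
Qed.

End Quadratic.

(** * The discrete Cauchy-Pompeiu argument *)

Section Key.
Context {R : realType}.

Lemma ler_subsum (F : nat -> R) (j m M : nat) : (forall i, 0 <= F i) -> (j + m <= M)%N ->
  \sum_(s < m) F (j + s)%N <= \sum_(s < M) F s.
Proof.
move=> F0 jmM; rewrite -(big_mkord xpredT F) (big_cat_nat (n := j)) //=; last first.
  by apply: leq_trans jmM; exact: leq_addr.
rewrite (big_cat_nat (n := (j + m)%N) (m := j)) ?leq_addr //=.
have -> : \sum_(j <= s < j + m) F s = \sum_(s < m) F (j + s)%N.
  by rewrite -{1}[j]add0n big_addn addKn big_mkord; apply: eq_bigr => s _; rewrite addnC.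
rewrite -[leLHS]add0r; apply: lerD; first exact: sumr_ge0.
by rewrite -[leLHS]addr0; apply: lerD => //; exact: sumr_ge0.
Qed.

(** With this mesh the box reaches out to [4 r], and the square of [qcut_radial_eq], of side
    [r / 4], holds [m * m] points that contribute [4 h / (3 r^2)] each. The whole sum is about
    [16 pi m / r]; only the order matters. *)
Lemma qcut_winding (r h : R) (m : nat) : 0 < r -> (0 < m)%N -> h = r / (4 * m%:R) ->
  m%:R / (3 * r) <= - complex.Re (gsum h (16 * m) (fun z => db h (qcut r) z / z)).
Proof.
move=> r0 m0 hE; have mR : 1 <= m%:R :> R by rewrite ler1n.
have mR0 : 0 < m%:R :> R by rewrite ltr0n.
have h0 : 0 < h by rewrite hE divr_gt0 // mulr_gt0.
have hr : h <= r / 4.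
  rewrite hE invfM mulrA ler_pdivrMr // -[leLHS]mulr1; apply: ler_wpM2l => //.
  by rewrite divr_ge0 // ltW.
pose F j k : R := - complex.Re (db h (qcut r) (lpt h (16 * m) j.+1 k.+1) /
  lpt h (16 * m) j.+1 k.+1).
have F0 j k : 0 <= F j k by exact: qcut_radial.
have -> : - complex.Re (gsum h (16 * m) (fun z => db h (qcut r) z / z)) =
    \sum_(j < (2 * (16 * m)).-1) \sum_(k < (2 * (16 * m)).-1) F j k.
  rewrite /gsum raddf_sum -sumrN; apply: eq_bigr => j _.
  by rewrite raddf_sum -sumrN.
(* The indices [21 m] and [16 m] give the corner [(5 r / 4, 0)] of the square; the predecessors undo
   the shift by one in [gsum]. *)
have le1 : ((21 * m).-1 + m <= (2 * (16 * m)).-1)%N by lia.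
have le2 : ((16 * m).-1 + m <= (2 * (16 * m)).-1)%N by lia.
apply: le_trans (ler_subsum (fun j => \sum_(k < (2 * (16 * m)).-1) F j k) _ _ _ _ le1); last first.
  by move=> j; apply: sumr_ge0.
have hm : h * m%:R = r / 4 by rewrite hE; field; rewrite gt_eqF.
have E (s t : 'I_m) : F ((21 * m).-1 + s)%N ((16 * m).-1 + t)%N = 4 * h / (3 * r ^+ 2).
  have sm : 0 <= h * s%:R <= h * m%:R.
    by rewrite mulr_ge0 ?(ltW h0) //= ler_wpM2l ?(ltW h0) // ler_nat ltnW.
  have tm : 0 <= h * t%:R <= h * m%:R.
    by rewrite mulr_ge0 ?(ltW h0) //= ler_wpM2l ?(ltW h0) // ler_nat ltnW.
  have e1 : ((21 * m).-1 + s).+1 = (21 * m + s)%N by rewrite -addSn prednK ?muln_gt0.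
  have e2 : ((16 * m).-1 + t).+1 = (16 * m + t)%N by rewrite -addSn prednK ?muln_gt0.
  rewrite /F e1 e2; apply: qcut_radial_eq => //.
    by rewrite /= natrD !natrM !mulrBr !mulrDr; lra.
  by rewrite /= natrD !natrM !mulrBr !mulrDr; lra.
apply: (@le_trans _ _ (\sum_(s < m) \sum_(t < m) (4 * h / (3 * r ^+ 2)))).
  rewrite !sumr_const card_ord -mulrnA -(mulr_natl _ (m * m)) natrM.
  rewrite le_eqVlt; apply/orP; left; apply/eqP; rewrite hE; field.
  by rewrite !gt_eqF.
apply: ler_sum => s _.
apply: le_trans (ler_subsum (F ((21 * m).-1 + s)%N) _ _ _ (F0 _) le2).
by apply: ler_sum => t _; rewrite E.
Qed.

Variables (n : nat) (A : 'M[R[i]]_n) (a d : R).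
Hypotheses (n0 : (0 < n)%N) (a1 : 1 <= a) (aA : mxbound a A) (d0 : 0 < d) (d1 : d <= 1).

(** Equal to 1 where [smin A z <= d / 3] and to 0 where [smin A z >= 2 d / 3]. For a mesh
    [h <= d / 6] its differences live on [d / 6 <= smin A z <= d], where both the polynomial and the
    resolvent are under control. *)
Definition scut (z : R[i]) : R := clamp (2 - 3 * smin A z / d).

Lemma scut_ge1 z : smin A z <= d / 3 -> scut z = 1.
Proof.
move=> zd; apply: clamp_ge1.
have : 3 * smin A z / d <= 1 by rewrite ler_pdivrMr // mul1r mulrC -ler_pdivlMr.
lra.
Qed.

Lemma scut_le0 z : 2 * d / 3 <= smin A z -> scut z = 0.
Proof.
move=> zd; apply: clamp_le0.
have : 2 <= 3 * smin A z / d by rewrite ler_pdivlMr // (mulrC 3) -ler_pdivrMr.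
lra.
Qed.

Lemma db_scut (h : R) z : 0 < h -> h <= d / 6 ->
  smin A z <= d / 6 \/ d <= smin A z -> db h scut z = 0.
Proof.
move=> h0 hd [zd|zd].
  apply: (@db_const _ _ 1) => [|w wz]; first exact: ltW.
  apply: scut_ge1; apply: le_trans (smin_lip A w z n0) _.
  by apply: le_trans (lerD zd (le_trans wz hd)) _; move: d0; lra.
apply: (@db_const _ _ 0) => [|w wz]; first exact: ltW.
apply: scut_le0; have := smin_lip A z w n0; rewrite cabsB.
by move: (smin A z) (smin A w) (cabs _) zd wz d0 hd => *; lra.
Qed.

Lemma db_scut_bound (h : R) z : 0 < h -> cabs (db h scut z) <= 12 * h / d.
Proof.
move=> h0; apply: (@le_trans _ _ (4 * (3 / d) * h)); last first.
  by rewrite le_eqVlt; apply/orP; left; apply/eqP; ring.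
apply: db_lip => // {}z w; apply: le_trans (clamp_lip _ _) _.
have -> : 2 - 3 * smin A z / d - (2 - 3 * smin A w / d) =
    3 / d * (smin A w - smin A z).
  by move: (smin A z) (smin A w) => s t; ring.
rewrite normrM ger0_norm; last by rewrite divr_ge0 // ltW.
apply: ler_wpM2l; first by rewrite divr_ge0 // ltW.
have := smin_lip A w z n0; have := smin_lip A z w n0; rewrite (cabsB w z) ler_norml.
by move: (smin A z) (smin A w) (cabs _) => s t u ? ?; apply/andP; split; lra.
Qed.

End Key.

Opaque smin.

(** * Bounds for the terms of the lattice sums *)

Section KeyStep.
Context {R : realType}.
Variables (n : nat) (A : 'M[R[i]]_n) (a d : R).
Hypotheses (n0 : (0 < n)%N) (a1 : 1 <= a) (aA : mxbound a A) (d0 : 0 < d) (d1 : d <= 1).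
Variables (q : {poly R[i]}) (b : 'cV[R[i]]_n) (eta r L : R).
Hypotheses (eta0 : 0 <= eta) (qb : forall z, smin A z <= d -> cabs q.[z] <= eta).
Hypotheses (rE : r = 3 * L * a) (L2 : 2 <= L).

Let a0 : 0 < a. Proof. exact: lt_le_trans a1. Qed.
Let L0 : 0 < L. Proof. exact: lt_le_trans L2. Qed.
Let r0 : 0 < r. Proof. by rewrite rE !mulr_gt0. Qed.
Let La : 2 * a <= L * a. Proof. by rewrite ler_wpM2r // ltW. Qed.

Lemma db_scut_term h z (v : 'cV[R[i]]_n) : 0 < h -> h <= d / 6 ->
  vnorm (db h (scut n A d) z *: (q.[z] *: (resolvent A z *m v))) <=
  12 * h / d * (eta * ((d / 6)^-1 * vnorm v)).
Proof.
move=> h0 hd; have d6 : 0 < d / 6 by rewrite divr_gt0.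
have pos : 0 <= 12 * h / d * (eta * ((d / 6)^-1 * vnorm v)).
  by rewrite !mulr_ge0 ?invr_ge0 ?vnorm_ge0 ?eta0 ?(ltW h0) ?(ltW d0) ?(ltW d6).
have [zd|/ltW zd] := leP (smin A z) (d / 6).
  by rewrite (db_scut n A d n0 d0 h z h0 hd (or_introl zd)) scale0r vnorm0.
have [zd'|/ltW zd'] := leP d (smin A z).
  by rewrite (db_scut n A d n0 d0 h z h0 hd (or_intror zd')) scale0r vnorm0.
rewrite !vnormZ; apply: ler_pM; rewrite ?cabs_ge0 ?mulr_ge0 ?vnorm_ge0 ?cabs_ge0 //.
  exact: db_scut_bound.
apply: ler_pM; rewrite ?cabs_ge0 ?vnorm_ge0 //; first exact: qb.
exact: resolvent_bound.
Qed.

(** The two cutoffs agree near the spectrum: where [smin A z <= d / 3] the modulus of [z] is at most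
    [a + d / 3 <= r], so both equal 1. Elsewhere the mesh leaves level [d / 6] for the
    resolvents. *)
Lemma cut_diff h z (v : 'cV[R[i]]_n) : 0 < h -> h <= d / 6 ->
  vnorm ((qcut r z - scut n A d z)%:C *: Db h (fun w => resolvent A w *m v) z) <=
  4 * h ^+ 3 * (d / 6)^-1 ^+ 4 * vnorm v.
Proof.
move=> h0 hd; have d6 : 0 < d / 6 by rewrite divr_gt0.
have pos : 0 <= 4 * h ^+ 3 * (d / 6)^-1 ^+ 4 * vnorm v.
  by rewrite !mulr_ge0 ?exprn_ge0 ?invr_ge0 ?vnorm_ge0 ?ltW.
have [zd|/ltW zd] := leP (smin A z) (d / 3).
  rewrite scut_ge1 // qcut_near ?subrr ?scale0r ?vnorm0 //.
  have := smin_large A a z n0 aA.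
  by move: (smin A z) (cabs z) zd d1 a1 rE La => s t *; lra.
rewrite vnormZ cabs_real -[leRHS]mul1r; apply: ler_pM; rewrite ?vnorm_ge0 //.
  have := qcut01 r z; have := clamp01 (2 - 3 * smin A z / d).
  by rewrite ler_norml /scut => /andP[? ?] /andP[? ?]; apply/andP; split; lra.
apply: resolvent_Db_bound => //; apply: le_trans zd; move: hd; lra.
Qed.

(** Where the difference is nonzero, [cabs z > r / 2], so [smin A z >= 3 L a / 2 - a >= L a] and
    [A *m resolvent A z] has norm at most [1 / L]. *)
Lemma qcut_term h z (v : 'cV[R[i]]_n) : 0 < h -> h <= r / 4 ->
  `|complex.Re z| <= 4 * r -> `|complex.Im z| <= 4 * r ->
  vnorm ((db h (qcut r) z / z) *: (A *m (resolvent A z *m v))) <=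
  11 * h / r * (2 / r) * (L^-1 * vnorm v).
Proof.
move=> h0 hr xr yr.
have pos : 0 <= 11 * h / r * (2 / r) * (L^-1 * vnorm v).
  by rewrite !mulr_ge0 ?invr_ge0 ?vnorm_ge0 ?(ltW r0) ?(ltW h0) ?(ltW L0).
have [zr|zr] := leP (cabs z) (r / 2).
  by rewrite db_qcut_small // mul0r scale0r vnorm0.
rewrite vnormZ; apply: ler_pM; rewrite ?cabs_ge0 ?vnorm_ge0 //.
  rewrite cabsM cabsV; apply: ler_pM; rewrite ?invr_ge0 ?cabs_ge0 ?db_qcut_bound //.
  rewrite -[leRHS]invf_div lef_pV2 ?posrE ?divr_gt0 //; first exact: ltW.
  by apply: lt_trans zr; rewrite divr_gt0.
apply: le_trans (aA _) _.
have ts : L * a <= smin A z.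
  have := smin_large A a z n0 aA; move: (smin A z) (cabs z) zr rE La a1 => s t *; lra.
have t0 : 0 < L * a by exact: mulr_gt0.
have := resolvent_bound A z _ v t0 ts.
rewrite -(ler_pM2l a0) => /le_trans; apply.
by rewrite le_eqVlt; apply/orP; left; apply/eqP; field; rewrite !gt_eqF.
Qed.

(** From [z (z - A)^-1 = 1 + A (z - A)^-1]: the first part multiplies [v] by a scalar, the second is
    small by [qcut_term]. *)
Lemma qcut_split h z (v : 'cV[R[i]]_n) : 0 < h -> h <= r / 4 ->
  db h (qcut r) z *: (resolvent A z *m v) =
  (db h (qcut r) z / z) *: v + (db h (qcut r) z / z) *: (A *m (resolvent A z *m v)).
Proof.
move=> h0 hr; have [zr|zr] := leP (cabs z) (r / 2).
  by rewrite db_qcut_small // mul0r !scale0r addr0.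
have z0 : z != 0 by rewrite -cabs_gt0; apply: lt_trans zr; rewrite divr_gt0.
have u : z%:M - A \in unitmx.
  apply: smin_unit; have := smin_large A a z n0 aA.
  by move: (smin A z) (cabs z) zr rE La a1 => s t *; lra.
rewrite -scalerDr -scalerA; congr (_ *: _).
have {2}-> : v = (z%:M - A) *m (resolvent A z *m v) by rewrite mulmxA mulmxV // mul1mx.
by rewrite mulmxBl subrK mul_scalar_mx scalerA mulVf // scale1r.
Qed.

End KeyStep.

(** * Comparison of the two cutoffs and passage to the limit *)

Section Assemble.
Context {R : realType}.
Variables (n : nat) (A : 'M[R[i]]_n) (a d : R).
Hypotheses (n0 : (0 < n)%N) (a1 : 1 <= a) (aA : mxbound a A) (d0 : 0 < d) (d1 : d <= 1).
Variables (q : {poly R[i]}) (b : 'cV[R[i]]_n) (eta r L : R).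
Hypotheses (eta0 : 0 <= eta) (qb : forall z, smin A z <= d -> cabs q.[z] <= eta).
Hypotheses (rE : r = 3 * L * a) (L2 : 2 <= L).

Let a0 : 0 < a. Proof. exact: lt_le_trans a1. Qed.
Let L0 : 0 < L. Proof. exact: lt_le_trans L2. Qed.
Let r0 : 0 < r. Proof. by rewrite rE !mulr_gt0. Qed.
Let La : 2 * a <= L * a. Proof. by rewrite ler_wpM2r // ltW. Qed.

Let y := mxpoly_eval q A *m b.

Lemma scut_far z : 3 * r <= cabs z -> scut n A d z = 0.
Proof.
move=> zr; apply: scut_le0 => //; have := smin_large A a z n0 aA.
by move: (smin A z) (cabs z) zr rE La a1 d1 d0 => s t *; lra.
Qed.

(** The identity behind it is [e *: y = T1 - T3 - T4 - T5] with [e] the winding sum. [T1] carries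
    the bound on [q]; [T3] and [T4] are O(h) after summation by parts and make up [E / m]; [T5] is
    an O(1/L) fraction of the left side. *)
Lemma key_step : exists2 E : R, 0 <= E & forall (m : nat) (h : R),
  (0 < m)%N -> h = r / (4 * m%:R) -> h <= d / 6 ->
  vnorm y * (m%:R / (3 * r)) <= 256 * 72 * m%:R * (r / d ^+ 2 * (eta * vnorm b)) +
    E / m%:R + 256 * 22 * m%:R / (r * L) * vnorm y.
Proof.
have [g gK gE] := resolvent_poly A q b.
have [K K0 gKb] := gK (2 * (4 * r)).
exists (16 * K * r ^+ 3 + 64 * r ^+ 3 * (d / 6)^-1 ^+ 4 * vnorm y).
  by rewrite addr_ge0 ?mulr_ge0 ?exprn_ge0 ?invr_ge0 ?divr_ge0 ?vnorm_ge0 ?(ltW r0) ?(ltW d0).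
move=> m h m0 hE hd.
have mR0 : 0 < m%:R :> R by rewrite ltr0n.
have h0 : 0 < h by rewrite hE divr_gt0 // mulr_gt0.
have hr : h <= r / 4 by move: hd rE La a1 d1; lra.
have h1 : h <= 1 by move: hd d1; lra.
have [N NE] : {N | N = (16 * m)%N} by exists (16 * m)%N.
have hN : h * N%:R = 4 * r by rewrite NE natrM hE; field; rewrite gt_eqF.
have N1 : (1 < N)%N by rewrite NE (@leq_trans (16 * 1)) // leq_mul2l m0 orbT.
pose phi := scut n A d; pose Phi := qcut r.
have box z : inbox h N z -> `|complex.Re z| <= 4 * r /\ `|complex.Im z| <= 4 * r.
  by case; rewrite hN.
have pR z : h * N%:R - h <= `|complex.Re z| -> 3 * r <= cabs z.
  rewrite hN => zr; apply: le_trans (_ : `|complex.Re z| <= _).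
    by move: hr zr r0; lra.
  by rewrite ler_norml lerNl Re_le_cabs andbT -cabsN; apply: le_trans (Re_le_cabs _); case: (z).
have pI z : h * N%:R - h <= `|complex.Im z| -> 3 * r <= cabs z.
  rewrite hN => zr; apply: le_trans (Im_le_cabs z); move: hr zr r0; lra.
have PR z : h * N%:R - h <= `|complex.Re z| -> Phi z = 0.
  rewrite hN => zr; apply: qcut_far => //; left; move: hr zr r0; lra.
have PI z : h * N%:R - h <= `|complex.Im z| -> Phi z = 0.
  rewrite hN => zr; apply: qcut_far => //; right; move: hr zr r0; lra.
have sphi (V : lmodType R[i]) (f : R[i] -> V) :
    gsum h N (fun z => db h phi z *: f z) = - gsum h N (fun z => (phi z)%:C *: Db h f z).
  apply: sbp N1 (ltW h0) _ _ => z zr; apply: scut_far; first exact: pR.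
  exact: pI.
have sdiff (V : lmodType R[i]) (f : R[i] -> V) :
    gsum h N (fun z => db h (fun w => Phi w - phi w) z *: f z) =
    - gsum h N (fun z => (Phi z - phi z)%:C *: Db h f z).
  apply: sbp N1 (ltW h0) _ _ => z zr.
    by rewrite (PR _ zr) /phi scut_far ?subrr //; exact: pR.
  by rewrite (PI _ zr) /phi scut_far ?subrr //; exact: pI.
pose e : R[i] := gsum h N (fun z => db h Phi z / z).
pose T1 : 'cV[R[i]]_n := gsum h N (fun z => db h phi z *: (q.[z] *: (resolvent A z *m b))).
pose T3 : 'cV[R[i]]_n := gsum h N (fun z => db h phi z *: g z).
pose T4 : 'cV[R[i]]_n := gsum h N (fun z => (Phi z - phi z)%:C *: Db h (fun w => resolvent A w *m y) z).
pose T5 : 'cV[R[i]]_n := gsum h N (fun z => (db h Phi z / z) *: (A *m (resolvent A z *m y))).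
have T1E : T1 = gsum h N (fun z => db h phi z *: (resolvent A z *m y)) + T3.
  rewrite /T3 /T1 -gsumD; apply: eq_gsum => z; rewrite -scalerDr.
  (* The resolvent may fail to exist at low levels, but there the differences of the cutoff
     vanish. *)
  have [zd|zd] := leP (smin A z) (d / 6).
    by rewrite /phi (db_scut n A d n0 d0 h z h0 hd (or_introl zd)) !scale0r.
  rewrite -gE //; apply: smin_unit; apply: lt_trans zd; exact: divr_gt0.
have PhiE : gsum h N (fun z => db h Phi z *: (resolvent A z *m y)) = e *: y + T5.
  rewrite /e -gsum_scale -gsumD; apply: eq_gsum => z.
  exact: (@qcut_split R n A a n0 a1 aA r L rE L2).
have diffE : gsum h N (fun z => db h Phi z *: (resolvent A z *m y)) =
    gsum h N (fun z => db h phi z *: (resolvent A z *m y)) - T4.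
  rewrite /T4 -sdiff -gsumD; apply: eq_gsum => z.
  by rewrite dbB -scalerDl addrC subrK.
have alg (X S1 S3 S4 S5 S : 'cV[R[i]]_n) : S + S5 = X - S4 -> S1 = X + S3 ->
    S = S1 - S3 - S4 - S5 by move=> H ->; rewrite addrK -H addrK.
have ey : e *: y = T1 - T3 - T4 - T5.
  by apply: alg T1E; rewrite -diffE PhiE.
have B1 : vnorm T1 <= 4 * N%:R ^+ 2 * (12 * h / d * (eta * ((d / 6)^-1 * vnorm b))).
  rewrite /T1.
  apply: gsum_bound.
  - by exact: ltW.
  - move=> z _.
    exact: (@db_scut_term R n A d n0 d0 q eta eta0 qb h z b h0 hd).
  by rewrite !mulr_ge0 ?invr_ge0 ?divr_ge0 ?vnorm_ge0 ?eta0 ?(ltW h0) ?(ltW d0).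
have B3 : vnorm T3 <= 4 * N%:R ^+ 2 * (K * h ^+ 3).
  rewrite /T3 sphi vnormN; apply: gsum_bound => [|z zb|]; first exact: ltW.
    rewrite vnormZ cabs_real -[leRHS]mul1r; apply: ler_pM; rewrite ?vnorm_ge0 //.
      by have := clamp01 (2 - 3 * smin A z / d); rewrite /phi /scut ler_norml => /andP[? ?];
        apply/andP; split; lra.
    by apply: gKb; [rewrite -hN; exact: inbox_cabs | rewrite h0].
  by rewrite mulr_ge0 ?exprn_ge0 ?(ltW h0).
have B4 : vnorm T4 <= 4 * N%:R ^+ 2 * (4 * h ^+ 3 * (d / 6)^-1 ^+ 4 * vnorm y).
  apply: gsum_bound => [|z _|]; first exact: ltW.
    exact: (@cut_diff R n A a d n0 a1 aA d0 d1 r L rE L2).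
  by rewrite !mulr_ge0 ?exprn_ge0 ?invr_ge0 ?divr_ge0 ?vnorm_ge0 ?(ltW h0) ?(ltW d0).
have B5 : vnorm T5 <= 4 * N%:R ^+ 2 * (11 * h / r * (2 / r) * (L^-1 * vnorm y)).
  apply: gsum_bound => [|z /box[xr yr]|]; first exact: ltW.
    exact: (@qcut_term R n A a n0 a1 aA r L rE L2).
  by rewrite !mulr_ge0 ?invr_ge0 ?vnorm_ge0 ?(ltW r0) ?(ltW h0) ?(ltW L0).
have en : m%:R / (3 * r) <= cabs e.
  apply: le_trans (qcut_winding r h m r0 m0 hE) _.
  by rewrite -cabsN; apply: le_trans (Re_le_cabs _); rewrite /e NE; case: (gsum _ _ _).
have : cabs e * vnorm y <= vnorm T1 + vnorm T3 + vnorm T4 + vnorm T5.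
  rewrite -vnormZ ey; do 2 (apply: le_trans (vnormB _ _) _; rewrite lerD2r).
  exact: vnormB.
have := ler_wpM2l (vnorm_ge0 y) en; rewrite (mulrC _ (cabs e)) => /le_trans H /H {H}.
move/le_trans; apply.
apply: le_trans (lerD (lerD (lerD B1 B3) B4) B5) _.
rewrite le_eqVlt; apply/orP; left; apply/eqP; rewrite NE natrM hE; field.
by rewrite !gt_eqF.
Qed.

End Assemble.

Lemma pseudospectral_bound (R : realType) : exists2 K : R, 0 < K &
  forall (n : nat) (A : 'M[R[i]]_n) (a d eta : R) (q : {poly R[i]}) (b : 'cV[R[i]]_n),
  (0 < n)%N -> 1 <= a -> mxbound a A -> 0 < d <= 1 -> 0 <= eta ->
  (forall z, smin A z <= d -> cabs q.[z] <= eta) ->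
  vnorm (mxpoly_eval q A *m b) <= K * (a / d) ^+ 2 * eta * vnorm b.
Proof.
(* [256 * 22 / L <= 1 / 6] makes the last term of [key_step] at most half of its left side; any
   [L >= 33792] would do. *)
pose L : R := 200 * 200; have L2 : 2 <= L by rewrite /L; lra.
have L0 : 0 < L by exact: lt_le_trans L2.
have LK : 256 * 22 / L <= 6^-1 by rewrite ler_pdivrMr // /L; lra.
(* Forgets the value of [L]: from here on it is an atom with these three properties. *)
move: L L2 L0 LK => L L2 L0 LK.
have c0 : 0 < 6 * (256 * 72) :> R by lra.
have L3 : 0 < 3 * L by exact: mulr_gt0.
exists (6 * (256 * 72) * (3 * L) ^+ 2); first exact: mulr_gt0 c0 (exprn_gt0 2 L3).
clear c0 L3.
move=> n A a d eta q b n0 a1 aA /andP[d0 d1] eta0 qb.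
have a0 : 0 < a by exact: lt_le_trans a1.
pose r := 3 * L * a; have r0 : 0 < r by rewrite !mulr_gt0.
have [E E0 H] := @key_step R n A a d n0 a1 aA d0 d1 q b eta r L eta0 qb erefl L2.
set Y := vnorm _ in H *; set X := vnorm b in H *.
have -> : 6 * (256 * 72) * (3 * L) ^+ 2 * (a / d) ^+ 2 * eta * X =
    (256 * 72 * (r / d ^+ 2 * (eta * X))) * (6 * r) by rewrite /r; field; rewrite gt_eqF.
have r6 : 0 < 6 * r by rewrite mulr_gt0.
rewrite -ler_pdivrMr //; set Z := 256 * 72 * _.
rewrite leNgt; apply/negP => ZY; have e0 : 0 < Y / (6 * r) - Z by rewrite subr_gt0.
(* The first summand ensures [h <= d / 6]; the second makes [E] smaller than [m] times the supposed
   gap, which contradicts [key_step]. *)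
pose x := 6 * r / (4 * d) + E / (Y / (6 * r) - Z).
have x1 : 0 < 6 * r / (4 * d) by rewrite divr_gt0 // mulr_gt0.
have x2 : 0 <= E / (Y / (6 * r) - Z) by rewrite divr_ge0 // ltW.
have x0 : 0 <= x by rewrite addr_ge0 // ltW.
pose m := Num.bound x; have mx : x < m%:R by have := archi_boundP x0.
have m0 : (0 < m)%N by rewrite -(ltr0n R); apply: le_lt_trans mx.
have mR0 : 0 < m%:R :> R by rewrite ltr0n.
have m1 : 1 <= m%:R :> R by rewrite ler1n.
have hd : r / (4 * m%:R) <= d / 6.
  have : 6 * r / (4 * d) < m%:R by apply: le_lt_trans mx; rewrite lerDl.
  rewrite ltr_pdivrMr ?mulr_gt0 // => H1.
  rewrite ler_pdivrMr ?mulr_gt0 //; move: H1; rewrite (mulrC m%:R) => H1.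
  by have -> : d / 6 * (4 * m%:R) = (4 * d * m%:R) / 6 by [ring]; rewrite ler_pdivlMr // mulrC ltW.
have H2 := H m _ m0 erefl hd.
have H6 : E < m%:R * (Y / (6 * r)) - m%:R * Z.
  by rewrite -mulrBr -ltr_pdivrMr //; apply: le_lt_trans mx; rewrite lerDr ltW.
have Em : E / m%:R <= E by rewrite ler_pdivrMr // -[leLHS]mulr1; exact: ler_wpM2l.
have Y0 : 0 <= Y by exact: vnorm_ge0.
have H3 : 256 * 22 * m%:R / (r * L) * Y <= m%:R * (Y / (6 * r)).
  have -> : 256 * 22 * m%:R / (r * L) * Y = (m%:R * Y / r) * (256 * 22 / L).
    by field; rewrite !gt_eqF.
  have -> : m%:R * (Y / (6 * r)) = (m%:R * Y / r) * 6^-1 by field; rewrite gt_eqF.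
  by apply: ler_wpM2l => //; rewrite divr_ge0 ?mulr_ge0 // ltW.
have H4 : Y * (m%:R / (3 * r)) = 2 * (m%:R * (Y / (6 * r))) by field; rewrite gt_eqF.
have H5 : 256 * 72 * m%:R * (r / d ^+ 2 * (eta * X)) = m%:R * Z by rewrite /Z; ring.
move: H2 H6 H3 Em; rewrite H4 H5; set u := m%:R * (Y / _); set v := m%:R * Z.
by set w := _ / _ * Y; set e := E / _; move: u v w e => u v w e; clear; lra.
Qed.

(** * The orthogonal direction method *)

Section Orthodir.
Context {R : realType} {n : nat}.
Variables (A : 'M[R[i]]_n) (b : 'cV[R[i]]_n).
Implicit Types (u v x y r d : 'cV[R[i]]_n) (ps : seq ('cV[R[i]]_n * 'cV[R[i]]_n)).

(** Modified Gram-Schmidt: each coefficient is computed from the remainder left by the previous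
    projections. *)
Definition orthogonalize ps (uy : 'cV[R[i]]_n * 'cV[R[i]]_n) :=
  foldl (fun uy p => let c := dot p.1 uy.1 / dot p.1 p.1 in
    (uy.1 - c *: p.1, uy.2 - c *: p.2)) uy ps.

Record state := State { pairs : seq ('cV[R[i]]_n * 'cV[R[i]]_n);
  iterate : 'cV[R[i]]_n; resid : 'cV[R[i]]_n; dir : 'cV[R[i]]_n }.

Definition init := State [::] 0 b b.

(** The next direction is the last vector [A *m y] instead of the residual, so a step that leaves
    the residual unchanged does not stop the growth of the Krylov space. *)
Definition step (s : state) : state :=
  let uy := orthogonalize (pairs s) (A *m dir s, dir s) in
  let c := dot uy.1 (resid s) / dot uy.1 uy.1 in
  State (rcons (pairs s) uy) (iterate s + c *: uy.2) (resid s - c *: uy.1) uy.1.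

Lemma dotDr u v w : dot u (v + w) = dot u v + dot u w.
Proof. by rewrite /dot mulmxDr mxE. Qed.

Lemma dotBr u v w : dot u (v - w) = dot u v - dot u w.
Proof. by rewrite /dot mulmxBr mxE [X in _ + X]mxE. Qed.

Lemma dotZr u v c : dot u (c *: v) = c * dot u v.
Proof. by rewrite /dot -scalemxAr mxE. Qed.

Lemma dot_conj u v : dot v u = (dot u v)^*.
Proof.
rewrite !dotE rmorph_sum; apply: eq_bigr => i _.
by rewrite rmorphM mulrC; congr (_ * _); rewrite [RHS]conjcK.
Qed.

Lemma dot_self_eq0 u : dot u u = 0 -> u = 0.
Proof.
rewrite dot_vv => /(congr1 (@complex.Re R)) /= /eqP.
by rewrite sqrf_eq0 vnorm_eq0 => /eqP.
Qed.

(* The denominator vanishes only if [u = 0], and then division gives 0: the algorithm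
   needs no breakdown test. *)
Lemma dot_project u v : dot u (v - (dot u v / dot u u) *: u) = 0.
Proof.
rewrite dotBr dotZr; have [u0|u0] := eqVneq (dot u u) 0.
  by rewrite (dot_self_eq0 _ u0) /dot trmx0 map_mx0 !mul0mx mxE mulr0 subr0.
by rewrite divfK // subrr.
Qed.

(** The Krylov space; [k] counts coefficients and is one more than the degree. *)
Definition inK (k : nat) v := exists2 p : {poly R[i]}, (size p <= k)%N &
  v = mxpoly_eval p A *m b.

Lemma inK_le k l v : (k <= l)%N -> inK k v -> inK l v.
Proof. by move=> kl [p pk ->]; exists p => //; exact: leq_trans kl. Qed.

Lemma inKD k v w c : inK k v -> inK k w -> inK k (v + c *: w).
Proof.
move=> [p pk ->] [q qk ->]; exists (p + c *: q); last first.
  by rewrite mxpoly_evalD mxpoly_evalZ mulmxDl scalemxAl.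
rewrite (leq_trans (size_polyD _ _)) // geq_max pk.
exact: leq_trans (size_scale_leq _ _) qk.
Qed.

Lemma inKA k v : inK k v -> inK k.+1 (A *m v).
Proof.
move=> [p pk ->]; exists (p * 'X).
  by rewrite (leq_trans (size_polyMleq _ _)) // size_polyX addn2.
by rewrite mxpoly_evalMX mulmxA.
Qed.

(* [l] runs over the linear functionals: the last two clauses say that
   certain vectors lie in the span of the directions. *)
Definition invariant (j : nat) (s : state) := [/\ size (pairs s) = j,
  (forall p, p \in pairs s -> p.1 = A *m p.2 /\ inK j p.2) /\ inK j.+1 (dir s) /\
    inK j (iterate s),
  pairwise (fun p q => dot p.1 q.1 == 0) (pairs s) /\
  resid s = b - A *m iterate s /\ (forall p, p \in pairs s -> dot p.1 (resid s) = 0),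
  (forall l : 'rV[R[i]]_n, (forall p, p \in pairs s -> l *m p.2 = 0) ->
    l *m iterate s = 0 /\ forall m, (m < j)%N -> l *m (A ^+ m *m b) = 0)
  & forall l : 'rV[R[i]]_n, (forall p, p \in pairs s -> l *m p.2 = 0) ->
    l *m dir s = 0 -> (forall p, p \in pairs s -> l *m p.1 = 0) /\
    forall m, (m <= j)%N -> l *m (A ^+ m *m b) = 0].

Lemma orthogonalize_dot ps uy v : dot v uy.1 = 0 ->
  (forall p, p \in ps -> dot v p.1 = 0) -> dot v (orthogonalize ps uy).1 = 0.
Proof.
elim: ps uy => //= p ps IH uy vu vps; apply: IH => [|q qps] /=; last first.
  by apply: vps; rewrite inE qps orbT.
by rewrite dotBr dotZr vu vps ?inE ?eqxx // mulr0 subr0.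
Qed.

Lemma orthogonalizeP ps uy : pairwise (fun p q => dot p.1 q.1 == 0) ps ->
  forall p, p \in ps -> dot p.1 (orthogonalize ps uy).1 = 0.
Proof.
elim: ps uy => //= p ps IH uy /andP[/allP pps ops] q.
rewrite inE => /orP[/eqP ->|]; last exact: IH.
apply: orthogonalize_dot => [|p' /pps /eqP //]; exact: dot_project.
Qed.

Lemma orthogonalize_image ps uy : uy.1 = A *m uy.2 ->
  (forall p, p \in ps -> p.1 = A *m p.2) ->
  (orthogonalize ps uy).1 = A *m (orthogonalize ps uy).2.
Proof.
elim: ps uy => //= p ps IH uy Auy Aps; apply: IH => [|q qps] /=; last first.
  by apply: Aps; rewrite inE qps orbT.
by rewrite Auy mulmxBr -scalemxAr; congr (_ - _ *: _); apply: Aps; rewrite inE eqxx.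
Qed.

Lemma orthogonalize_inK k ps uy : inK k uy.2 ->
  (forall p, p \in ps -> inK k p.2) -> inK k (orthogonalize ps uy).2.
Proof.
elim: ps uy => //= p ps IH uy Kuy Kps; apply: IH => [|q qps] /=; last first.
  by apply: Kps; rewrite inE qps orbT.
by rewrite -scaleNr; apply: inKD => //; apply: Kps; rewrite inE eqxx.
Qed.

Lemma orthogonalize_functional (l : 'rV[R[i]]_n) ps uy :
  (forall p, p \in ps -> l *m p.2 = 0) ->
  l *m (orthogonalize ps uy).2 = l *m uy.2.
Proof.
elim: ps uy => //= p ps IH uy lps; rewrite IH /= => [|q qps]; last first.
  by apply: lps; rewrite inE qps orbT.
by rewrite mulmxBr -scalemxAr (lps p) ?inE ?eqxx // scaler0 subr0.
Qed.

Lemma invariant_init : invariant 0 init.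
Proof.
split => //=.
- split=> //; split.
    by exists 1%:P; rewrite ?size_polyC_leq1 // mxpoly_evalC mul1mx.
  by exists 0; rewrite ?size_poly0 // /mxpoly_eval size_poly0 big_ord0 mul0mx.
- by rewrite mulmx0 subr0.
- by move=> l _; rewrite mulmx0.
by move=> l _ lb; split=> // m; rewrite leqn0 => /eqP ->; rewrite expr0 mul1mx.
Qed.

Lemma invariant_step j s : invariant j s -> invariant j.+1 (step s).
Proof.
case: s => ps x r d [/= sj [pK [dK xK]] [po [rE ro]] lx ld].
set uy := orthogonalize ps (A *m d, d).
have Ay : uy.1 = A *m uy.2 by apply: orthogonalize_image => // p /pK[].
have yK : inK j.+1 uy.2.
  by apply: orthogonalize_inK => // p /pK[_]; exact: inK_le.
have lE (l : 'rV[R[i]]_n) : (forall p, p \in rcons ps uy -> l *m p.2 = 0) ->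
    (forall p, p \in ps -> l *m p.2 = 0) /\ l *m uy.2 = 0 /\ l *m d = 0.
  move=> H; have Hps p : p \in ps -> l *m p.2 = 0.
    by move=> pps; apply: H; rewrite mem_rcons inE pps orbT.
  have Hu : l *m uy.2 = 0 by apply: H; rewrite mem_rcons inE eqxx.
  by split=> //; split=> //; rewrite -Hu orthogonalize_functional.
have uo p : p \in ps -> dot p.1 uy.1 = 0 by exact: orthogonalizeP.
have pKS p : p \in rcons ps uy -> p.1 = A *m p.2 /\ inK j.+1 p.2.
  rewrite mem_rcons inE => /orP[/eqP -> //|/pK[-> pj]].
  by split=> //; exact: inK_le pj.
have lS (l : 'rV[R[i]]_n) : (forall p, p \in rcons ps uy -> l *m p.2 = 0) ->
    forall m, (m < j.+1)%N -> l *m (A ^+ m *m b) = 0.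
  by move=> /lE[Hps [_ Hd]] m mj; have [_ ->] := ld l Hps Hd.
split => /=.
- by rewrite size_rcons sj.
- split=> //; split; first by rewrite Ay; exact: inKA.
  by apply: inKD => //; exact: inK_le xK.
- split; first by rewrite pairwise_rcons po andbT; apply/allP => p /uo ->.
  split; first by rewrite rE mulmxDr -scalemxAr -Ay opprD addrA.
  move=> p; rewrite mem_rcons inE => /orP[/eqP ->|pps]; first exact: dot_project.
  by rewrite dotBr dotZr (ro p pps) (uo p pps) mulr0 subrr.
- move=> l Hl; split; last exact: lS.
  have [Hps [Hy _]] := lE l Hl; have [lx0 _] := lx l Hps.
  by rewrite mulmxDr lx0 -scalemxAr Hy scaler0 addr0.
move=> l Hl lu; have [Hps [Hy Hd]] := lE l Hl; have [lp lA] := ld l Hps Hd.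
have lps p : p \in rcons ps uy -> l *m p.1 = 0.
  by rewrite mem_rcons inE => /orP[/eqP ->|/lp].
split=> // -[|m] mj; first by rewrite lA.
(* The functional [l *m A] kills all second components because [l] kills the first ones, so [lS]
   applies to it with the lower power. *)
rewrite exprS -mulmxA mulmxA; apply: lS => // p pp.
by rewrite -mulmxA; have [<- _] := pKS p pp; exact: lps.
Qed.

Lemma invariant_iter k : invariant k (iter k step init).
Proof. by elim: k => [|k]; [exact: invariant_init | exact: invariant_step]. Qed.

Lemma vnorm_pythagoras u v : dot u v = 0 -> vnorm u <= vnorm (u + v).
Proof.
move=> uv; have vu : dot v u = 0 by rewrite dot_conj uv rmorph0.
rewrite -(@ler_pXn2r _ 2) ?nnegrE ?vnorm_ge0 //.
suff /(congr1 (@complex.Re R)) /= -> : (vnorm (u + v) ^+ 2)%:C =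
    (vnorm u ^+ 2 + vnorm v ^+ 2)%:C by rewrite lerDl sqr_ge0.
rewrite rmorphD /= -!dot_vv dotDr [dot (u + v) u]dot_conj [dot (u + v) v]dot_conj.
by rewrite !dotDr uv vu addr0 add0r -!dot_conj.
Qed.

(** The functional [(resid s)^t* *m A] kills all directions, hence by the invariant the whole Krylov
    space: the residual is orthogonal to its image under [A], and Pythagoras gives minimality.
    Degree at most [k] means [k + 1] coefficients, whence the [k.+1] steps. *)
Lemma orthodir_gmres k : gmres_output A b k (iterate (iter k.+1 step init)).
Proof.
move: (iter _ _ _) (invariant_iter k.+1) => s.
case=> _ [pK [_ [p pk xE]]] [_ [rE ro]] lx _.
exists p; split; [exact: pk | move=> q qk | exact: xE]; rewrite /gmres_residual -xE -rE.
set y := mxpoly_eval q A *m b.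
have -> : b - A *m y = resid s + (A *m iterate s - A *m y).
  by rewrite rE addrA subrK.
apply: vnorm_pythagoras; pose l := (resid s)^t* *m A.
have lp p' : p' \in pairs s -> l *m p'.2 = 0.
  move=> pp; rewrite /l -mulmxA; have [<- _] := pK _ pp.
  apply/matrixP => i0 j0; rewrite !ord1 [RHS]mxE -/(dot _ _) dot_conj ro //.
  exact: rmorph0.
have [lx0 lA] := lx l lp.
have dotA v : dot (resid s) (A *m v) = (l *m v) 0 0 by rewrite /dot mulmxA.
have ly : l *m y = 0.
  rewrite /y (mxpoly_eval_wide _ _ _ qk) mulmx_suml mulmx_sumr big1 // => i _.
  by rewrite -scalemxAl -scalemxAr lA // scaler0.
by rewrite dotBr !dotA lx0 ly mxE subrr.
Qed.

End Orthodir.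

(** * Programs for algebraic computation trees *)

Section Programs.
Context {I : Type} {F : numClosedFieldType} {n : nat}.
Variable input : I -> F.
Implicit Types (tmp ext : seq F) (o : operand I F).
Local Notation tree := (ctree I F n).
Local Notation run := (exec input).
Local Notation opval := (operand_val input).

(* Continuation-passing programs; the [nat] is the number of operations
   performed so far, that is, the index of the next [Temp]. *)
Definition prog (X : Type) := nat -> (nat -> X -> tree) -> tree.

Definition ret {X} (x : X) : prog X := fun c k => k c x.
Definition bind {X Y} (m : prog X) (f : X -> prog Y) : prog Y :=
  fun c k => m c (fun c' x => f x c' k).
Definition emit (a : arith_op I F) : prog (operand I F) :=
  fun c k => Compute a (k c.+1 (Temp _ _ c)).
(** The continuation is copied into both branches. The tree grows exponentially in the number of
    tests, but only the executed path is counted. *)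
Definition ifzero {X} o (m1 m2 : prog X) : prog X :=
  fun c k => IfZero o (m1 c k) (m2 c k).

(** A Hoare triple with cost. Each operation appends one value, so [size ext] is the operation
    count; [ext] and [x] are chosen before the continuation [k]. *)
Definition spec {X} tmp (m : prog X) (Q : seq F -> X -> Prop) (N : nat) :=
  exists ext x, [/\ Q (tmp ++ ext) x, (size ext <= N)%N & forall k,
    run (m (size tmp) k) tmp =
    let r := run (k (size (tmp ++ ext)) x) (tmp ++ ext) in (r.1, (r.2 + size ext)%N)].

Lemma spec_ret X (x : X) tmp Q N : Q tmp x -> spec tmp (ret x) Q N.
Proof.
move=> Qx; exists [::], x; rewrite cats0; split => // k.
by rewrite /= addn0; case: (run _ _).
Qed.

Lemma spec_bind X Y (m : prog X) (f : X -> prog Y) tmp Q Q' N1 N2 N :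
  spec tmp m Q N1 ->
  (forall ext x, Q (tmp ++ ext) x -> spec (tmp ++ ext) (f x) Q' N2) ->
  (N1 + N2 <= N)%N -> spec tmp (bind m f) Q' N.
Proof.
move=> [e1 [x1 [Q1 s1 E1]]] /(_ _ _ Q1) [e2 [x2 [Q2 s2 E2]]] le.
exists (e1 ++ e2), x2; rewrite catA; split => // [|k].
  by rewrite size_cat (leq_trans _ le) // leq_add.
by rewrite /bind E1 E2 /=; congr (_, _); rewrite [size (e1 ++ e2)]size_cat addnAC addnA.
Qed.

(** The range condition makes the value stable under appending: out of range, [nth] returns the
    default 0 now and possibly another value later. *)
Definition has tmp o (v : F) :=
  match o with Temp j => (j < size tmp)%N | _ => True end /\ opval tmp o = v.

Lemma has_cat tmp ext o v : has tmp o v -> has (tmp ++ ext) o v.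
Proof.
case: o => [i|c|j] [lt <-] //; split; last by rewrite /= nth_cat lt.
by rewrite size_cat ltn_addr.
Qed.

Lemma spec_emit tmp a : spec tmp (emit a) (fun t o => has t o (arith_op_val input tmp a)) 1.
Proof.
exists [:: arith_op_val input tmp a], (Temp _ _ (size tmp)); split => //.
  by split; rewrite ?size_cat ?addn1 //= nth_cat ltnn subnn.
by move=> k; rewrite /emit /= cats1 size_rcons addn1.
Qed.

Lemma spec_ifzero X tmp o (m1 m2 : prog X) Q N :
  spec tmp (if opval tmp o == 0 then m1 else m2) Q N -> spec tmp (ifzero o m1 m2) Q N.
Proof.
move=> [ext [x [Qx sN E]]]; exists ext, x; split => // k; rewrite -E /ifzero /=.
by case: ifP.
Qed.

Fixpoint foldM {J X} (f : J -> X -> prog X) (s : seq J) (x : X) : prog X :=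
  if s is j :: s' then bind (f j x) (foldM f s') else ret x.

Lemma spec_foldM J X W (f : J -> X -> prog X) (g : J -> W -> W)
    (rel : seq F -> X -> W -> Prop) (c : J -> nat) s tmp x w :
  (forall j ext x w, rel (tmp ++ ext) x w ->
    spec (tmp ++ ext) (f j x) (fun t x' => rel t x' (g j w)) (c j)) ->
  rel tmp x w ->
  spec tmp (foldM f s x) (fun t x' => rel t x' (foldl (fun w j => g j w) w s))
    (\sum_(j <- s) c j).
Proof.
elim: s tmp x w => [|j s IH] tmp x w H r /=; first exact: spec_ret.
apply: (spec_bind _ _ _ _ _ _ _ (c j) (\sum_(j <- s) c j)) => [|ext x' r'|].
- by have := H j [::] x w; rewrite cats0; apply.
- by apply: IH => // j' ext' x'' w'; rewrite -catA; exact: H.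
by rewrite big_cons.
Qed.

Definition hasv tmp (u : 'I_n -> operand I F) (v : 'cV[F]_n) :=
  forall i, has tmp (u i) (v i 0).

Lemma hasv_cat tmp ext u v : hasv tmp u v -> hasv (tmp ++ ext) u v.
Proof. by move=> H i; exact: has_cat. Qed.

Fixpoint tabulate (f : 'I_n -> prog (operand I F)) (s : seq 'I_n) :
    prog ('I_n -> operand I F) :=
  if s is i :: s' then bind (f i) (fun o => bind (tabulate f s') (fun u =>
    ret (fun j => if j == i then o else u j))) else ret (fun=> Const _ 0).

Lemma spec_tabulate f (v : 'cV[F]_n) (c : 'I_n -> nat) tmp :
  (forall i ext, spec (tmp ++ ext) (f i) (fun t o => has t o (v i 0)) (c i)) ->
  spec tmp (tabulate f (enum 'I_n)) (fun t u => hasv t u v) (\sum_i c i).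
Proof.
move=> H; rewrite -big_enum /=.
suff [ext [u [Q N E]]] : spec tmp (tabulate f (enum 'I_n)) (fun t u =>
    forall i, i \in enum 'I_n -> has t (u i) (v i 0)) (\sum_(i <- enum 'I_n) c i).
  by exists ext, u; split => // i; apply: Q; rewrite mem_enum.
elim: (enum _) tmp H => [|i s IH] tmp H /=; first exact: spec_ret.
apply: (spec_bind _ _ _ _ _ _ _ (c i) (\sum_(j <- s) c j)).
- by have := H i [::]; rewrite cats0; exact.
- move=> ext o ho; apply: (spec_bind _ _ _ _ _ _ _ (\sum_(j <- s) c j) 0).
  + by apply: IH => j ext'; rewrite -catA; exact: H.
  + move=> ext' u hu; apply: spec_ret => j; rewrite inE.
    by case: eqVneq => [-> _|_ /hu //]; exact: has_cat.
  + by rewrite addn0.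
by rewrite big_cons.
Qed.

Lemma foldl_add (J : Type) (G : J -> F) s w :
  foldl (fun w j => w + G j) w s = w + \sum_(j <- s) G j.
Proof.
elim: s w => [|j s IH] w /=; first by rewrite big_nil addr0.
by rewrite IH big_cons addrA.
Qed.

Definition dotM (u v : 'I_n -> operand I F) : prog (operand I F) :=
  foldM (fun i acc => bind (emit (Conj (u i))) (fun a =>
    bind (emit (Mul a (v i))) (fun m => emit (Add acc m)))) (enum 'I_n) (Const _ 0).

Lemma spec_dotM tmp u v (x y : 'cV[F]_n) : hasv tmp u x -> hasv tmp v y ->
  spec tmp (dotM u v) (fun t o => has t o (\sum_i Num.conj (x i 0) * y i 0)) (n * 3).
Proof.
move=> ux vy.
have := @spec_foldM _ _ _ (fun i acc => bind (emit (Conj (u i))) (fun a =>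
  bind (emit (Mul a (v i))) (fun m => emit (Add acc m))))
  (fun i w => w + Num.conj (x i 0) * y i 0) (fun t o w => has t o w) (fun=> 3)
  (enum 'I_n) tmp (Const _ 0) 0.
rewrite big_const_seq count_predT size_enum_ord iter_addn_0 mulnC.
rewrite foldl_add add0r big_enum; apply; last by split.
move=> i ext o w how.
apply: (spec_bind _ _ _ _ _ _ _ 1 2); [exact: spec_emit | move=> e1 a [_ ha] | by []].
apply: (spec_bind _ _ _ _ _ _ _ 1 1); [exact: spec_emit | move=> e2 m [_ hm] | by []].
have [_ how'] := has_cat _ (e1 ++ e2) _ _ how.
have [_ hv] := has_cat _ (ext ++ e1) _ _ (vy i).
have [_ hu] := has_cat _ ext _ _ (ux i).
have [e3 [z [Q S E]]] := spec_emit (((tmp ++ ext) ++ e1) ++ e2) (Add o m).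
exists e3, z; split => //; move: Q; rewrite /= hm /= ha /= hu.
by move: hv how'; rewrite !catA => -> ->.
Qed.

Definition axpyM (s : bool) (c : operand I F) (u v : 'I_n -> operand I F) :=
  tabulate (fun i => bind (emit (Mul c (v i))) (fun m =>
    emit (if s then Defs.Sub (u i) m else Add (u i) m))) (enum 'I_n).

Lemma spec_axpyM s tmp c u v a (x y : 'cV[F]_n) : has tmp c a -> hasv tmp u x ->
  hasv tmp v y -> spec tmp (axpyM s c u v)
    (fun t w => hasv t w (if s then x - a *: y else x + a *: y)) (n * 2).
Proof.
move=> hc ux vy.
have := @spec_tabulate (fun i => bind (emit (Mul c (v i))) (fun m =>
    emit (if s then Defs.Sub (u i) m else Add (u i) m)))
    (if s then x - a *: y else x + a *: y) (fun=> 2) tmp.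
rewrite sum_nat_const card_ord; apply=> i ext.
apply: (spec_bind _ _ _ _ _ _ _ 1 1); [exact: spec_emit | move=> e1 m [_ hm] | by []].
have [_ hc'] := has_cat _ ext _ _ hc; have [_ hv] := has_cat _ ext _ _ (vy i).
have [_ hu] := has_cat _ (ext ++ e1) _ _ (ux i).
have [e3 [z [Q S E]]] := spec_emit ((tmp ++ ext) ++ e1)
  (if s then Defs.Sub (u i) m else Add (u i) m).
exists e3, z; split => //; move: Q; move: hu; rewrite catA.
by case: (s) => /= ->; rewrite hm /= hc' hv !mxE.
Qed.

End Programs.

(** * The program for shatteredGMRES and its cost *)

Section ShatteredGMRES.
Context {R : realType} {n : nat}.
Local Notation F := R[i].
Local Notation oper := (operand (sg_slot n) F).
Local Notation vect := ('I_n -> oper).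

Definition rowM (f : 'I_n -> sg_slot n) (v : vect) : prog oper :=
  foldM (n := n) (fun j acc => ifzero (Input _ (f j)) (ret acc)
    (bind (emit (Mul (Input _ (f j)) (v j))) (fun m => emit (Add acc m))))
    (enum 'I_n) (Const _ 0).

(** The perturbed matrix is never formed: [M] and [N] act separately, at two operations per nonzero
    entry. [n] is fixed, so [sqrt n] sits in a constant, while [delta] is an input and costs one
    multiplication. *)
Definition matvecM (v : vect) : prog vect :=
  bind (emit (Mul (Const _ (10^-1 / Num.sqrt n%:R)%:C) (Input _ slot_delta)))
  (fun t => tabulate (fun i => bind (rowM (slot_M i) v) (fun s1 =>
     bind (rowM (slot_N i) v) (fun s2 => bind (emit (Mul t s2)) (fun m =>
     emit (Add s1 m))))) (enum 'I_n)).

Definition projectM (p uy : vect * vect) : prog (n := n) (vect * vect) :=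
  bind (dotM p.1 uy.1) (fun a => bind (dotM p.1 p.1) (fun q =>
  bind (emit (Div a q)) (fun c => bind (axpyM true c uy.1 p.1) (fun u =>
  bind (axpyM true c uy.2 p.2) (fun y => ret (u, y)))))).

Record ostate := OState { opairs : seq (vect * vect); oiterate : vect;
  oresid : vect; odir : vect }.

Definition stepM (s : ostate) : prog (n := n) ostate :=
  bind (matvecM (odir s)) (fun Ad =>
  bind (foldM projectM (opairs s) (Ad, odir s)) (fun uy =>
  bind (dotM uy.1 (oresid s)) (fun a => bind (dotM uy.1 uy.1) (fun q =>
  bind (emit (Div a q)) (fun c => bind (axpyM false c (oiterate s) uy.2) (fun x =>
  bind (axpyM true c (oresid s) uy.1) (fun r =>
  ret (OState (rcons (opairs s) uy) x r uy.1)))))))).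

Definition initM : ostate :=
  OState [::] (fun=> Const _ 0) (fun i => Input _ (slot_b i)) (fun i => Input _ (slot_b i)).

Definition loopM (k : nat) : prog ostate := foldM (fun (_ : nat) s => stepM s) (iota 0 k) initM.

Definition shattered_gmres (k : nat) : ctree (sg_slot n) F n :=
  loopM k.+1 0 (fun _ s => Return (oiterate s)).

Variables (delta : R) (M N : 'M[F]_n) (b : 'cV[F]_n).
Local Notation input := (sg_input delta M N b).
Local Notation A := (shattered delta M N).
Local Notation spec := (spec input).
Local Notation has := (has input).
Local Notation hasv := (hasv input).

Lemma spec_rowM tmp f (v : vect) (x : 'cV[F]_n) : hasv tmp v x ->
  spec tmp (rowM f v) (fun t o => has t o (\sum_j input (f j) * x j 0))
    (\sum_j 2 * (input (f j) != 0%R)).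
Proof.
move=> vx.
have := @spec_foldM _ F n input _ _ F (fun j acc => ifzero (Input _ (f j)) (ret acc)
    (bind (emit (Mul (Input _ (f j)) (v j))) (fun m => emit (Add acc m))))
  (fun j w => w + input (f j) * x j 0) (fun t o w => has t o w)
  (fun j => 2 * (input (f j) != 0%R))%N (enum 'I_n) tmp (Const _ 0) 0.
rewrite foldl_add add0r !big_enum; apply; last by split.
move=> j ext o w how; apply: spec_ifzero => /=; case: eqVneq => [->|_].
  by apply: spec_ret; rewrite mul0r addr0.
apply: (spec_bind _ _ _ _ _ _ _ _ 1 1); [exact: spec_emit | move=> e1 m [_ hm] | by []].
have [_ ho] := has_cat _ _ e1 _ _ how; have [_ hv] := has_cat _ _ ext _ _ (vx j).
by have := spec_emit (n := n) input ((tmp ++ ext) ++ e1) (Add o m); rewrite /= ho hm /= hv.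
Qed.

Definition matvec_cost := (1 + \sum_i (\sum_j 2 * (M i j != 0%R) +
  (\sum_j 2 * (N i j != 0%R) + 2)))%N.

Lemma spec_matvecM tmp (v : vect) (x : 'cV[F]_n) : hasv tmp v x ->
  spec tmp (matvecM v) (fun t o => hasv t o (A *m x)) matvec_cost.
Proof.
move=> vx; apply: spec_bind (leqnn _); first exact: spec_emit.
move=> e0 t ht; apply: spec_tabulate => i ext.
have vx1 := hasv_cat _ _ ext _ _ (hasv_cat _ _ e0 _ _ vx).
apply: spec_bind (leqnn _); first exact: spec_rowM vx1.
move=> e1 s1 h1; apply: spec_bind (leqnn _).
  exact: spec_rowM (hasv_cat _ _ e1 _ _ vx1).
move=> e2 s2 [_ h2].
apply: (spec_bind _ _ _ _ _ _ _ _ 1 1); [exact: spec_emit | move=> e3 m [_ hm] | by []].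
have [_ ht'] := has_cat _ _ (ext ++ e1 ++ e2) _ _ ht.
have [_ h1'] := has_cat _ _ (e2 ++ e3) _ _ h1.
have := spec_emit (n := n) input (((((tmp ++ e0) ++ ext) ++ e1) ++ e2) ++ e3) (Add s1 m).
move: ht' h1'; rewrite /= !catA => ht' h1'.
rewrite h1' hm /= ht' h2 /=.
have -> // : (A *m x) i 0 = \sum_j M i j * x j 0 +
    (10^-1 / Num.sqrt n%:R)%:C * delta%:C * \sum_j N i j * x j 0.
  rewrite /shattered mulmxDl -scalemxAl mxE [X in _ + X]mxE ![(_ *m _) i 0]mxE.
  by congr (_ + _ * _); rewrite -rmorphM /=; congr (_%:C); rewrite mulrAC.
Qed.

Fixpoint hasps (t : seq F) (ps : seq (vect * vect)) (qs : seq ('cV[F]_n * 'cV[F]_n)) :=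
  match ps, qs with
  | [::], [::] => True
  | p :: ps', q :: qs' => [/\ hasv t p.1 q.1, hasv t p.2 q.2 & hasps t ps' qs']
  | _, _ => False
  end.

Lemma hasps_cat t e ps qs : hasps t ps qs -> hasps (t ++ e) ps qs.
Proof.
elim: ps qs => [|p ps IH] [|q qs] //= [h1 h2 /IH h3].
by split; [exact: hasv_cat | exact: hasv_cat | exact: h3].
Qed.

Lemma hasps_rcons t ps qs p q : hasps t ps qs -> hasv t p.1 q.1 -> hasv t p.2 q.2 ->
  hasps t (rcons ps p) (rcons qs q).
Proof.
elim: ps qs => [|p' ps IH] [|q' qs] H h1 h2 /=.
- by split; [exact: h1 | exact: h2 |].
- by case: H.
- by case: H.
by case: H => g1 g2 /IH g3; split; [exact: g1 | exact: g2 | exact: g3].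
Qed.

Definition hass (t : seq F) (s : ostate) (w : state) :=
  [/\ hasps t (opairs s) (pairs w), hasv t (oiterate s) (iterate w),
  hasv t (oresid s) (resid w) & hasv t (odir s) (dir w)].

Lemma spec_dot tmp u v (x y : 'cV[F]_n) : hasv tmp u x -> hasv tmp v y ->
  spec tmp (dotM u v) (fun t o => has t o (dot x y)) (n * 3).
Proof. by move=> ux vy; rewrite dotE; exact: spec_dotM. Qed.

(** The cost is two inner products at [3 n], one division and two vector updates at [2 n]. *)
Lemma spec_projectM tmp p uy (q vz : 'cV[F]_n * 'cV[F]_n) :
  hasv tmp p.1 q.1 -> hasv tmp p.2 q.2 -> hasv tmp uy.1 vz.1 -> hasv tmp uy.2 vz.2 ->
  spec tmp (projectM p uy) (fun t o =>
    let c := dot q.1 vz.1 / dot q.1 q.1 in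
    hasv t o.1 (vz.1 - c *: q.1) /\ hasv t o.2 (vz.2 - c *: q.2)) (10 * n + 1).
Proof.
move=> p1 p2 u1 u2.
apply: (spec_bind _ _ _ _ _ _ _ _ (n * 3) (7 * n + 1)); last by lia.
  exact: spec_dot p1 u1.
move=> e1 a ha; apply: (spec_bind _ _ _ _ _ _ _ _ (n * 3) (4 * n + 1)); last by lia.
  by apply: spec_dot; apply: hasv_cat p1.
move=> e2 d hd; apply: (spec_bind _ _ _ _ _ _ _ _ 1 (4 * n)); last by lia.
  exact: spec_emit.
move=> e3 c; rewrite /= (has_cat _ _ _ _ _ ha).2 hd.2 => hc.
have lift (u : vect) v : hasv tmp u v -> hasv (((tmp ++ e1) ++ e2) ++ e3) u v.
  by move=> uv; do 3 apply: hasv_cat.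
apply: (spec_bind _ _ _ _ _ _ _ _ (n * 2) (n * 2)); last by lia.
  exact: (spec_axpyM input true _ _ _ _ _ _ _ hc (lift _ _ u1) (lift _ _ p1)).
move=> e4 u hu; apply: (spec_bind _ _ _ _ _ _ _ _ (n * 2) 0); last by lia.
  by apply: (spec_axpyM input true); [exact: has_cat hc| apply/hasv_cat/lift; exact: u2
    | apply/hasv_cat/lift; exact: p2].
by move=> e5 y hy; apply: spec_ret; split; [exact: hasv_cat hu | exact: hy].
Qed.

Lemma spec_orthogonalize ps qs tmp uy vz : hasps tmp ps qs ->
  hasv tmp uy.1 vz.1 -> hasv tmp uy.2 vz.2 ->
  spec tmp (foldM projectM ps uy) (fun t o =>
    hasv t o.1 (orthogonalize qs vz).1 /\ hasv t o.2 (orthogonalize qs vz).2)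
    (size qs * (10 * n + 1)).
Proof.
elim: ps qs tmp uy vz => [|p ps IH] [|q qs] tmp uy vz //= H u1 u2.
- by apply: spec_ret; split; [exact: u1 | exact: u2].
case: H => p1 p2 H.
apply: (spec_bind _ _ _ _ _ _ _ _ (10 * n + 1) (size qs * (10 * n + 1))).
- exact: spec_projectM p1 p2 u1 u2.
- by move=> e w [w1 w2]; apply: IH; [exact: hasps_cat | exact: w1 | exact: w2].
by rewrite mulSn.
Qed.

Lemma spec_stepM tmp s w : hass tmp s w ->
  spec tmp (stepM s) (fun t s' => hass t s' (step A w))
    (matvec_cost + (size (pairs w)).+1 * (10 * n + 1)).
Proof.
case: s w => ps x r d [qs x' r' d'] [/= hps hx hr hd].
apply: (spec_bind _ _ _ _ _ _ _ _ _ ((size qs).+1 * (10 * n + 1))); last exact: leqnn.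
  exact: spec_matvecM hd.
move=> e1 Ad hAd.
apply: (spec_bind _ _ _ _ _ _ _ _ (size qs * (10 * n + 1)) (10 * n + 1)).
- by apply: (spec_orthogonalize _ _ _ (Ad, d) (A *m d', d'));
    [exact: hasps_cat | exact: hAd | exact: hasv_cat].
- move=> e2 uy [hu hy].
  apply: (spec_bind _ _ _ _ _ _ _ _ (n * 3) (7 * n + 1)); last by lia.
    by apply: spec_dot; [exact: hu | apply/hasv_cat/hasv_cat; exact: hr].
  move=> e3 a ha; apply: (spec_bind _ _ _ _ _ _ _ _ (n * 3) (4 * n + 1)); last by lia.
    by apply: spec_dot; apply: hasv_cat hu.
  move=> e4 q hq; apply: (spec_bind _ _ _ _ _ _ _ _ 1 (4 * n)); last by lia.
    exact: spec_emit.
  move=> e5 c; rewrite /= (has_cat _ _ _ _ _ ha).2 hq.2 => hc.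
  have lift (u : vect) v : hasv ((tmp ++ e1) ++ e2) u v ->
      hasv (((((tmp ++ e1) ++ e2) ++ e3) ++ e4) ++ e5) u v.
    by move=> uv; do 3 apply: hasv_cat.
  have lift' (u : vect) v : hasv tmp u v -> hasv ((tmp ++ e1) ++ e2) u v.
    by move=> uv; do 2 apply: hasv_cat.
  apply: (spec_bind _ _ _ _ _ _ _ _ (n * 2) (n * 2)); last by lia.
    exact: (spec_axpyM input false _ _ _ _ _ _ _ hc (lift _ _ (lift' _ _ hx)) (lift _ _ hy)).
  move=> e6 x1 hx1; apply: (spec_bind _ _ _ _ _ _ _ _ (n * 2) 0); last by lia.
    by apply: (spec_axpyM input true); [exact: has_cat hc
      | apply/hasv_cat/lift/lift'; exact: hr | apply/hasv_cat/lift; exact: hu].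
  move=> e7 r1 hr1; apply: spec_ret.
  have hu' := hasv_cat _ _ e7 _ _ (hasv_cat _ _ e6 _ _ (lift _ _ hu)).
  have hy' := hasv_cat _ _ e7 _ _ (hasv_cat _ _ e6 _ _ (lift _ _ hy)).
  split; [|exact: hasv_cat hx1 | exact: hr1 | exact: hu'].
  apply: hasps_rcons; [|exact: hu' | exact: hy'].
  by do 7 apply: hasps_cat.
by rewrite mulSn addnC.
Qed.

Lemma spec_loop k i tmp s w : hass tmp s w ->
  spec tmp (foldM (fun (_ : nat) s => stepM s) (iota i k) s)
    (fun t s' => hass t s' (iter k (step A) w))
    (k * (matvec_cost + (size (pairs w) + k) * (10 * n + 1))).
Proof.
elim: k i tmp s w => [|k IH] i tmp s w H; first exact: spec_ret H.
apply: (spec_bind _ _ _ _ _ _ _ _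
  (matvec_cost + (size (pairs w)).+1 * (10 * n + 1))
  (k * (matvec_cost + ((size (pairs w)).+1 + k) * (10 * n + 1)))).
- exact: spec_stepM H.
- by move=> e s' H'; have := IH i.+1 _ _ _ H'; rewrite iterSr /= size_rcons.
rewrite [(k.+1 * _)%N]mulSn addSnnS; apply: leq_add => //.
by rewrite leq_add2l; apply: leq_mul => //; rewrite -addn1 leq_add2l.
Qed.

Lemma shattered_gmres_exec k :
  ctree_output input (shattered_gmres k) = iterate (iter k.+1 (step A) (init b)) /\
  (ctree_ops input (shattered_gmres k) <=
    k.+1 * (matvec_cost + k.+1 * (10 * n + 1)))%N.
Proof.
have H0 : hass [::] initM (init b).
  by split => //= i; split => //=; rewrite ?mxE.
have [ext [s [[_ hx _ _] sN E]]] := spec_loop k.+1 0 _ _ _ H0.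
rewrite /ctree_output /ctree_ops /shattered_gmres /loopM E /=; split => //.
by apply/matrixP => i j; rewrite ord1 mxE; have [] := hx i.
Qed.

End ShatteredGMRES.

(** * The sparse Gaussian noise *)

Section Tail.
Context {R : realType}.
Local Notation mu := (@lebesgue_measure R).

Lemma union_bound d (T : measurableType d) (P : probability T R) (I : finType)
    (F : I -> set T) (B : R) : (forall i, measurable (F i)) ->
  (forall i, (P (F i) <= B%:E)%E) ->
  measurable (\bigcup_i F i) /\ (P (\bigcup_i F i) <= (#|I|%:R * B)%:E)%E.
Proof.
move=> mF FB; have mU : measurable (\bigcup_i F i).
  by apply: fin_bigcup_measurable => // i _; exact: mF.
split=> //; apply: (@le_trans _ _ (\sum_(i \in [set` enum I]) P (F i))%E).
  apply: content_sub_fsum => //.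
  by move=> x [i _ Fix]; exists i => //=; rewrite mem_enum.
rewrite -fsbig_seq ?enum_uniq //; apply: le_trans (lee_sum _ (fun i _ => FB i)) _.
rewrite sumEFin lee_fin big_const_seq iter_addr_0 count_predT -cardE.
by rewrite mulr_natl.
Qed.

Lemma gaussian_product_integral :
  (\int[mu \x mu]_z (normal_pdf 0 1 z.1 * normal_pdf 0 1 z.2)%:E = 1)%E.
Proof.
have mf0 : measurable_fun setT
    ((fun z => normal_pdf 0 1 z.1 * normal_pdf 0 1 z.2) : R * R -> R).
  apply: measurable_funM.
    by apply: measurableT_comp => //; exact: measurable_normal_pdf.
  by apply: measurableT_comp => //; exact: measurable_normal_pdf.
have /measurable_EFinP mf := mf0.
rewrite fubini_tonelli1 //; last first.
  by move=> z; rewrite lee_fin mulr_ge0 ?normal_pdf_ge0.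
rewrite /fubini_F /=.
transitivity (\int[mu]_x (normal_pdf 0 1 x)%:E)%E; last exact: integral_normal_pdf.
apply: eq_integral => x _; under eq_integral do rewrite EFinM.
rewrite ge0_integralZl //.
- by rewrite integral_normal_pdf mule1.
- by apply/measurable_EFinP; exact: measurable_normal_pdf.
- by move=> y _; rewrite lee_fin normal_pdf_ge0.
by rewrite lee_fin normal_pdf_ge0.
Qed.

(** No polar coordinates: the density is [2 exp (- |z|^2 / 2)] times the product of two standard
    normal densities, and on the event the factor is at most [2 exp (- t^2 / 2)]. *)
Lemma gaussian_tail d (T : measurableType d) (P : probability T R) (g : T -> R[i]) (t : R) :
  std_complex_gaussian P g -> 0 <= t ->
  measurable [set w | t < cabs (g w)] /\
  (P [set w | (t < cabs (g w))%R] <= (2 * expR (- (t ^+ 2 / 2)))%R%:E)%E.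
Proof.
move=> [mg gP] t0.
pose B : set (R * R) := [set z | t ^+ 2 < z.1 ^+ 2 + z.2 ^+ 2].
have mB : measurable B.
  have -> : B = (fun z : R * R => z.1 ^+ 2 + z.2 ^+ 2) @^-1` `]t ^+ 2, +oo[.
    by apply/seteqP; split => z /=; rewrite in_itv /= andbT.
  rewrite -[X in measurable X]setTI.
  have mf : measurable_fun setT ((fun z => z.1 ^+ 2 + z.2 ^+ 2) : R * R -> R).
    by apply: measurable_funD; apply: measurable_funX.
  by apply: mf => //; exact: measurable_itv.
have BE : [set w | t < cabs (g w)] = (fun w => reim (g w)) @^-1` B.
  apply/seteqP; split => w /=; rewrite /B /reim /= -cabs_sqr.
    by rewrite ltr_pXn2r ?nnegrE ?cabs_ge0.
  by rewrite ltr_pXn2r ?nnegrE ?cabs_ge0.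
rewrite BE gP //; split; first by rewrite -[X in measurable X]setTI; exact: mg.
set c := 2 * expR _.
have c0 : 0 <= c by rewrite mulr_ge0 // expR_ge0.
have mf0 : measurable_fun setT
    ((fun z => normal_pdf 0 1 z.1 * normal_pdf 0 1 z.2) : R * R -> R).
  apply: measurable_funM.
    by apply: measurableT_comp => //; exact: measurable_normal_pdf.
  by apply: measurableT_comp => //; exact: measurable_normal_pdf.
have /measurable_EFinP mf := mf0.
have f0 z : (0 <= (normal_pdf 0 1 z.1 * normal_pdf 0 1 z.2 : R)%:E)%E.
  by rewrite lee_fin mulr_ge0 ?normal_pdf_ge0.
have md0 : measurable_fun setT
    ((fun z => pi^-1 * expR (- (z.1 ^+ 2 + z.2 ^+ 2))) : R * R -> R).
  apply: measurable_funM => //; apply: measurableT_comp => //.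
  by apply: measurableT_comp => //; apply: measurable_funD; apply: measurable_funX.
have /measurable_EFinP md := md0.
apply: (@le_trans _ _ (\int[mu \x mu]_(z in B)
    (c%:E * (normal_pdf 0 1 z.1 * normal_pdf 0 1 z.2)%:E))%E).
  apply: ge0_le_integral => //.
  - by move=> z _; rewrite lee_fin mulr_ge0 ?expR_ge0 ?invr_ge0 ?pi_ge0.
  - exact: measurable_funTS md.
  - by apply: measurable_funeM; apply: measurable_funTS.
  move=> z Bz; rewrite -EFinM lee_fin.
  have pdfE (x : R) : normal_pdf 0 1 x = (Num.sqrt (2 * pi))^-1 * expR (- (x ^+ 2 / 2)).
    rewrite normal_pdfE ?oner_eq0 // /normal_peak /normal_fun subr0 expr1n mul1r.
    by rewrite mulr_natl mulNr.
  have sq : Num.sqrt (2 * pi) * Num.sqrt (2 * pi) = 2 * pi :> R.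
    by rewrite -expr2 sqr_sqrtr // mulr_ge0 // pi_ge0.
  have s0 : Num.sqrt (2 * pi) != 0 :> R by rewrite gt_eqF // sqrtr_gt0 mulr_gt0 // pi_gt0.
  rewrite !pdfE /c; set s := Num.sqrt _ in sq s0 *.
  have -> : 2 * expR (- (t ^+ 2 / 2)) * (s^-1 * expR (- (z.1 ^+ 2 / 2)) *
      (s^-1 * expR (- (z.2 ^+ 2 / 2)))) = 2 * (s * s)^-1 *
      (expR (- (t ^+ 2 / 2)) * expR (- (z.1 ^+ 2 / 2)) * expR (- (z.2 ^+ 2 / 2))).
    by rewrite invfM; ring.
  rewrite sq -!expRD invfM mulrA divff // mul1r ler_pM2l ?invr_gt0 ?pi_gt0 //.
  by rewrite ler_expR; move: Bz; rewrite /B /=; lra.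
rewrite ge0_integralZl //; last by apply: measurable_funTS.
rewrite -[leRHS]mule1; apply: lee_wpmul2l; first by rewrite lee_fin.
by rewrite -gaussian_product_integral; apply: ge0_subset_integral.
Qed.

End Tail.

(** * The Bernoulli pattern of the noise *)

Section Sparse.
Context {R : realType}.

Lemma expR1_le4 : expR 1 <= 4 :> R.
Proof.
have -> : 1 = 2^-1 + 2^-1 :> R by lra.
have H : expR 2^-1 <= 2 :> R.
  have := expR_ge1Dx (- 2^-1 : R); rewrite expRN.
  have e0 := expR_gt0 (2^-1 : R).
  have -> : 1 + - 2^-1 = 2^-1 :> R by lra.
  by rewrite lef_pV2 // posrE.
have e0 := expR_ge0 (2^-1 : R).
by rewrite expRD; apply: (@le_trans _ _ (2 * 2)); [exact: ler_pM | lra].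
Qed.

(** A single term of the exponential series at [e l] gives [e^m l^m / m! <= exp (e l)]. The 5 is
    [e <= 4] plus the 1 that remains in the exponent. *)
Lemma pow_div_fact_le (l : R) (m : nat) : 0 <= l -> 5 * l <= m%:R -> (0 < m)%N ->
  l ^+ m / m`!%:R <= expR (- l).
Proof.
move=> l0 lm m0; have := expR_ge1Dxn m.-1 (mulr_ge0 (expR_ge0 1) l0).
rewrite prednK // => H.
have {H} : expR 1 ^+ m * (l ^+ m / m`!%:R) <= expR (expR 1 * l).
  by apply: le_trans H; rewrite exprMn mulrA lerDr.
rewrite -expRM_natl mulr1 mulrC -ler_pdivlMr ?expR_gt0 // => /le_trans; apply.
rewrite -expRN -expRD ler_expR.
have := ler_wpM2r l0 expR1_le4; lra.
Qed.

Lemma binomial_tail (n m : nat) (l : R) : (0 < n)%N -> 0 <= l -> 5 * l <= m%:R ->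
  (0 < m)%N -> 'C(n, m)%:R * (l / n%:R) ^+ m <= expR (- l).
Proof.
move=> n0 l0 lm m0; apply: le_trans (pow_div_fact_le l m l0 lm m0).
have nR : 0 < n%:R :> R by rewrite ltr0n.
have fR : 0 < m`!%:R :> R by rewrite ltr0n fact_gt0.
have ffact_le k : (n ^_ k <= n ^ k)%N.
  by elim: k => [|k IH] //; rewrite ffactnSr expnSr leq_mul // leq_subr.
rewrite expr_div_n mulrCA; apply: ler_wpM2l; first exact: exprn_ge0.
rewrite ler_pdivrMr ?exprn_gt0 // mulrC ler_pdivlMr // -natrM bin_ffact -natrX.
by rewrite ler_nat.
Qed.

Lemma subset_card (T : finType) (A : pred T) (m : nat) : (m <= #|A|)%N ->
  exists K : {set T}, #|K| = m /\ forall x, x \in K -> x \in A.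
Proof.
move=> mA; exists (finset (mem (take m (enum A)))); split.
  rewrite cardsE; have /card_uniqP -> : uniq (take m (enum A)).
    by rewrite take_uniq // enum_uniq.
  by rewrite size_take -cardE; case: ltngtP mA.
by move=> x; rewrite inE => /mem_take; rewrite mem_enum.
Qed.

Context d (T : measurableType d) (P : probability T R) (n : nat) (rho : R).
Variables (beta : 'I_n -> 'I_n -> T -> bool) (g : 'I_n -> 'I_n -> T -> R[i]).
Hypotheses (rho01 : 0 <= rho <= 1) (sg : sparse_gaussian P rho beta g).

Lemma measurable_beta i j : measurable (beta i j @^-1` [set true]).
Proof.
case: sg => /(_ i j) [mb _] _ _.
by rewrite -[X in measurable X]setTI; apply: mb.
Qed.

Lemma beta_prob i j : (P (beta i j @^-1` [set true]) = rho%:E)%E.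
Proof.
case: sg => /(_ i j) [_ ->] _ _; rewrite bernoulli_probE //.
by rewrite !diracE /= mem_set // memNset //= mule1 mule0 adde0.
Qed.

Lemma beta_all (J : {set 'I_n * 'I_n}) :
  measurable [set w | forall ij, ij \in J -> beta ij.1 ij.2 w] /\
  (P [set w | forall ij, ij \in J -> beta ij.1 ij.2 w] = (rho ^+ #|J|)%:E)%E.
Proof.
pose E (s : ('I_n * 'I_n) + ('I_n * 'I_n)) : set T :=
  match s with inl ij => beta ij.1 ij.2 @^-1` [set true] | inr _ => setT end.
pose J' : {set ('I_n * 'I_n) + ('I_n * 'I_n)} := inl @: J.
have EJ : [set w | forall ij, ij \in J -> beta ij.1 ij.2 w] = \bigcap_(s in [set` J']) E s.
  apply/seteqP; split => [w H s /= /imsetP[ij ijJ ->] //=|w H ij ijJ]; first exact: H.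
  exact: (H (inl ij) (imset_f inl ijJ)).
have mE s : measurable (E s).
  by rewrite /E; case: s => [ij|ij]; [exact: measurable_beta | exact: measurableT].
rewrite EJ; split; first by apply: fin_bigcap_measurable => // s _; exact: mE.
case: sg => _ _ ->; last first.
  by move=> s /imsetP[ij _ ->]; exists [set true].
rewrite big_imset /=; last by move=> x y _ _ [].
rewrite (eq_bigr (fun=> rho%:E)) => [|ij _]; last exact: beta_prob.
rewrite big_const; elim: #|J| => [|k IH] //=.
by rewrite IH exprS EFinM.
Qed.

(** A line with at least [m] ones contains an [m]-subset of ones, and by independence a given subset
    is all ones with probability [rho ^+ m]. The map [f] lets one proof serve rows and columns. *)
Lemma line_tail (f : 'I_n -> 'I_n -> 'I_n * 'I_n) (m : nat) :
  (forall i, injective (f i)) -> exists U : set T, [/\ measurable U,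
  (P U <= (n%:R * ('C(n, m)%:R * rho ^+ m))%:E)%E &
  forall w, ~ U w -> forall i, (#|[pred j | beta (f i j).1 (f i j).2 w]| < m)%N].
Proof.
move=> f_inj; pose I := ('I_n * {K : {set 'I_n} | #|K| == m})%type.
pose F (x : I) : set T := [set w | forall ij, ij \in f x.1 @: val x.2 -> beta ij.1 ij.2 w].
have mF x : measurable (F x) by have [] := beta_all (f x.1 @: val x.2).
have PF x : (P (F x) <= (rho ^+ m)%:E)%E.
  have [_ ->] := beta_all (f x.1 @: val x.2).
  by rewrite card_imset //; case: (x.2) => K /= /eqP ->.
have [mU PU] := union_bound _ _ P _ F (rho ^+ m) mF PF.
exists (\bigcup_x F x); split => //.
  suff -> : (n%:R * ('C(n, m)%:R * rho ^+ m)) = #|{: I}|%:R * rho ^+ m by [].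
  rewrite card_prod card_ord card_sig natrM -mulrA; congr (_ * (_%:R * _)).
  rewrite -[in LHS](card_ord n) -card_draws cardsE.
  by apply: eq_card => K; rewrite !inE.
move=> w Uw i; rewrite ltnNge; apply/negP => /subset_card[K [Km KA]].
apply: Uw; exists (i, exist _ K (introT eqP Km)) => // ij /imsetP[j jK ->] /=.
exact: KA jK.
Qed.

End Sparse.

(** Rows and columns cost [n exp (- L^6) <= 1 / n] each, the Gaussian entries
    [2 n^2 exp (- L^2 / 2) <= 2 / n]; both use [L >= 6]. *)
Lemma good_event (R : realType) d (T : measurableType d) (P : probability T R) (n : nat)
    (beta : 'I_n -> 'I_n -> T -> bool) (g : 'I_n -> 'I_n -> T -> R[i]) :
  (0 < n)%N -> 6 <= ln n%:R :> R -> ln n%:R ^+ 6 <= n%:R :> R ->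
  sparse_gaussian P (sg_rho R n) beta g ->
  exists E : set T, [/\ measurable E, ((1 - 4 / n%:R)%:E <= P E)%E &
  forall w, E w -> [/\ forall i, #|[pred j | beta i j w]|%:R <= 5 * ln n%:R ^+ 6 :> R,
    forall j, #|[pred i | beta i j w]|%:R <= 5 * ln n%:R ^+ 6 :> R &
    forall i j, cabs (g i j w) <= ln n%:R]].
Proof.
move=> n0 L6 Ln sg; have nR : 0 < n%:R :> R by rewrite ltr0n.
set L : R := ln n%:R in L6 Ln *; pose l := L ^+ 6.
have L0 : 0 <= L by apply: le_trans L6.
have l0 : 0 <= l by exact: exprn_ge0.
have rho01 : 0 <= sg_rho R n <= 1.
  by rewrite /sg_rho -/L divr_ge0 //= ler_pdivrMr // mul1r.
(* The successor makes [m > 5 l], while fewer than [m] ones still means at most [5 l]. *)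
pose m := (Num.truncn (5 * l)).+1.
have l5 : 0 <= 5 * l by exact: mulr_ge0.
have /andP[ml1 ml2] : (Num.truncn (5 * l))%:R <= 5 * l < m%:R by exact: truncn_itv.
have inj1 (i : 'I_n) : injective (fun j : 'I_n => (i, j)) by move=> x y [].
have inj2 (i : 'I_n) : injective (fun j : 'I_n => (j, i)) by move=> x y [].
have [U1 [mU1 PU1 HU1]] := line_tail _ _ _ _ _ _ _ rho01 sg (fun i j => (i, j)) m inj1.
have [U2 [mU2 PU2 HU2]] := line_tail _ _ _ _ _ _ _ rho01 sg (fun i j => (j, i)) m inj2.
pose F3 (ij : 'I_n * 'I_n) : set T := [set w | L < cabs (g ij.1 ij.2 w)].
have tail ij := gaussian_tail _ _ P (g ij.1 ij.2) L (let: And3 _ G _ := sg in G ij.1 ij.2) L0.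
have [mU3 PU3] := union_bound _ _ P _ F3 _ (fun ij => (tail ij).1) (fun ij => (tail ij).2).
have lnE : n%:R = expR L by rewrite lnK.
have b1 : n%:R * ('C(n, m)%:R * sg_rho R n ^+ m) <= n%:R^-1.
  apply: (@le_trans _ _ (n%:R * expR (- l))).
    by apply: ler_wpM2l => //; apply: binomial_tail => //; exact: ltW.
  rewrite lnE -expRN -expRD ler_expR.
  have : 6 * L <= l.
    rewrite /l exprSr; apply: ler_wpM2r => //; apply: le_trans (L6) _.
    by rewrite -[leLHS]expr1; apply: ler_weXn2l => //; apply: le_trans L6; rewrite ler1n.
  by move: (l) (L) L0; clear => x y; lra.
have b3 : #|{: 'I_n * 'I_n}|%:R * (2 * expR (- (L ^+ 2 / 2))) <= 2 * n%:R^-1.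
  rewrite card_prod card_ord natrM lnE mulrCA -!expRD -expRN ler_pM2l // ler_expR.
  have : 6 * L <= L ^+ 2 by rewrite expr2 ler_wpM2r.
  by move: (L) L0; clear => x x0; rewrite expr2; lra.
exists (~` (U1 `|` U2 `|` \bigcup_ij F3 ij)); split.
- by apply: measurableC; apply: measurableU => //; apply: measurableU.
- rewrite probability_setC; last by apply: measurableU => //; apply: measurableU.
  rewrite EFinB; apply: leeB => //.
  apply: le_trans (measureU2 _ _ mU3) _; first exact: measurableU.
  apply: (@le_trans _ _ ((n%:R^-1 + n%:R^-1)%:E + (2 * n%:R^-1)%:E)%E).
    apply: leeD; last by apply: le_trans PU3 _; rewrite lee_fin.
    apply: le_trans (measureU2 _ mU1 mU2) _; rewrite EFinD; apply: leeD.
      by apply: le_trans PU1 _; rewrite lee_fin.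
    by apply: le_trans PU2 _; rewrite lee_fin.
  by rewrite -EFinD lee_fin; move: (n%:R^-1); clear => x; lra.
move=> w /not_orP[/not_orP[w1 w2] w3]; split => [i|j|i j].
- apply: le_trans ml1; rewrite ler_nat -ltnS; exact: HU1 w1 i.
- apply: le_trans ml1; rewrite ler_nat -ltnS; exact: HU2 w2 j.
by rewrite leNgt; apply/negP => H; apply: w3; exists (i, j).
Qed.

(** * The theorem *)

Section Deterministic.
Context {R : realType} {n : nat}.
Implicit Types (A M N : 'M[R[i]]_n) (b : 'cV[R[i]]_n) (Omega : set R[i]).

(** The infimum need not be attained; the factor 2 leaves room for an actual polynomial. *)
Lemma approx_error_poly Omega (C alpha : R) (k : nat) : 0 < C -> 0 < alpha ->
  (approx_error Omega k <= (C * alpha ^+ k)%:E)%E ->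
  exists2 p : {poly R[i]}, (size p <= k.+1)%N &
    forall z, Omega z -> cabs (1 - z * p.[z]) <= 2 * C * alpha ^+ k.
Proof.
move=> C0 al0 H; have c0 : 0 < C * alpha ^+ k by rewrite mulr_gt0 ?exprn_gt0.
have : (approx_error Omega k < (2 * C * alpha ^+ k)%:E)%E.
  by apply: le_lt_trans H _; rewrite lte_fin; lra.
move=> /ereal_inf_lt[_ [p /= pk <-]] Hp; exists p => // z Oz.
rewrite -lee_fin; apply: le_trans (ltW Hp); apply: ereal_sup_ubound.
by exists z.
Qed.

Lemma pseudospectrum_disc M (delta : R) lambda (v : 'cV[R[i]]_n) z :
  M *m v = lambda *: v -> v != 0 -> cabs (z - lambda) <= delta ->
  pseudospectrum delta M z.
Proof.
move=> Mv v0 zl; apply: le_trans zl.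
have nv : 0 < vnorm v by rewrite vnorm_gt0.
rewrite -(ler_pM2r nv); apply: le_trans (sigma_min_le _ _) _.
by rewrite mulmxBl mul_scalar_mx Mv -scalerBl vnormZ.
Qed.

Lemma eigenvector_exists M : (0 < n)%N ->
  exists lambda (v : 'cV[R[i]]_n), M *m v = lambda *: v /\ v != 0.
Proof.
move=> n0; have [lambda /eigenvalueP[v vM v0]] := eigenvalue_closed M^T n0.
exists lambda, v^T; split; last by rewrite -trmx0 (inj_eq trmx_inj).
by apply: trmx_inj; rewrite trmx_mul trmxK vM linearZ /= trmxK.
Qed.

(* Lagrange interpolation at [lambda] and [lambda +- delta], evaluated at 0. *)
Lemma quadratic_lower_bound M Omega (delta a B : R) (p : {poly R[i]}) : (0 < n)%N ->
  0 < delta -> mxbound a M -> pseudospectrum delta M `<=` Omega -> (size p <= 2)%N ->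
  (forall z, Omega z -> cabs (1 - z * p.[z]) <= B) -> 1 <= 2 * B * (1 + a / delta) ^+ 2.
Proof.
move=> n0 d0 aM MO p2 pB; have [lambda [v [Mv v0]]] := eigenvector_exists M n0.
have nv : 0 < vnorm v by rewrite vnorm_gt0.
have la : cabs lambda <= a.
  by rewrite -(ler_pM2r nv) -vnormZ -Mv; exact: aM.
pose q z := 1 - z * p.[z].
have qB (x : R) : `|x| <= delta -> cabs (q (lambda + x%:C)) <= B.
  move=> xd; apply/pB/MO; apply: pseudospectrum_disc Mv v0 _.
  by rewrite addrC addKr cabs_real.
have dn : `|delta| <= delta by rewrite ger0_norm // ltW.
have B1 : cabs (q lambda) <= B by have := qB 0; rewrite addr0 normr0; apply; exact: ltW.
have B2 := qB delta dn.
have B3 : cabs (q (lambda - delta%:C)) <= B.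
  by have := qB (- delta); rewrite rmorphN normrN; apply.
pose s := - lambda / delta%:C.
have dC : delta%:C != 0 :> R[i] by rewrite -cabs_gt0 cabs_real normr_gt0 gt_eqF.
have qE z : q z = 1 - z * (p`_0 + p`_1 * z).
  rewrite /q (horner_coef_wide _ p2) !big_ord_recl big_ord0 /=.
  by rewrite expr0 mulr1 addr0 expr1.
have one : 1 = q lambda * (1 - s * s) + q (lambda + delta%:C) * (s * (s + 1) / 2) +
    q (lambda - delta%:C) * (s * (s - 1) / 2).
  by rewrite !qE /s; field.
have c1 : cabs 1 = 1 :> R by exact: cabs1.
have half x : cabs (x / 2) = cabs x / 2 :> R.
  by rewrite cabsM cabsV -(rmorph_nat (real_complex R)) cabs_real ger0_norm.
set S := cabs s; have S0 : 0 <= S by exact: cabs_ge0.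
have B0 : 0 <= B by apply: le_trans B1; exact: cabs_ge0.
have h1 : cabs (1 - s * s) <= 1 + S * S.
  by apply: le_trans (cabsD _ _) _; rewrite cabsN cabsM c1.
have h2 : cabs (s * (s + 1) / 2) <= S * (S + 1) / 2.
  rewrite half cabsM; apply: ler_wpM2r => //; apply: ler_wpM2l => //.
  by apply: le_trans (cabsD _ _) _; rewrite c1.
have h3 : cabs (s * (s - 1) / 2) <= S * (S + 1) / 2.
  rewrite half cabsM; apply: ler_wpM2r => //; apply: ler_wpM2l => //.
  by apply: le_trans (cabsD _ _) _; rewrite cabsN c1.
have : 1 <= B * (1 + S * S) + B * (S * (S + 1) / 2) + B * (S * (S + 1) / 2).
  rewrite -[leLHS]c1 {1}one; apply: le_trans (cabsD _ _) _; apply: lerD.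
    apply: le_trans (cabsD _ _) _; apply: lerD; rewrite cabsM;
    by apply: ler_pM; rewrite ?cabs_ge0.
  by rewrite cabsM; apply: ler_pM; rewrite ?cabs_ge0.
move/le_trans; apply.
have Sa : S <= a / delta.
  rewrite /S /s cabsM cabsN cabsV cabs_real (ger0_norm (ltW d0)).
  by apply: ler_wpM2r => //; rewrite invr_ge0 ltW.
apply: (@le_trans _ _ (2 * B * (1 + S) ^+ 2)).
  have : 0 <= B * S by exact: mulr_ge0.
  have : 0 <= B by [].
  rewrite expr2; clear -B0; nra.
apply: ler_wpM2l; first exact: mulr_ge0.
by rewrite ler_pXn2r ?nnegrE ?addr_ge0 ?lerD2l //; exact: le_trans Sa.
Qed.

(** Weyl's perturbation inequality, in the direction that places sublevel sets of the perturbed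
    matrix inside the pseudospectrum of [M]. *)
Lemma perturbed_smin M N (delta e : R) z : (0 < n)%N -> mxbound e N ->
  smin (M + N) z <= delta - e -> pseudospectrum delta M z.
Proof.
move=> n0 eN sz; rewrite /pseudospectrum /=.
have : sigma_min (z%:M - M) - e <= smin (M + N) z.
  apply: smin_ge => // v v1; have := sigma_min_le (z%:M - M) v; rewrite v1 mulr1.
  have -> : (z%:M - M) *m v = (z%:M - (M + N)) *m v + N *m v.
    by rewrite -mulmxDl opprD addrA subrK.
  have := vnormD ((z%:M - (M + N)) *m v) (N *m v); have := eN v; rewrite v1 mulr1.
  move: (sigma_min _) (vnorm _) (vnorm _) (vnorm _) => x1 x2 x3 x4; clear; lra.
by move: sz; move: (smin _ _) (sigma_min _); clear => x y; lra.
Qed.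

Lemma gmres_residual_poly A b p :
  gmres_residual A b p = vnorm (mxpoly_eval (1 - p * 'X) A *m b).
Proof.
have -> : 1 - p * 'X = 1%:P + (-1) *: (p * 'X) by rewrite scaleN1r.
rewrite mxpoly_evalD mxpoly_evalZ mxpoly_evalMX mxpoly_evalC scaleN1r mulmxBl mul1mx.
by rewrite /gmres_residual mulmxA.
Qed.

End Deterministic.

(** * Operation count and size of the noise *)

Lemma matvec_costE (R : realType) n (M N : 'M[R[i]]_n) :
  matvec_cost M N = (1 + (2 * nnz M + (2 * nnz N + 2 * n)))%N.
Proof.
rewrite /matvec_cost !nnzE !big_split /= sum_nat_const card_ord mulnC.
by rewrite !big_distrr /=; congr (1 + (_ + (_ + _)))%N; apply: eq_bigr => i _;
  rewrite big_distrr.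
Qed.

Lemma nnz_le_rows (R : realType) n (N : 'M[R[i]]_n) (m : R) :
  (forall i, #|[pred j | N i j != 0%R]|%:R <= m) -> (nnz N)%:R <= n%:R * m.
Proof.
move=> H; rewrite nnzE natr_sum -[in leRHS](card_ord n) mulr_natl -sumr_const.
apply: ler_sum => i _; apply: le_trans (H i); rewrite ler_nat -sum1_card.
by rewrite [leqRHS]big_mkcond /=; apply: leq_sum => j _; rewrite inE; case: (N i j != 0).
Qed.

Lemma ops_arith (R : realType) (x y l u v : R) : v * x <= v * (u * (5 * l)) ->
  0 <= v * y -> 0 <= v * u -> 0 <= v * u * l -> v * u <= v * v * u ->
  2 * v * (2 * y + 2 * x + 3 * u + 2 * v * (11 * u)) <= 80 * (v * y + v * u * l + v * v * u).
Proof. lra. Qed.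

Lemma ops_le (R : realType) n k (delta : R) (M N : 'M[R[i]]_n) (b : 'cV[R[i]]_n) :
  (0 < n)%N -> (0 < k)%N ->
  (forall i, #|[pred j | N i j != 0%R]|%:R <= 5 * ln n%:R ^+ 6 :> R) ->
  (ctree_ops (sg_input delta M N b) (shattered_gmres k))%:R <= 80 * ops_bound k M.
Proof.
move=> n0 k0 rowN; have [_ H] := shattered_gmres_exec delta M N b k.
(* Here [k.+1 <= 2 * k], because [k] is positive, and [10 * n + 1 <= 11 * n]. *)
apply: le_trans (_ : (2 * k * (2 * nnz M + 2 * nnz N + 3 * n + 2 * k * (11 * n)))%:R <= _).
  rewrite ler_nat; apply: leq_trans H _; rewrite matvec_costE; nia.
have := nnz_le_rows R n N _ rowN.
rewrite /ops_bound !(natrM, natrD); set x := (nnz N)%:R; set y := (nnz M)%:R.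
set l := ln _ ^+ 6; set u := n%:R; set v := k%:R => Hx.
have u1 : 1 <= u by rewrite ler1n.
have v1 : 1 <= v by rewrite ler1n.
have u0 : 0 <= u by exact: le_trans u1.
have v0 : 0 <= v by exact: le_trans v1.
have y0 : 0 <= y by [].
have l0 : 0 <= l by rewrite exprn_ge0 // ln_ge0.
have vx : v * x <= v * (u * (5 * l)) by exact: ler_wpM2l.
have vy : 0 <= v * y by exact: mulr_ge0.
have vul : 0 <= v * u * l by apply: mulr_ge0 => //; apply: mulr_ge0.
have vu : v * u <= v * v * u.
  by rewrite -mulrA ler_peMl // mulr_ge0.
by apply: ops_arith vx vy _ vul vu; exact: mulr_ge0.
Qed.

Lemma near_ln (R : realType) (B : R) : \forall n \near \oo, B <= ln n%:R.
Proof.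
exists (Num.bound (expR B)) => // n /= Hn.
have H : expR B < n%:R.
  apply: lt_le_trans (archi_boundP (expR_ge0 B)) _; by rewrite ler_nat.
rewrite -ler_expR lnK ?posrE; first exact: ltW.
by apply: lt_trans H; exact: expR_gt0.
Qed.

Lemma noise_mxbound (R : realType) (T : Type) n (beta : 'I_n -> 'I_n -> T -> bool)
    (g : 'I_n -> 'I_n -> T -> R[i]) (w : T) (m t : R) : 0 <= m -> 0 <= t ->
  (forall i, #|[pred j | beta i j w]|%:R <= m) ->
  (forall j, #|[pred i | beta i j w]|%:R <= m) ->
  (forall i j, cabs (g i j w) <= t) ->
  let N : 'M[R[i]]_n := \matrix_(i, j) ((beta i j w)%:R * g i j w) in
  mxbound (m * t) N /\ forall i, #|[pred j | N i j != 0%R]|%:R <= m.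
Proof.
move=> m0 t0 Hr Hc Hg N.
have Nb i j : N i j != 0 -> beta i j w.
  by rewrite mxE; case: (beta i j w); rewrite // mul0r eqxx.
have row i : #|[pred j | N i j != 0%R]|%:R <= m.
  apply: le_trans (Hr i); rewrite ler_nat; apply: subset_leq_card.
  by apply/fintype.subsetP => j; rewrite !inE; exact: Nb.
split=> //; apply: mxbound_schur => // [i j|j].
  rewrite mxE cabsM; case: (beta i j w); first by rewrite cabs1 mul1r.
  by rewrite cabs0 mul0r.
apply: le_trans (Hc j); rewrite ler_nat; apply: subset_leq_card.
by apply/fintype.subsetP => i; rewrite !inE; exact: Nb.
Qed.

(** [sqrt n = exp (L / 2)] exceeds the term [(L / 2)^8 / 8!] of its series. The power 7 is that of
    the noise norm: [L^6] nonzeros per line, entries of size [L]. *)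
Lemma ln_pow7_le (R : realType) (n : nat) : (0 < n)%N ->
  2 ^+ 8 * 8`!%:R <= ln n%:R :> R -> ln n%:R ^+ 7 <= Num.sqrt n%:R :> R.
Proof.
move=> n0; set L := ln _ => HL.
have nR : 0 < n%:R :> R by rewrite ltr0n.
have F0 : 0 < 2 ^+ 8 * 8`!%:R :> R by rewrite mulr_gt0 ?exprn_gt0 // ltr0n fact_gt0.
have L0 : 0 <= L by apply: le_trans HL; exact: ltW.
have -> : Num.sqrt n%:R = expR (L / 2).
  apply/eqP; rewrite -(@eqrXn2 _ 2) ?sqrtr_ge0 ?expR_ge0 // sqr_sqrtr ?ltW //.
  by rewrite expr2 -expRD -mulrDl -mulr2n -(mulr_natr L) mulfK // lnK.
have := @expR_ge1Dxn R (L / 2) 7 (divr_ge0 L0 (ler0n _ 2)).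
move=> H; apply: le_trans (_ : (L / 2) ^+ 8 / 8`!%:R <= _); last first.
  by apply: le_trans H; rewrite lerDr.
rewrite expr_div_n -mulrA -invfM ler_pdivlMr // (exprSr L 7).
by apply: ler_wpM2l => //; exact: exprn_ge0.
Qed.

(** * Logarithmic bookkeeping *)

Section Logs.
Context {R : realType}.
Variables (C1 cc nu delta eps : R).
Let L := ln nu.
Hypotheses (C0 : 0 < C1) (cc0 : 0 <= cc) (nu0 : 0 < nu) (L1 : 1 <= L) (CL : ln C1 <= L).
Hypotheses (d01 : 0 < delta < 1) (e01 : 0 < eps < 1).

Let X := ln (nu / delta) * L + ln eps^-1.

(** [X] is the numerator of the iteration bound. As [1 <= L], the terms [ln C1], [2 cc L] and
    [- 2 ln delta] are all absorbed by multiples of [ln (nu / delta) * L]. *)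
Lemma budget_ge : 0 <= X /\
  ln (C1 * (nu `^ cc) ^+ 2 / delta ^+ 2) + ln eps^-1 <= (3 + 2 * cc) * X.
Proof.
have [d0 d1] := andP d01; have [e0 e1] := andP e01.
have ld : ln delta <= 0 by apply: ln_le0; exact: ltW.
have le : ln eps <= 0 by apply: ln_le0; exact: ltW.
have P0 : 0 < nu `^ cc by exact: powR_gt0.
set x := - ln delta; set y := - ln eps.
have e1E : ln (nu / delta) = L + x by rewrite lnM ?posrE ?invr_gt0 // lnV ?posrE.
have e2E : ln eps^-1 = y by rewrite lnV ?posrE.
have e3E : ln (C1 * (nu `^ cc) ^+ 2 / delta ^+ 2) = ln C1 + 2 * (cc * L) + 2 * x.
  rewrite lnM ?posrE ?mulr_gt0 ?invr_gt0 ?exprn_gt0 // lnM ?posrE ?exprn_gt0 //.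
  by rewrite lnV ?posrE ?exprn_gt0 // !lnXn // ln_powR -/L /x mulrN !mulr_natl.
rewrite /X e1E e2E e3E.
have x0 : 0 <= x by rewrite oppr_ge0.
have y0 : 0 <= y by rewrite oppr_ge0.
have L0 : 0 <= L by exact: le_trans L1.
have xL : x <= x * L by exact: ler_peMr.
have LL : L <= L * L by exact: ler_peMr.
have cxL : 0 <= cc * (x * L) by rewrite !mulr_ge0.
have cLL : cc * L <= cc * (L * L) by exact: ler_wpM2l.
have cy : 0 <= cc * y by rewrite mulr_ge0.
have arith (u v l c z : R) : 0 <= u -> 0 <= v -> u <= u * l -> 0 <= c * (u * l) ->
    0 <= c * v -> l <= l * l -> c * l <= c * (l * l) -> z <= l -> 1 <= l -> 0 <= c ->
    0 <= (l + u) * l + v /\ z + 2 * (c * l) + 2 * u + v <= (3 + 2 * c) * ((l + u) * l + v).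
  by clear => *; split; lra.
exact: arith.
Qed.

Let Q := C1 * (nu `^ cc) ^+ 2 / delta ^+ 2.

Let Q0 : 0 < Q.
Proof.
have [d0 _] := andP d01.
by rewrite /Q mulr_gt0 ?invr_gt0 ?exprn_gt0 // mulr_gt0 ?exprn_gt0 // powR_gt0.
Qed.

Lemma enough_iterations alpha (k : nat) : 0 < alpha ->
  (3 + 2 * cc) * X <= k%:R * ln alpha^-1 -> Q * alpha ^+ k <= eps.
Proof.
move=> al0 H; have [_ HX] := budget_ge; have [e0 _] := andP e01.
have p0 : 0 < Q * alpha ^+ k by rewrite mulr_gt0 ?exprn_gt0.
have -> : (Q * alpha ^+ k <= eps) = (ln (Q * alpha ^+ k) <= ln eps) by rewrite ler_ln ?posrE.
have -> : ln (Q * alpha ^+ k) = ln Q + k%:R * ln alpha.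
  by rewrite lnM ?posrE ?exprn_gt0 // lnXn // mulr_natl.
move: (le_trans HX H); rewrite !lnV ?posrE // mulrN.
by rewrite -/Q; move: (ln Q) (ln eps) (_ * _) => x y z; lra.
Qed.

Lemma rate_le_budget alpha : 0 < alpha -> 1 <= Q * alpha ->
  ln alpha^-1 <= (3 + 2 * cc) * X.
Proof.
move=> al0 H; have [_ HX] := budget_ge; have [e0 e1] := andP e01.
have : ln 1 <= ln (Q * alpha) by rewrite ler_ln ?posrE ?ltr01 ?(mulr_gt0 Q0).
have le : ln eps <= 0 by apply: ln_le0; exact: ltW.
rewrite ln1 lnM ?posrE //; move: HX; rewrite !lnV ?posrE //.
by rewrite -/Q; move: (ln Q) le (_ * X) (ln alpha); move: (ln eps) => x y ? z t; lra.
Qed.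

End Logs.

Theorem theorem6p1 (R : realType) (C c : R) (C_gt0 : 0 < C) :
  exists (K : R) (iters : nat -> R -> R -> R -> nat)
         (alg : forall n k : nat, ctree (sg_slot n) R[i] n),
    [/\ 0 < K,
        forall (n : nat) (alpha eps delta : R), (0 < n)%N ->
          0 < alpha < 1 -> 0 < eps < 1 -> 0 < delta < 1 ->
          (iters n alpha eps delta)%:R <= K * iteration_bound n alpha eps delta,
        forall n k : nat, implements_shatteredGMRES k (alg n k)
      & forall eta : R, 0 < eta ->
        \forall n \near \oo,
        forall (Omega : set R[i]) (alpha eps delta : R)
               (M : 'M[R[i]]_n) (b : 'cV[R[i]]_n)
               (d : measure_display) (T : measurableType d)
               (P : probability T R)
               (beta : 'I_n -> 'I_n -> T -> bool)
               (g : 'I_n -> 'I_n -> T -> R[i]),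
          0 < alpha < 1 ->
          (forall k : nat, (approx_error Omega k <= (C * alpha ^+ k)%:E)%E) ->
          0 < eps < 1 -> 0 < delta < 1 ->
          opnorm M <= n%:R `^ c ->
          pseudospectrum delta M `<=` Omega ->
          sparse_gaussian P (sg_rho R n) beta g ->
          let k := iters n alpha eps delta in
          prob_at_least P
            [set w | let N := noise_matrix beta g w in
               (forall x, gmres_output (shattered delta M N) b k x ->
                  approx_solution eps delta M b x) /\
               (ctree_ops (sg_input delta M N b) (alg n k))%:R
                 <= K * ops_bound k M]
            (1 - eta)].
Proof.
have [kap kap0 key] := pseudospectral_bound R.
(* The absolute value ensures [n ^ cc >= 1], also for negative [c]. *)
pose cc := `|c|; have cc0 : 0 <= cc by exact: normr_ge0.
(* [K0] is the constant of [budget_ge]; [K] doubles it to pay for rounding down and adds the 80 of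
   [ops_le]. *)
pose K0 := 3 + 2 * cc; have K03 : 3 <= K0 by rewrite lerDl mulr_ge0.
pose K := 2 * K0 + 80; have KK0 : 2 * K0 <= K by rewrite lerDl.
have K80 : 80 <= K by rewrite lerDr mulr_ge0 // (le_trans _ K03).
have Kp : 0 < K by apply: lt_le_trans K80.
have ib0 n (alpha eps delta : R) : (0 < n)%N -> 0 < alpha < 1 -> 0 < eps < 1 -> 0 < delta < 1 ->
    0 <= iteration_bound n alpha eps delta.
  move=> n0 /andP[a0 a1] /andP[e0 e1] /andP[d0 d1]; rewrite /iteration_bound.
  have n1 : 1 <= n%:R :> R by rewrite ler1n.
  have h1 : 0 <= ln (n%:R / delta).
    by apply: ln_ge0; rewrite ler_pdivlMr // mul1r; apply: le_trans n1; exact: ltW.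
  have h2 (x : R) : 0 < x -> x < 1 -> 0 <= ln x^-1.
    by move=> x0 x1; apply: ln_ge0; rewrite invf_ge1 // ltW.
  apply: divr_ge0; last exact: h2.
  by apply: addr_ge0; [apply: mulr_ge0 => //; exact: ln_ge0 | exact: h2].
exists K, (fun n alpha eps delta => Num.truncn (K * iteration_bound n alpha eps delta)).
exists (fun n k => shattered_gmres k); split => //.
- move=> n alpha eps delta n0 al01 e01 d01.
  by have /andP[] := truncn_itv (mulr_ge0 (ltW Kp) (ib0 n _ _ _ n0 al01 e01 d01)).
- move=> n k delta M N b; have [-> _] := shattered_gmres_exec delta M N b k.
  exact: orthodir_gmres.
(* 32 is 16 from [(2 a / (delta / 2)) ^+ 2] times the 2 of [approx_error_poly]. 16 is the 2 of
   [quadratic_lower_bound], again that 2, and 4 from [1 + a / delta <= 2 a / delta]. *)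
move=> eta eta0; pose C1 := 32 * kap * C; pose C2 := 16 * C.
pose B0 := 6 + 2 ^+ 8 * 8`!%:R + `|ln C1| + `|ln C2| + 4 / eta.
apply: filterS (near_ln R B0) => n HB Omega alpha eps delta M b d T P beta g.
move=> al01 Happ e01 d01 Mc MO sg.
pose k := Num.truncn (K * iteration_bound n alpha eps delta); rewrite /= -/k.
have [al0 al1] := andP al01; have [e0 e1] := andP e01; have [d0 d1] := andP d01.
pose L : R := ln n%:R.
have F8 : 0 <= 2 ^+ 8 * 8`!%:R :> R by rewrite mulr_ge0.
have E4 : 0 < 4 / eta by rewrite divr_gt0.
have [L6 L8 LC1 LC2 Leta] : [/\ 6 <= L, 2 ^+ 8 * 8`!%:R <= L, ln C1 <= L, ln C2 <= L &
    4 / eta <= L].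
  move: HB (ler_norm (ln C1)) (ler_norm (ln C2)) (normr_ge0 (ln C1)) (normr_ge0 (ln C2)) F8 E4.
  rewrite /B0 -/L; move: (2 ^+ 8 * _) (ln C1) (ln C2) (L) (4 / eta).
  clear => f u v l e *; split; lra.
have L1 : 1 <= L by apply: le_trans L6; rewrite ler1n.
have n0 : (0 < n)%N.
  by rewrite lt0n; apply/eqP => n00; move: L1; rewrite /L n00 ln0 // leNgt ltr01.
have nR : 0 < n%:R :> R by rewrite ltr0n.
have n1 : 1 <= n%:R :> R by rewrite ler1n.
pose a : R := n%:R `^ cc.
have a1 : 1 <= a by rewrite -(powRr0 n%:R); apply: ler_powR.
have a0 : 0 < a by apply: lt_le_trans a1.
have aM : mxbound a M.
  move=> v; apply: le_trans (opnorm_mxbound M v) _; apply: ler_wpM2r; first exact: vnorm_ge0.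
  by apply: le_trans Mc _; apply: ler_powR => //; exact: ler_norm.
have C10 : 0 < C1 by rewrite !mulr_gt0.
have C20 : 0 < C2 by rewrite mulr_gt0.
pose X := ln (n%:R / delta) * ln n%:R + ln eps^-1.
have [X0 _] := budget_ge C1 cc n%:R delta eps C10 cc0 nR L1 LC1 d01 e01.
have la0 : 0 < ln alpha^-1 by rewrite ln_gt0 // invf_gt1.
have kE : k = Num.truncn (K * iteration_bound n alpha eps delta) by [].
have /andP[_ ktr] := truncn_itv (mulr_ge0 (ltW Kp) (ib0 n _ _ _ n0 al01 e01 d01)).
rewrite -kE /iteration_bound -/X mulrA ltr_pdivrMr // in ktr.
have K0X : 0 <= K0 * X by rewrite mulr_ge0 // (le_trans _ K03).
have KX : 2 * (K0 * X) <= K * X by rewrite mulrA; exact: ler_wpM2r.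
have rate : ln alpha^-1 <= K0 * X.
  have [p p2 Hp] := approx_error_poly Omega C alpha 1 C_gt0 al0 (Happ 1%N).
  have := quadratic_lower_bound M Omega delta a _ p n0 d0 aM MO p2 Hp.
  move=> H; apply: (rate_le_budget C2 cc n%:R delta eps C20 cc0 nR L1 LC2 d01 e01 _ al0).
  apply: le_trans H _; rewrite -/a.
  have -> : C2 * a ^+ 2 / delta ^+ 2 * alpha = 2 * (2 * C * alpha ^+ 1) * (2 * (a / delta)) ^+ 2.
    by rewrite /C2; field; rewrite gt_eqF.
  apply: ler_wpM2l; first by rewrite !mulr_ge0 // ?expr1 ltW.
  have ad : 1 <= a / delta by rewrite ler_pdivlMr // mul1r (le_trans (ltW d1)).
  by rewrite ler_pXn2r ?nnegrE //; move: (a / delta) ad; clear => s s1; lra.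
(* [ops_bound] vanishes at [k = 0], so that case has to be excluded. *)
have k0 : (0 < k)%N.
  rewrite lt0n; apply/eqP => k00; move: ktr rate K0X KX; rewrite k00 mul1r.
  by move: (K * X) (K0 * X) (ln _); clear => x y z; lra.
(* As [k.+1 <= 2 * k], rounding down loses no more than the factor 2 built into [K]. *)
have kX : K0 * X <= k%:R * ln alpha^-1.
  have : k.+1%:R * ln alpha^-1 <= 2 * (k%:R * ln alpha^-1).
    rewrite mulrA; apply: ler_wpM2r; first exact: ltW.
    by rewrite -natrM ler_nat mul2n -addnn -addn1 leq_add2l.
  move: ktr KX; move: (K * X) (K0 * X) (_ * ln _) (k%:R * _); clear => *; lra.
have small := enough_iterations C1 cc n%:R delta eps C10 cc0 nR L1 LC1 d01 e01 alpha k al0 kX.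
have sqn : L ^+ 7 <= Num.sqrt n%:R by exact: ln_pow7_le.
have s0 : 0 < Num.sqrt n%:R :> R by rewrite sqrtr_gt0.
have sq1 : Num.sqrt n%:R <= n%:R :> R.
  have sq : Num.sqrt n%:R * Num.sqrt n%:R = n%:R :> R.
    by rewrite -expr2 sqr_sqrtr //; exact: ltW.
  rewrite -[leRHS]sq; apply: ler_peMr; last by rewrite -[leLHS]sqrtr1 ler_sqrt.
  exact: sqrtr_ge0.
have L0 : 0 <= L by apply: le_trans L1.
have L6n : L ^+ 6 <= n%:R.
  apply: le_trans sq1; apply: le_trans sqn; rewrite (exprS L 6).
  by apply: ler_peMl => //; exact: exprn_ge0.
have [E [mE PE HE]] := good_event R _ T P n beta g n0 L6 L6n sg.
exists E; split => //; last first.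
  apply: le_trans PE; rewrite lee_fin lerD2l lerN2.
  rewrite ler_pdivrMr // mulrC -ler_pdivrMr //; apply: le_trans Leta _.
  have := expR_ge1Dx L; rewrite /L lnK ?posrE // -/L.
  by move: (L) (n%:R); clear => x y; lra.
move=> w /HE[Hr Hc Hg] /=; set N := noise_matrix beta g w.
have L60 : 0 <= 5 * ln n%:R ^+ 6 :> R by rewrite mulr_ge0 ?exprn_ge0.
have [Nb Nrow] := noise_mxbound R T n beta g w _ _ L60 L0 Hr Hc Hg.
split; last first.
  apply: le_trans (ops_le R n k delta M N b n0 k0 Nrow) _.
  apply: ler_wpM2r => //; rewrite /ops_bound !addr_ge0 ?mulr_ge0 ?exprn_ge0 //.
pose tau := 10^-1 * delta / Num.sqrt n%:R.
have tau0 : 0 <= tau by rewrite !mulr_ge0 ?invr_ge0 ?sqrtr_ge0 ?ltW.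
(* The norm of [N] is at most [5 L^7 <= 5 sqrt n], and [0.1 * 5 = 1 / 2]. The other half of [delta]
   is the level at which the pseudospectral bound is applied to [A]. *)
have tNb : mxbound (delta / 2) (tau%:C *: N).
  move=> v; rewrite -scalemxAl vnormZ cabs_real ger0_norm //.
  apply: le_trans (ler_wpM2l tau0 (Nb v)) _; rewrite mulrA.
  apply: ler_wpM2r; first exact: vnorm_ge0.
  have -> : delta / 2 = tau * (5 * Num.sqrt n%:R) by rewrite /tau; field; rewrite gt_eqF.
  apply: ler_wpM2l => //; rewrite -mulrA; apply: ler_wpM2l => //.
  by rewrite -exprSr.
have [p pk Hp] := approx_error_poly Omega C alpha k C_gt0 al0 (Happ k).
move=> x [p0 [p0k p0min xE]].
pose A := shattered delta M N.
have Ab : mxbound (2 * a) A.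
  move=> v; rewrite /A /shattered mulmxDl; apply: le_trans (vnormD _ _) _.
  have av : delta / 2 * vnorm v <= a * vnorm v.
    apply: ler_wpM2r; first exact: vnorm_ge0.
    by move: a1 d1 d0; clear; lra.
  apply: le_trans (lerD (aM v) (le_trans (tNb v) av)) _.
  by rewrite -mulrA mulr_natl mulr2n.
have res : gmres_residual A b p0 <= eps * vnorm b.
  apply: le_trans (p0min p pk) _; rewrite gmres_residual_poly.
  have d2 : 0 < delta / 2 <= 1 by move: d0 d1; clear; lra.
  have a2 : 1 <= 2 * a by move: a1; clear; lra.
  have e2 : 0 <= 2 * C * alpha ^+ k by rewrite !mulr_ge0 ?exprn_ge0 ?ltW.
  apply: le_trans (key n A (2 * a) (delta / 2) _ (1 - p * 'X) b n0 a2 Ab d2 e2 _) _.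
    move=> z sz; rewrite hornerD hornerN hornerMX hornerC mulrC; apply/Hp/MO.
    apply: (perturbed_smin M (tau%:C *: N) delta (delta / 2) z n0 tNb).
    by apply: le_trans sz _; move: (delta); clear => y; lra.
  apply: ler_wpM2r; first exact: vnorm_ge0.
  apply: le_trans small; rewrite le_eqVlt; apply/orP; left; apply/eqP.
  have alg (t y z u v : R) : z != 0 ->
      t * (2 * y / (z / 2)) ^+ 2 * (2 * u * v) = 32 * t * u * y ^+ 2 / z ^+ 2 * v.
    by move=> z0; field.
  by apply: alg; rewrite gt_eqF.
(* The noise itself is the backward error in [M], and the GMRES residual, up to sign, the one in
   [b]. *)
exists (tau%:C *: N), (A *m x - b); split.
- by rewrite [RHS]addrC subrK.
- apply: mxbound_opnorm; first exact: ltW.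
  move=> v; apply: le_trans (tNb v) _; apply: ler_wpM2r; first exact: vnorm_ge0.
  by move: d0; clear; lra.
by rewrite -vnormN opprB xE; exact: res.
Qed.
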